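(* Let $N,m\geq 1$ be integers, let $\Omega\subset\mathbb{R}^N$ be a bounded domain, $q\geq 1$, $r\geq 0$ and $u\in L^\infty(\Omega,\mathbb{R}^m)$. Then $$\liminf_{\varepsilon\to0^+}\Big(\int_{S^{N-1}}\int_\Omega\chi_\Omega(x+\varepsilon n)\frac{|u(x+\varepsilon n)-u(x)|^q}{\varepsilon^r}\,dx\,d\mathcal{H}^{N-1}(n)\Big)\leq(N+r)\limsup_{s\to+\infty}\Big\{s\,\mathcal{L}^{2N}\Big(\Big\{(x,y)\in\Omega\times\Omega:\frac{|u(y)-u(x)|^q}{|y-x|^{r+N}}>s\Big\}\Big)\Big\},$$ and $$\limsup_{\varepsilon\to0^+}\Big(\int_{S^{N-1}}\int_\Omega\chi_\Omega(x+\varepsilon n)\frac{|u(x+\varepsilon n)-u(x)|^q}{\varepsilon^r}\,dx\,d\mathcal{H}^{N-1}(n)\Big)\geq N\,\liminf_{s\to+\infty}\Big\{s\,\mathcal{L}^{2N}\Big(\Big\{(x,y)\in\Omega\times\Omega:\frac{|u(y)-u(x)|^q}{|y-x|^{r+N}}>s\Big\}\Big)\Big\}.$$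
   Context: A domain is a connected open set. $\chi_\Omega(z)=1$ for $z\in\Omega$ and $\chi_\Omega(z)=0$ for $z\in\mathbb{R}^N\setminus\Omega$; an integrand with the factor $\chi_\Omega(x+\varepsilon n)$ is understood to be $0$ when $x+\varepsilon n\notin\Omega$. $|\cdot|$ is the Euclidean norm, $\mathcal{L}^{2N}$ is Lebesgue measure in $\mathbb{R}^{2N}$, $\mathcal{H}^{N-1}$ is the $(N-1)$-dimensional Hausdorff measure and $S^{N-1}$ is the unit sphere in $\mathbb{R}^N$. *)

(* Defs.v *)
From HB Require Import structures.
From mathcomp Require Import all_boot all_order all_algebra.
From mathcomp Require Import all_classical all_reals all_analysis.
From mathcomp Require Import ess_sup_inf.

Set Implicit Arguments.
Unset Strict Implicit.
Unset Printing Implicit Defensive.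
Import Order.TTheory GRing.Theory Num.Theory.
Import numFieldNormedType.Exports.

Local Open Scope classical_set_scope.
Local Open Scope ring_scope.

(* The Euclidean norm: the library norm `|x| on 'rV[R]_n is the sup norm, which
   induces the same topology and the same bounded sets. *)
Definition enorm {R : realType} {n : nat} (x : 'rV[R]_n) : R :=
  Num.sqrt (\sum_(i < n) x 0 i ^+ 2).

Section countable_cover.
Local Open Scope ereal_scope.
Context {R : realType} {I T : Type}.
Variables (D : set I) (P : I -> set T) (c : I -> \bar R).
Hypothesis c_ge0 : forall i, 0 <= c i.

(* Covers are at most countable families, encoded as nat -> option I, with None
   contributing the empty set at cost 0. *)
Definition countable_cover (A : set T) : set (nat -> option I) :=
  [set F | (forall k i, F k = Some i -> D i) /\
           A `<=` \bigcup_k oapp P set0 (F k)].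

Definition cover_measure (A : set T) : \bar R :=
  ereal_inf [set \sum_(k <oo) oapp c 0 (F k) | F in countable_cover A].

Let oc_ge0 (o : option I) : 0 <= oapp c 0 o.
Proof. by case: o => //= i; exact: c_ge0. Qed.

Lemma cover_measure_ge0 A : 0 <= cover_measure A.
Proof.
by apply: le_ereal_inf_tmp => _ [F _ <-]; exact: nneseries_ge0.
Qed.

Lemma cover_measure0 : cover_measure set0 = 0.
Proof.
apply/eqP; rewrite eq_le cover_measure_ge0 andbT.
apply: ereal_inf_lbound; exists (fun=> None); first by split.
by rewrite eseries0.
Qed.

Lemma le_cover_measure : {homo cover_measure : A B / A `<=` B >-> A <= B}.
Proof.
move=> A B AB; apply: ereal_inf_le_tmp => _ [F [DF BF] <-].
by exists F => //; split => //; exact: subset_trans BF.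
Qed.

Lemma cover_measure_sigma_subadditive : sigma_subadditive cover_measure.
Proof.
move=> A; have [[i ioo]|] := pselect (exists i, cover_measure (A i) = +oo).
  rewrite (eseries_pinfty _ _ ioo) ?leey// => n _.
  by rewrite -ltNye (lt_le_trans _ (cover_measure_ge0 _)).
rewrite -forallNE => Aoo.
suff add2e (e : {posnum R}) : cover_measure (\bigcup_n A n) <=
    \sum_(i <oo) cover_measure (A i) + e%:num%:E.
  by apply/lee_addgt0Pr => _/posnumP[].
rewrite (le_trans _ (epsilon_trick _ _ _))//; last first.
  by move=> n; exact: cover_measure_ge0.
pose Q n F := countable_cover (A n) F /\ \sum_(k <oo) oapp c 0 (F k) <=
  cover_measure (A n) + (e%:num / (2 ^ n.+1)%:R)%:E.
have [G QG] : {G : nat -> nat -> option I & forall n, Q n (G n)}.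
  apply: (@choice _ _ Q) => n; rewrite /Q.
  have en1 : (0 < e%:num / (2 ^ n.+1)%:R)%R by [].
  have fA : cover_measure (A n) \is a fin_num.
    by rewrite ge0_fin_numE ?cover_measure_ge0// ltey; apply/eqP/Aoo.
  have [_ [F cF <-] lt_F] := lb_ereal_inf_adherent en1 fA.
  by exists F; split => //; exact/ltW.
pose g := oapp c 0 \o uncurry G.
have g_ge0 x : 0 <= g x by exact: oc_ge0.
apply: (@le_trans _ _ (\esum_(i in setT) g i)).
  apply: ereal_inf_lbound => /=.
  have /card_esym/ppcard_eqP[f] := card_nat2.
  exists (uncurry G \o f).
    split=> [k i /=|t [i _ At]].
      by case: (f k) => a b /=; exact: (QG a).1.1.
    have [j _ Gijt] := (QG i).1.2 _ At.
    by exists (f^-1%FUN (i, j)) => //=; rewrite invK ?inE.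
  by rewrite -(esum_pred_image g _ xpredT) ?[fun=> _]set_true// image_eq.
rewrite (_ : esum _ _ = \sum_(i <oo) \sum_(j <oo) oapp c 0 (G i j)).
  by apply: lee_nneseries => n *; [exact: nneseries_ge0|exact: (QG n).2].
pose J : nat -> set (nat * nat) := fun i => [set (i, j) | j in setT].
rewrite (_ : setT = \bigcup_k J k); last first.
  by rewrite predeqE => -[a b]; split => // _; exists a => //; exists b.
rewrite esum_bigcupT //=; last first.
  apply/trivIsetP => i j _ _ ij.
  rewrite predeqE => -[n m] /=; split => //= -[] [_] _ [<-{n} _].
  by move=> [m' _] [] /esym/eqP; rewrite (negbTE ij).
rewrite -(image_id [set: nat]) -fun_true esum_pred_image//; last first.
  by move=> n _; exact: esum_ge0.
apply: eq_eseriesr => /= j _.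
rewrite -(esum_pred_image g (pair j) predT)//=; last first.
  by move=> ? ? _ _; exact: (@can_inj _ _ _ snd).
by congr esum; rewrite predeqE => -[a b]; split; move=> [i _ <-]; exists i.
Qed.

End countable_cover.

Section lebesgue.
Context {R : realType} {n : nat}.
Implicit Types ab : 'rV[R]_n * 'rV[R]_n.

Definition box ab : set 'rV[R]_n :=
  [set x | forall i, ab.1 0 i < x 0 i <= ab.2 0 i].

Definition box_volume ab : \bar R :=
  (\prod_(i < n) `|ab.2 0 i - ab.1 0 i|)%:E.

Definition lebesgue_outer : set 'rV[R]_n -> \bar R :=
  cover_measure
    [set ab : 'rV[R]_n * 'rV[R]_n | forall i, ab.1 0 i <= ab.2 0 i]
    box box_volume.

Let box_volume_ge0 ab : (0 <= box_volume ab)%E.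
Proof. by rewrite lee_fin prodr_ge0. Qed.

HB.instance Definition _ := isOuterMeasure.Build R 'rV[R]_n lebesgue_outer
  (cover_measure0 _ _ box_volume_ge0) (cover_measure_ge0 _ _ box_volume_ge0)
  (@le_cover_measure _ _ _ _ _ _)
  (cover_measure_sigma_subadditive _ _ box_volume_ge0).

End lebesgue.

Section hausdorff.
Local Open Scope ereal_scope.
Context {R : realType} {n : nat}.
Implicit Types (E A : set 'rV[R]_n).

Definition diameter E : \bar R :=
  ereal_sup [set (enorm (x.1 - x.2))%:E | x in E `*` E].

Definition unit_ball_volume k : \bar R :=
  lebesgue_outer [set x : 'rV[R]_k | (enorm x <= 1)%R].

Variable k : nat.

(* Only used for diameter E <= delta; [fine] sends diameter set0 = -oo to 0. *)
Definition hausdorff_cost E : \bar R :=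
  unit_ball_volume k * ((fine (diameter E) / 2) ^+ k)%:E.

Definition hausdorff_delta (delta : R) : set 'rV[R]_n -> \bar R :=
  cover_measure [set E | diameter E <= delta%:E] id hausdorff_cost.

Definition hausdorff_outer A : \bar R :=
  ereal_sup [set hausdorff_delta delta A | delta in [set d | (0 < d)%R]].

Let hausdorff_cost_ge0 E : 0 <= hausdorff_cost E.
Proof.
rewrite mule_ge0 ?outer_measure_ge0// lee_fin exprn_ge0// divr_ge0//.
have [->|/set0P[x Ex]] := eqVneq E set0.
  by rewrite /diameter setX0 image_set0 ereal_sup0.
apply/fine_ge0/le_ereal_sup_tmp; exists (enorm (x - x))%:E.
  by exists (x, x).
by rewrite lee_fin sqrtr_ge0.
Qed.

Let hausdorff_delta_ge0 d A : 0 <= hausdorff_delta d A.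
Proof. exact: cover_measure_ge0. Qed.

Let hausdorff_outer0 : hausdorff_outer set0 = 0.
Proof.
rewrite /hausdorff_outer (_ : [set _ | _ in _] = [set 0]) ?ereal_sup1//.
apply/seteqP; split => [_ [d _ <-]|_ ->]; first exact: cover_measure0.
by exists 1%R => //=; exact: cover_measure0.
Qed.

Let hausdorff_outer_ge0 A : 0 <= hausdorff_outer A.
Proof.
by apply: le_ereal_sup_tmp; exists (hausdorff_delta 1 A) => //; exists 1%R => /=.
Qed.

Let le_hausdorff_outer : {homo hausdorff_outer : A B / A `<=` B >-> A <= B}.
Proof.
move=> A B AB; apply: ge_ereal_sup => _ [d d0 <-].
apply: (@le_trans _ _ (hausdorff_delta d B)); first exact: le_cover_measure.
by apply: ereal_sup_ubound; exists d.
Qed.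

Let hausdorff_outer_sigma_subadditive : sigma_subadditive hausdorff_outer.
Proof.
move=> F; apply: ge_ereal_sup => _ [d d0 <-].
apply: (le_trans (cover_measure_sigma_subadditive _ _ hausdorff_cost_ge0 F)).
apply: lee_nneseries => i *; first exact: hausdorff_delta_ge0.
by apply: ereal_sup_ubound; exists d.
Qed.

HB.instance Definition _ := isOuterMeasure.Build R 'rV[R]_n hausdorff_outer
  hausdorff_outer0 hausdorff_outer_ge0 le_hausdorff_outer
  hausdorff_outer_sigma_subadditive.

End hausdorff.
Arguments hausdorff_outer {R n} k A.
Arguments lebesgue_outer {R n} A.

(* R^n carries two sigma-algebras below, hence two aliases of 'rV[R]_n: the
   Lebesgue-measurable sets and the H^k-measurable sets. *)
Notation lebesgue_type R n := (caratheodory_type (@lebesgue_outer R n)).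
Notation hausdorff_type R n k := (caratheodory_type (@hausdorff_outer R n k)).

Section measures.
Context (R : realType) (n k : nat).

Definition lebesgue : set (lebesgue_type R n) -> \bar R := lebesgue_outer.

HB.instance Definition _ := isMeasure.Build _ (lebesgue_type R n) R lebesgue
  (caratheodory_measure0 _) (@caratheodory_measure_ge0 _ _ _)
  (@caratheodory_measure_sigma_additive _ _ _).

Definition hausdorff : set (hausdorff_type R n k) -> \bar R :=
  hausdorff_outer k.

HB.instance Definition _ := isMeasure.Build _ (hausdorff_type R n k) R hausdorff
  (caratheodory_measure0 _) (@caratheodory_measure_ge0 _ _ _)
  (@caratheodory_measure_sigma_additive _ _ _).

End measures.
Arguments lebesgue R n : clear implicits.
Arguments hausdorff R n k : clear implicits.

Section notions.
Context {R : realType}.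

Definition unit_sphere {N : nat} : set 'rV[R]_N := [set x | enorm x = 1].

Definition domain (N : nat) (Omega : set 'rV[R]_N) :=
  open Omega /\ connected Omega.

(* Representatives u of classes in L^oo(Omega, R^m); values of u outside Omega
   are irrelevant. *)
Definition Linfty (N m : nat) (Omega : set 'rV[R]_N)
    (u : 'rV[R]_N -> 'rV[R]_m) :=
  (forall j, measurable_fun (Omega : set (lebesgue_type R N))
     (fun x : lebesgue_type R N => u x 0 j)) /\
  (ess_sup (lebesgue R N) (EFin \o ((enorm \o u) \_ Omega)) < +oo)%E.

Variables (N m : nat) (Omega : set 'rV[R]_N) (u : 'rV[R]_N -> 'rV[R]_m).
Variables q r : R.

Definition sphere_integral (eps : R) : \bar R :=
  (\int[hausdorff R N N.-1]_(n in unit_sphere) \int[lebesgue R N]_(x in Omega)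
     (\1_Omega (x + eps *: n) *
       (enorm (u (x + eps *: n) - u x) `^ q / eps `^ r))%:E)%E.

(* 'rV[R]_(N + N) is R^N x R^N, the point (x, y) being row_mx x y. *)
Definition superlevel (s : R) : set 'rV[R]_(N + N) :=
  [set z | let x := lsubmx z in let y := rsubmx z in
    [/\ Omega x, Omega y &
      s < enorm (u y - u x) `^ q / enorm (y - x) `^ (r + N%:R)]].

Definition scaled_measure (s : R) : \bar R :=
  (s%:E * lebesgue R (N + N) (superlevel s))%E.

End notions.

(* Main.v *)
Require Import Defs.
From HB Require Import structures.
From mathcomp Require Import all_boot all_order all_algebra.
From mathcomp Require Import all_classical all_reals all_analysis.
From mathcomp Require Import measurable_realfun ess_sup_inf ring lra zify.

(** The idea is to read both sides of the two inequalities off one double integral, up to bounded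
    errors, and to compare the logarithmic rates at which the two readings grow.

    Put N for the dimension, D(x, z) = |u(x+z) - u(x)|^q when x and x+z lie in Omega and 0 otherwise,
    W(x, z) = D(x, z) / |z|^(r+N), S(t) for the double integral over the sphere and Omega at
    epsilon = t, and L(s) for the measure of the set W > s, which is the measure of the superlevel
    set after the shear (x, y) |-> (x, y - x).

    - The layer cake formula turns the integral of L over ]s0, s1] into the integral of the positive
      part of min(W, s1) - s0 over all (x, z).  When L(s) is comparable to B / s, it grows like
      B ln s1.
    - In polar coordinates, with v = |z|^N and t = v^(1/N), the integral of W itself over the shell
      at v is S(t) / (N v) dv.  When S is comparable to A near 0, shells with a < v <= b contribute
      about (A / N)(ln b - ln a).

    It remains to see which shells count.  The lower cut s0 removes all shells outside a fixed radius
    and costs a bounded amount inside it, since Omega has finite measure.  The upper cut s1 is not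
    felt as long as W <= s1; as u is bounded this holds for v >= c s1^(-N/(N+r)).  Using only those
    shells, the growth rate of the integral is at least (A / N)(N / (N+r)), whence A <= (N+r) B
    (level_le_sphere_mean).  In the other direction min(W, s1) <= s1 makes the contribution of the
    shells with v <= 1/s1 bounded, and the other shells give the rate A / N at most, whence N B <= A
    (level_ge_sphere_mean).

    Polar coordinates have to be justified for the Hausdorff measure of the sphere, whose definition
    by coverings carries the normalization by the volume of the unit ball.  First, Hausdorff and
    Lebesgue measure agree in full dimension (haus_leb): one inequality is the isodiametric
    inequality, proved by Steiner symmetrization; the other follows from filling a fixed fraction of
    a cube by small balls, because translation-invariant measures are proportional to Lebesgue
    measure.  Secondly, central projection from a tangent hyperplane is almost isometric near the
    point of contact, so that on small pieces of the sphere the Hausdorff measure is almost N times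
    the volume of the cone over the piece; cutting the sphere into small pieces makes this exact
    (haus_sphere).  For the cone measure the polar formula is a product measure identity
    (leb_polar).

    Finally, u is only Lebesgue measurable, so it is replaced by its restriction to Omega minus a
    Borel null set, on which it is Borel and bounded (Linfty_borel); all the integrals and measures
    involved are unaffected. *)

Import Order.TTheory GRing.Theory Num.Theory.
Import numFieldNormedType.Exports.
Set Implicit Arguments.
Unset Strict Implicit.
Unset Printing Implicit Defensive.
Local Open Scope classical_set_scope.
Local Open Scope ring_scope.

(** * Borel sets of the space of row vectors *)

Definition rV_display : measure_display. Proof. exact: default_measure_display. Qed.

Section borel_rV.
Context {R : realType} {n : nat}.

Definition coord (i : 'I_n) (x : 'rV[R]_n) : R := x 0 i.

Let rV_set0 : g_sigma_preimage coord set0.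
Proof. exact: sigma_algebra0. Qed.

Let rV_setC A : g_sigma_preimage coord A -> g_sigma_preimage coord (~` A).
Proof. exact: sigma_algebraC. Qed.

Let rV_bigcup (F : _^nat) : (forall i, g_sigma_preimage coord (F i)) ->
  g_sigma_preimage coord (\bigcup_i (F i)).
Proof. exact: sigma_algebra_bigcup. Qed.

HB.instance Definition _ := @isMeasurable.Build rV_display
  'rV[R]_n (g_sigma_preimage coord) rV_set0 rV_setC rV_bigcup.

Lemma measurable_coord (i : 'I_n) :
  measurable_fun [set: 'rV[R]_n] (fun x : 'rV[R]_n => x 0 i).
Proof.
move=> _ Y mY; rewrite setTI; apply: sub_sigma_algebra => /=.
rewrite -bigcup_seq/=; exists i => /=; first by rewrite mem_index_enum.
by exists Y => //; rewrite setTI.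
Qed.

End borel_rV.

Lemma measurable_fun_rVP d (T : measurableType d) (R : realType) n
    (D : set T) (f : T -> 'rV[R]_n) : measurable D ->
  measurable_fun D f <-> forall i, measurable_fun D (fun t => f t 0 i).
Proof.
move=> mD; split=> [mf i|mf].
  exact: (measurable_comp measurableT (@subsetT _ _) (measurable_coord i) mf).
apply: (measurability (\big[setU/set0]_(i < n) preimage_set_system setT (@coord R n i) measurable)) => //.
move=> _ [A + <-].
rewrite -bigcup_seq => -[i _ [B mB <-]].
rewrite setTI -comp_preimage; exact: mf.
Qed.

(** The Borel sets are caught in a sigma-algebra as soon as the half-spaces are; this reduces the
    Caratheodory measurability of Borel sets to half-spaces, for both outer measures. *)
Lemma rV_measurable_halfspaces (R : realType) n (S : set (set 'rV[R]_n)) :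
  sigma_algebra setT S ->
  (forall i c, S [set x | x 0 i <= c]) -> measurable `<=` S.
Proof.
move=> saS hS; apply: smallest_sub => // A.
rewrite -bigcup_seq => -[i _ [B mB <-]]; rewrite setTI.
pose T := g_sigma_algebraType S.
have ST : measurable = S :> set (set T) by rewrite [LHS]sigma_algebra_id.
suff : measurable_fun [set: T] (fun x : T => (x : 'rV[R]_n) 0 i).
  by move=> /(_ measurableT B mB); rewrite setTI ST.
apply: (measurability _ (RGenOInfty.measurableE R)) => // _ [_ [c ->] <-].
rewrite setTI preimage_itvoy -[X in measurable X]setCK; apply: measurableC.
rewrite ST (_ : ~` _ = [set x : 'rV[R]_n | x 0 i <= c]); first exact: hS.
by apply/seteqP; split=> x /=; [move/negP; rewrite -leNgt|rewrite leNgt => /negP].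
Qed.

Lemma measurable_box (R : realType) n (ab : 'rV[R]_n * 'rV[R]_n) :
  measurable (box ab).
Proof.
have -> : box ab = \big[setI/setT]_(i < n)
    ((fun x : 'rV[R]_n => x 0 i) @^-1` `]ab.1 0 i, ab.2 0 i]%classic).
  rewrite -bigcap_seq; apply/seteqP; split=> x /=.
    by move=> bx i _ /=; rewrite in_itv /=.
  by move=> bx i; have := bx i (mem_index_enum _); rewrite /= in_itv.
apply: bigsetI_measurable => i _; rewrite -[X in measurable X]setTI.
exact: measurable_coord.
Qed.

Definition bigbox (R : realType) n (k : nat) : 'rV[R]_n * 'rV[R]_n :=
  (const_mx (- k%:R), const_mx k%:R).

Lemma bigcup_bigbox (R : realType) n : \bigcup_k box (bigbox R n k) = setT.
Proof.
apply/seteqP; split => // x _.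
have [k xk] : exists k : nat, forall i, `|x 0 i| < k%:R.
  exists (Num.truncn (\sum_i `|x 0 i|)).+1 => i.
  apply: (@le_lt_trans _ _ (\sum_i `|x 0 i|)).
    by rewrite (bigD1 i)//= lerDl sumr_ge0.
  by rewrite truncnS_gt.
exists k => // i /=; rewrite !mxE; have := xk i.
by rewrite ltr_norml => /andP[-> /ltW ->].
Qed.

Lemma box_setI (R : realType) n : setI_closed (range (@box R n)).
Proof.
move=> _ _ [[a b] _ <-] [[c d] _ <-].
exists (\row_i Num.max (a 0 i) (c 0 i), \row_i Num.min (b 0 i) (d 0 i)) => //.
apply/seteqP; split=> x /=.
  move=> h; split=> i; have := h i; rewrite !mxE gt_max le_min => /andP[/andP[]];
  by move=> ? ? /andP[]; move=> *; apply/andP.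
move=> [h1 h2] i; have /= /andP[? ?] := h1 i; have /= /andP[? ?] := h2 i.
by rewrite !mxE gt_max le_min; do !(apply/andP; split).
Qed.

Lemma measurable_rV_boxE (R : realType) n :
  @measurable _ 'rV[R]_n = <<s range (@box R n) >>.
Proof.
apply/seteqP; split; last first.
  apply: smallest_sub; first exact: sigma_algebra_measurable.
  by move=> _ [ab _ <-]; exact: measurable_box.
apply: rV_measurable_halfspaces; first exact: smallest_sigma_algebra.
move=> i c; change (<<s range (@box R n) >> [set x : 'rV[R]_n | x 0 i <= c]).
have -> : [set x : 'rV[R]_n | x 0 i <= c] =
    \bigcup_k box (const_mx (- k%:R), \row_j if j == i then Num.min c k%:R else k%:R).
  apply/seteqP; split=> x /=.
    move=> xc; have : [set: 'rV[R]_n] x by [].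
    rewrite -bigcup_bigbox => -[k _ /= kx]; exists k => // j /=.
    have := kx j; rewrite !mxE => /andP[-> /=]; case: eqP => // -> xk.
    by rewrite le_min xc.
  by move=> [k _ /(_ i)/=]; rewrite !mxE eqxx le_min => /andP[_ /andP[]].
apply: (@sigma_algebra_bigcup _ _ (range (@box R n))) => k; apply: sub_sigma_algebra.
by exists (const_mx (- k%:R), \row_j if j == i then Num.min c k%:R else k%:R).
Qed.

(** * Outer measures defined by coverings *)

Section cover_measure_facts.
Local Open Scope ereal_scope.
Context {R : realType} {I T : Type}.
Variables (D : set I) (P : I -> set T) (c : I -> \bar R).
Hypothesis c_ge0 : forall i, 0 <= c i.

Lemma cover_measure_le1 A i : D i -> A `<=` P i -> cover_measure D P c A <= c i.
Proof.
move=> Di AP.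
pose F (k : nat) := if k is 0%N then Some i else None.
apply: ereal_inf_lbound; exists F.
  split; first by case=> [|k] j //= [<-].
  by move=> x /AP Px; exists 0%N.
rewrite (nneseries_split 0 1)//; last by move=> [|k] _ //=.
rewrite big_mkord big_ord1 /= eseries0 ?adde0//.
by case.
Qed.

Lemma le_cover_measureP A (b : \bar R) :
  (forall F, countable_cover D P A F -> b <= \sum_(k <oo) oapp c 0 (F k)) ->
  b <= cover_measure D P c A.
Proof. by move=> h; apply: le_ereal_inf_tmp => _ [F cF <-]; exact: h. Qed.

(** The extremal property of a cover measure: lower bounds are tested on the covering sets only. *)
Lemma le_outer_cover_measure (mu : {outer_measure set T -> \bar R}) A :
  (forall i, D i -> mu (P i) <= c i) -> mu A <= cover_measure D P c A.
Proof.
move=> h; apply: le_cover_measureP => F [DF AF].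
apply: (le_trans (le_outer_measure mu _ _ AF)).
apply: (le_trans (outer_measure_sigma_subadditive mu _)).
apply: lee_nneseries => k _ //=; first by move=> _; exact: outer_measure_ge0.
by case E : (F k) => [i|] //=; [exact: h (DF _ _ E)|rewrite outer_measure0].
Qed.

(** Cutting all the sets of a cover by X gives covers of the two parts; their total cost has to be
    compared set by set only. *)
Lemma cover_measure_cut (mu : {outer_measure set T -> \bar R}) (X A : set T) :
  (forall i, D i -> mu (P i `&` X) + mu (P i `&` ~` X) <= c i) ->
  mu (A `&` X) + mu (A `&` ~` X) <= cover_measure D P c A.
Proof.
move=> h; apply: le_cover_measureP => F [DF AF].
pose G k := oapp P set0 (F k).
have sub Y : mu (A `&` Y) <= \sum_(k <oo) mu (G k `&` Y).
  apply: le_trans (outer_measure_sigma_subadditive mu _).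
  by apply: le_outer_measure; rewrite -setI_bigcupl; apply: setSI.
apply: (le_trans (leeD (sub _) (sub _))).
rewrite -nneseriesD; last 2 first.
- by move=> *; exact: outer_measure_ge0.
- by move=> *; exact: outer_measure_ge0.
apply: lee_nneseries => k _; first by move=> _; rewrite adde_ge0 ?outer_measure_ge0.
rewrite /G; case E : (F k) => [i|] //=; first exact: h (DF _ _ E).
by rewrite !set0I outer_measure0 adde0.
Qed.

End cover_measure_facts.

(** * Lebesgue measure on Borel sets *)

Section lebesgue_outer_facts.
Local Open Scope ereal_scope.
Context {R : realType} {n : nat}.
Implicit Types ab : 'rV[R]_n * 'rV[R]_n.

Lemma box_volume_ge0 ab : 0 <= box_volume ab.
Proof. by rewrite lee_fin prodr_ge0. Qed.

Lemma lebesgue_outer_box_le ab : (forall i, ab.1 0%R i <= ab.2 0%R i)%R ->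
  lebesgue_outer (box ab) <= box_volume ab.
Proof. by move=> h; apply: cover_measure_le1 => //; exact: box_volume_ge0. Qed.

Definition upd (x : 'rV[R]_n) (i : 'I_n) (t : R) : 'rV[R]_n :=
  (\row_j if j == i then t else x 0 j)%R.

(** A half-space cuts a box into two boxes whose volumes add up. *)
Lemma lebesgue_outer_halfspace (i : 'I_n) (t : R) :
  lebesgue_outer.-caratheodory [set x : 'rV[R]_n | (x 0 i <= t)%R].
Proof.
apply: le_caratheodory_measurable => A.
apply: (cover_measure_cut (mu := @lebesgue_outer R n)) => -[a b] /= ab.
pose m := Num.max (a 0%R i) (Num.min (b 0%R i) t).
have am : (a 0%R i <= m)%R by rewrite le_max lexx.
have mb : (m <= b 0%R i)%R by rewrite ge_max ab ge_min lexx.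
have -> : box_volume (a, b) = box_volume (a, upd b i m) + box_volume (upd a i m, b).
  rewrite /box_volume -EFinD; congr EFin.
  rewrite (bigD1 i)//= [X in (_ = X + _)%R](bigD1 i)//=.
  rewrite [X in (_ = _ + X)%R](bigD1 i)//= !mxE eqxx.
  rewrite [X in (_ = _ * X + _)%R](eq_bigr (fun j => `|b 0%R j - a 0%R j|)%R); last first.
    by move=> j /negPf ji; rewrite mxE ji.
  rewrite [X in (_ = _ + _ * X)%R](eq_bigr (fun j => `|b 0%R j - a 0%R j|)%R); last first.
    by move=> j /negPf ji; rewrite mxE ji.
  rewrite -mulrDl; congr (_ * _)%R.
  by rewrite !ger0_norm ?subr_ge0//; ring.
apply: leeD.
- apply: (@le_trans _ _ (lebesgue_outer (box (a, upd b i m)))).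
    apply: le_outer_measure => x [bx /= xt] j; have /= := bx j.
    rewrite mxE; case: eqP => [->|_] //= /andP[-> xb]; rewrite /m le_max.
    by rewrite le_min xb xt orbT.
  apply: lebesgue_outer_box_le => j /=; rewrite mxE; case: eqP => // -> //.
- apply: (@le_trans _ _ (lebesgue_outer (box (upd a i m, b)))).
    apply: le_outer_measure => x [bx /= /negP]; rewrite -ltNge => xt j; have /= := bx j.
    rewrite mxE; case: eqP => [->|_] //= /andP[ax xb]; rewrite xb andbT /m gt_max.
    by rewrite ax gt_min xt orbT.
  apply: lebesgue_outer_box_le => j /=; rewrite mxE; case: eqP => // -> //.
Qed.

Lemma lebesgue_outer_borel : measurable `<=` (@lebesgue_outer R n).-caratheodory.
Proof.
apply: rV_measurable_halfspaces; last exact: lebesgue_outer_halfspace.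
exact: (@sigma_algebra_measurable _ (lebesgue_type R n)).
Qed.

(** Restricting to Borel sets gives products of measures: the Borel sets of a product are generated
    by rectangles, which fails for Caratheodory measurable sets. *)
Definition leb : set 'rV[R]_n -> \bar R := lebesgue_outer.

Let leb0 : leb set0 = 0. Proof. exact: outer_measure0. Qed.
Let leb_ge0 A : 0 <= leb A. Proof. exact: outer_measure_ge0. Qed.
Let leb_sigma_additive : semi_sigma_additive leb.
Proof.
move=> F mF tF mUF.
by apply: caratheodory_measure_sigma_additive => //;
  [move=> k|]; exact: lebesgue_outer_borel.
Qed.

HB.instance Definition _ := isMeasure.Build _ _ _ leb leb0 leb_ge0 leb_sigma_additive.

End lebesgue_outer_facts.
Arguments leb {R n}.

(** * Boxes, coordinates and products *)

Definition push_measure d1 d2 (T1 : measurableType d1) (T2 : measurableType d2)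
    (R : realType) (m : {measure set T1 -> \bar R}) (f : T1 -> T2)
    (mf : measurable_fun setT f) : {measure set T2 -> \bar R} :=
  measure_function_pushforward__canonical__measure_function_Measure m mf.

Lemma push_measureE d1 d2 (T1 : measurableType d1) (T2 : measurableType d2)
    (R : realType) (m : {measure set T1 -> \bar R}) (f : T1 -> T2)
    (mf : measurable_fun setT f) A : push_measure m mf A = m (f @^-1` A).
Proof. by []. Qed.

Section leb_boxes.
Local Open Scope ereal_scope.
Context {R : realType}.

Lemma bigbox_le n k i : ((bigbox R n k).1 0%R i <= (bigbox R n k).2 0%R i)%R.
Proof. by rewrite !mxE lerNl (le_trans _ (ler0n _ k))// oppr_le0. Qed.

Let leb_sigma_finite n : sigma_finite setT (@leb R n).
Proof.
exists (fun k => box (bigbox R n k)); first by rewrite bigcup_bigbox.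
move=> k; split; first exact: measurable_box.
apply: le_lt_trans (lebesgue_outer_box_le (@bigbox_le n k)) _.
by rewrite /box_volume ltry.
Qed.

HB.instance Definition _ n := Measure_isSigmaFinite.Build _ _ _ (@leb R n) (leb_sigma_finite n).

(** Coverings by boxes compare Lebesgue measure to any measure that is small on boxes. *)
Lemma le_measure_leb n (mu : {measure set 'rV[R]_n -> \bar R}) A :
  (forall ab : 'rV[R]_n * 'rV[R]_n, (forall i, ab.1 0%R i <= ab.2 0%R i)%R -> mu (box ab) <= box_volume ab) ->
  measurable A -> mu A <= leb A.
Proof.
move=> h mA; apply: le_cover_measureP => F [DF AF].
have mF k : measurable (oapp (@box R n) set0 (F k)).
  by case: (F k) => [ab|] //=; exact: measurable_box.
apply: (@le_trans _ _ (\sum_(k <oo) mu (oapp (@box R n) set0 (F k)))).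
  exact: measure_sigma_subadditive.
apply: lee_nneseries => k _ //=.
by case E : (F k) => [ab|] //=; [exact: h (DF _ _ E)|rewrite measure0].
Qed.

Definition ins n (i : 'I_n.+1) (t : R) (x : 'rV[R]_n) : 'rV[R]_n.+1 :=
  (\row_j oapp (fun k => x 0 k) t (unlift i j))%R.
Definition del n (i : 'I_n.+1) (x : 'rV[R]_n.+1) : 'rV[R]_n :=
  (\row_j x 0 (lift i j))%R.

Lemma ins_same n (i : 'I_n.+1) t x : ins i t x 0%R i = t.
Proof. by rewrite mxE unlift_none. Qed.

Lemma ins_lift n (i : 'I_n.+1) t x j : ins i t x 0%R (lift i j) = x 0%R j.
Proof. by rewrite mxE liftK. Qed.

Lemma del_ins n (i : 'I_n.+1) t x : del i (ins i t x) = x.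
Proof. by apply/rowP => j; rewrite mxE ins_lift. Qed.

Lemma ins_del n (i : 'I_n.+1) (x : 'rV[R]_n.+1) : ins i (x 0%R i) (del i x) = x.
Proof.
apply/rowP => j; have [k ->|->] := unliftP i j; last by rewrite ins_same.
by rewrite ins_lift mxE.
Qed.

Lemma measurable_ins n (i : 'I_n.+1) :
  measurable_fun setT (fun tx : R * 'rV[R]_n => ins i tx.1 tx.2).
Proof.
apply/measurable_fun_rVP => // j; have [k ->|->] := unliftP i j.
  under eq_fun do rewrite ins_lift.
  by apply: (measurableT_comp (measurable_coord k)).
by under eq_fun do rewrite ins_same; exact: measurable_fst.
Qed.

Lemma ins_box n (i : 'I_n.+1) (ab : 'rV[R]_n.+1 * 'rV[R]_n.+1) :
  (fun tx : R * 'rV[R]_n => ins i tx.1 tx.2) @^-1` box ab =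
  `]ab.1 0%R i, ab.2 0%R i]%classic `*` box (del i ab.1, del i ab.2).
Proof.
apply/seteqP; split=> [[t x]|[t x]] /=.
  move=> h; split; first by have := h i; rewrite ins_same in_itv.
  by move=> j; have := h (lift i j); rewrite ins_lift /= !mxE.
rewrite in_itv /= => -[h1 h2] j; have [k ->|->] := unliftP i j.
  by have := h2 k; rewrite ins_lift /= !mxE.
by rewrite ins_same.
Qed.

Lemma box_volume_del n (i : 'I_n.+1) (ab : 'rV[R]_n.+1 * 'rV[R]_n.+1) :
  box_volume ab = `|ab.2 0%R i - ab.1 0%R i|%:E * box_volume (del i ab.1, del i ab.2).
Proof.
rewrite /box_volume (bigD1_ord i)//= EFinM; congr (_ * _%:E).
by apply: eq_bigr => j _; rewrite !mxE.
Qed.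

Lemma push_ins_box n (i : 'I_n.+1) (ab : 'rV[R]_n.+1 * 'rV[R]_n.+1) :
  (forall ab : 'rV[R]_n * 'rV[R]_n, (forall i, ab.1 0%R i <= ab.2 0%R i)%R ->
    leb (box ab) = box_volume ab) ->
  (forall i, ab.1 0%R i <= ab.2 0%R i)%R ->
  pushforward (lebesgue_measure \x @leb R n)
    (fun tx : R * 'rV[R]_n => ins i tx.1 tx.2) (box ab) = box_volume ab.
Proof.
move=> h le_ab; rewrite /pushforward ins_box product_measure1E//; last exact: measurable_box.
rewrite /= (h (_, _)); last by move=> j; rewrite !mxE.
rewrite (box_volume_del i); congr (_ * _).
rewrite lebesgue_measure_itv/= lte_fin lt_neqAle le_ab andbT ger0_norm ?subr_ge0//.
by case: eqP => [->|]//=; rewrite subrr.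
Qed.

(** By induction on the dimension: the product of the measures of one coordinate and of the others
    is a measure that has the right value on boxes, hence bounds Lebesgue measure from below. *)
Lemma leb_box n (ab : 'rV[R]_n * 'rV[R]_n) :
  (forall i, ab.1 0%R i <= ab.2 0%R i)%R -> leb (box ab) = box_volume ab.
Proof.
elim: n ab => [|n IHn] ab le_ab.
  apply/eqP; rewrite eq_le lebesgue_outer_box_le//=.
  have := @le_measure_leb 0 (\d_(0%R : 'rV[R]_0)) (box ab).
  rewrite /= diracE mem_set; last by case.
  rewrite /box_volume big_ord0; apply; last exact: measurable_box.
  by move=> cd _; rewrite /box_volume big_ord0 diracE mem_set//; case.
apply/eqP; rewrite eq_le lebesgue_outer_box_le//=.
rewrite -(@push_ins_box n ord0)//.
pose mu := push_measure (lebesgue_measure \x @leb R n) (measurable_ins ord0).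
apply: (@le_measure_leb _ mu); last exact: measurable_box.
by move=> cd le_cd; rewrite /mu/= push_ins_box.
Qed.

Lemma leb_unique n (mu : {measure set 'rV[R]_n -> \bar R}) :
  (forall ab : 'rV[R]_n * 'rV[R]_n, (forall i, ab.1 0%R i <= ab.2 0%R i)%R -> mu (box ab) = box_volume ab) ->
  forall A, measurable A -> leb A = mu A.
Proof.
move=> h A mA; apply: (measure_unique (range (@box R n)) (fun k => box (bigbox R n k))) => //.
- exact: measurable_rV_boxE.
- exact: box_setI.
- exact: bigcup_bigbox.
- move=> _ [ab _ <-].
  have [le_ab|] := pselect (forall i, ab.1 0%R i <= ab.2 0%R i)%R.
    by rewrite /= leb_box// h.
  move=> /existsNP[i /negP]; rewrite -ltNge => ba.
  suff -> : box ab = set0 by rewrite !measure0.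
  apply/seteqP; split=> x //= /(_ i) /andP[ax xb].
  by have := lt_le_trans (lt_le_trans ax xb) (ltW ba); rewrite ltxx.
- move=> k; rewrite /= leb_box; last exact: bigbox_le.
  by rewrite /box_volume ltry.
Qed.

Lemma leb_ins n (i : 'I_n.+1) A : measurable A ->
  leb A = pushforward (lebesgue_measure \x @leb R n)
    (fun tx : R * 'rV[R]_n => ins i tx.1 tx.2) A.
Proof.
pose mu := push_measure (lebesgue_measure \x @leb R n) (measurable_ins i).
apply: (@leb_unique _ mu) => ab le_ab; rewrite /mu/= push_ins_box// => cd.
exact: leb_box.
Qed.

Lemma measurable_row_mx m n :
  measurable_fun setT (fun p : 'rV[R]_m * 'rV[R]_n => row_mx p.1 p.2).
Proof.
apply/measurable_fun_rVP => // j; have [k ->|k ->] := split_ordP j.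
  under eq_fun do rewrite row_mxEl.
  by apply: (measurableT_comp (measurable_coord k)).
under eq_fun do rewrite row_mxEr.
by apply: (measurableT_comp (measurable_coord k)).
Qed.

Lemma leb_row_mx m n A : measurable A ->
  leb A = pushforward (@leb R m \x @leb R n)
    (fun p : 'rV[R]_m * 'rV[R]_n => row_mx p.1 p.2) A.
Proof.
pose mu := push_measure (@leb R m \x @leb R n) (@measurable_row_mx m n).
apply: (@leb_unique _ mu) => -[a b] /= le_ab; rewrite /mu/= /pushforward.
have -> : (fun p : 'rV[R]_m * 'rV[R]_n => row_mx p.1 p.2) @^-1` box (a, b) =
    box (lsubmx a, lsubmx b) `*` box (rsubmx a, rsubmx b).
  apply/seteqP; split=> [[x y]|[x y]] /=.
    move=> h; split=> j /=.
      by have := h (lshift n j); rewrite row_mxEl /= !mxE.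
    by have := h (rshift m j); rewrite row_mxEr /= !mxE.
  move=> [h1 h2] j; have [k ->|k ->] := split_ordP j.
    by have := h1 k; rewrite row_mxEl /= !mxE.
  by have := h2 k; rewrite row_mxEr /= !mxE.
rewrite product_measure1E; try exact: measurable_box.
rewrite /= !leb_box; try by move=> j /=; rewrite !mxE.
rewrite /box_volume -EFinM big_split_ord/=; congr (_ * _)%:E;
 by apply: eq_bigr => j _; rewrite !mxE.
Qed.

End leb_boxes.

(** * Euclidean norm and invariance of Lebesgue measure *)

Section enorm_theory.
Context {R : realType} {n : nat}.
Implicit Types x y z : 'rV[R]_n.

Definition dotp x y : R := \sum_(i < n) x 0 i * y 0 i.

Lemma dotpC x y : dotp x y = dotp y x.
Proof. by apply: eq_bigr => i _; rewrite mulrC. Qed.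

Lemma dotpDl x y z : dotp (x + y) z = dotp x z + dotp y z.
Proof. by rewrite /dotp -big_split; apply: eq_bigr => i _; rewrite mxE mulrDl. Qed.

Lemma dotpZl a x z : dotp (a *: x) z = a * dotp x z.
Proof. by rewrite /dotp mulr_sumr; apply: eq_bigr => i _; rewrite mxE mulrA. Qed.

Lemma dotpDr x y z : dotp z (x + y) = dotp z x + dotp z y.
Proof. by rewrite !(dotpC z) dotpDl. Qed.

Lemma dotpZr a x z : dotp z (a *: x) = a * dotp z x.
Proof. by rewrite !(dotpC z) dotpZl. Qed.

Lemma dotpNl x z : dotp (- x) z = - dotp x z.
Proof. by rewrite -scaleN1r dotpZl mulN1r. Qed.

Lemma dotpNr x z : dotp z (- x) = - dotp z x.
Proof. by rewrite !(dotpC z) dotpNl. Qed.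

Definition dotpE := (dotpDl, dotpDr, dotpZl, dotpZr, dotpNl, dotpNr).

Lemma dotpxx_ge0 x : 0 <= dotp x x.
Proof. by apply: sumr_ge0 => i _; rewrite -expr2 sqr_ge0. Qed.

Lemma enormE x : enorm x = Num.sqrt (dotp x x).
Proof. by congr Num.sqrt; apply: eq_bigr => i _; rewrite expr2. Qed.

Lemma enorm_sqr x : enorm x ^+ 2 = dotp x x.
Proof. by rewrite enormE sqr_sqrtr// dotpxx_ge0. Qed.

Lemma enorm_ge0 x : 0 <= enorm x. Proof. exact: sqrtr_ge0. Qed.

Lemma dotpxx_eq0 x : (dotp x x == 0) = (x == 0).
Proof.
apply/idP/eqP => [|->]; last by rewrite /dotp big1// => i _; rewrite mxE mul0r.
rewrite psumr_eq0; last by move=> i _; rewrite -expr2 sqr_ge0.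
move=> /allP h; apply/rowP => i; rewrite mxE.
by have := h i (mem_index_enum _); rewrite /= mulf_eq0 orbb => /eqP.
Qed.

Lemma enorm_eq0 x : (enorm x == 0) = (x == 0).
Proof. by rewrite enormE sqrtr_eq0 le_eqVlt ltNge dotpxx_ge0 orbF dotpxx_eq0. Qed.

Lemma enorm0 : enorm (0 : 'rV[R]_n) = 0.
Proof. by apply/eqP; rewrite enorm_eq0. Qed.

Lemma enorm_gt0 x : (0 < enorm x) = (x != 0).
Proof. by rewrite lt_neqAle enorm_ge0 andbT eq_sym enorm_eq0. Qed.

Lemma enormZ a x : enorm (a *: x) = `|a| * enorm x.
Proof.
rewrite !enormE !dotpE mulrA -expr2 sqrtrM ?sqr_ge0//.
by rewrite sqrtr_sqr.
Qed.

Lemma enormN x : enorm (- x) = enorm x.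
Proof. by rewrite -scaleN1r enormZ normrN1 mul1r. Qed.

Lemma enormC x y : enorm (x - y) = enorm (y - x).
Proof. by rewrite -enormN opprB. Qed.

Lemma dotp_le x y : dotp x y <= enorm x * enorm y.
Proof.
apply: (le_trans (ler_norm _)).
rewrite -ler_sqr ?nnegrE ?mulr_ge0 ?enorm_ge0// exprMn !enorm_sqr.
rewrite real_normK ?num_real//.
have [/eqP|y0] := boolP (dotp y y == 0).
  move=> /eqP; rewrite dotpxx_eq0 => /eqP ->.
  by rewrite -(scale0r (0 : 'rV[R]_n)) !dotpE !mul0r expr0n /= mulr0.
have y1 : 0 < dotp y y by rewrite lt_neqAle eq_sym y0 dotpxx_ge0.
have := dotpxx_ge0 (dotp y y *: x - dotp x y *: y).
rewrite !dotpE (dotpC y x).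
rewrite (_ : _ + _ = dotp y y * (dotp x x * dotp y y - dotp x y ^+ 2)); last by ring.
by rewrite pmulr_rge0// subr_ge0.
Qed.

Lemma ler_enormD x y : enorm (x + y) <= enorm x + enorm y.
Proof.
rewrite -ler_sqr ?nnegrE ?addr_ge0 ?enorm_ge0//.
rewrite sqrrD !enorm_sqr !dotpE (dotpC y x).
have := dotp_le x y; lra.
Qed.

Lemma ler_enorm_dist x y : `|enorm x - enorm y| <= enorm (x - y).
Proof.
rewrite ler_norml; apply/andP; split.
  rewrite lerNl opprB lerBlDr -{1}(subrK x y) enormC addrC; apply: le_trans (ler_enormD _ _) _.
  by rewrite addrC enormC lexx.
by rewrite lerBlDr -{1}(subrK y x) ler_enormD.
Qed.

Lemma coord_le_enorm x i : `|x 0 i| <= enorm x.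
Proof.
rewrite -ler_sqr ?nnegrE ?enorm_ge0// enorm_sqr real_normK ?num_real//.
rewrite /dotp (bigD1 i)//= expr2 lerDl; apply: sumr_ge0 => j _.
by rewrite -expr2 sqr_ge0.
Qed.

Lemma enorm_le_coord x b : 0 <= b -> (forall i, `|x 0 i| <= b) -> enorm x <= b * Num.sqrt n%:R.
Proof.
move=> b0 h; rewrite -ler_sqr ?nnegrE ?enorm_ge0 ?mulr_ge0 ?sqrtr_ge0//.
rewrite enorm_sqr exprMn sqr_sqrtr// mulr_natr.
rewrite -[n in X in _ <= X]card_ord -sumr_const; apply: ler_sum => i _.
by rewrite -expr2 -real_normK ?num_real// ler_sqr ?nnegrE.
Qed.

End enorm_theory.

Lemma measurable_dotp d (T : measurableType d) (R : realType) n (D : set T)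
    (f g : T -> 'rV[R]_n) : measurable D ->
  measurable_fun D f -> measurable_fun D g -> measurable_fun D (fun t => dotp (f t) (g t)).
Proof.
move=> mD /measurable_fun_rVP mf /measurable_fun_rVP mg.
apply: measurable_sum => i; apply: measurable_funM; [exact: mf|exact: mg].
Qed.

Lemma measurable_enorm d (T : measurableType d) (R : realType) n (D : set T)
    (f : T -> 'rV[R]_n) : measurable D ->
  measurable_fun D f -> measurable_fun D (fun t => enorm (f t)).
Proof.
move=> mD mf; under eq_fun do rewrite enormE.
apply: (measurableT_comp (f := @Num.sqrt R)); last exact: measurable_dotp.
by apply: continuous_measurable_fun; exact: sqrt_continuous.
Qed.

Lemma measurable_rV_D d (T : measurableType d) (R : realType) n (D : set T)
    (f g : T -> 'rV[R]_n) : measurable D ->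
  measurable_fun D f -> measurable_fun D g -> measurable_fun D (fun t => f t + g t).
Proof.
move=> mD mf mg; apply/measurable_fun_rVP => // i.
under eq_fun do rewrite mxE.
by apply: measurable_funD; [exact: (iffLR (measurable_fun_rVP _ mD) mf)|exact: (iffLR (measurable_fun_rVP _ mD) mg)].
Qed.

Lemma measurable_rV_Z d (T : measurableType d) (R : realType) n (D : set T)
    (c : T -> R) (f : T -> 'rV[R]_n) : measurable D ->
  measurable_fun D c -> measurable_fun D f -> measurable_fun D (fun t => c t *: f t).
Proof.
move=> mD mc mf; apply/measurable_fun_rVP => // i.
under eq_fun do rewrite mxE.
by apply: measurable_funM => //; exact: (iffLR (measurable_fun_rVP _ mD) mf).
Qed.

Lemma measurable_rV_N d (T : measurableType d) (R : realType) n (D : set T)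
    (f : T -> 'rV[R]_n) : measurable D ->
  measurable_fun D f -> measurable_fun D (fun t => - f t).
Proof.
move=> mD mf; under eq_fun do rewrite -scaleN1r.
exact: measurable_rV_Z.
Qed.

Section leb_transformations.
Local Open Scope ereal_scope.
Context {R : realType} {n : nat}.

Lemma measurable_translate (v : 'rV[R]_n) : measurable_fun setT (fun x : 'rV[R]_n => x + v)%R.
Proof. exact: measurable_rV_D. Qed.

Lemma leb_translate (v : 'rV[R]_n) (A : set 'rV[R]_n) : measurable A ->
  leb ((fun x => x + v)%R @^-1` A) = leb A.
Proof.
move=> mA; apply/esym.
apply: (@leb_unique _ _ (push_measure leb (measurable_translate v))) => // -[a b] /= le_ab.
rewrite /push_measure /= /pushforward.
rewrite (_ : _ @^-1` _ = box (a - v, b - v)%R); last first.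
  by apply/seteqP; split=> x h i; have /= := h i; rewrite !mxE /= ltrBlDr lerBrDr.
rewrite leb_box; last by move=> i /=; rewrite !mxE lerD2r.
rewrite /box_volume; congr EFin; apply: eq_bigr => i _; rewrite !mxE.
by congr (`|_|)%R; ring.
Qed.

Lemma measurable_scale (c : R) : measurable_fun setT (fun x : 'rV[R]_n => c *: x)%R.
Proof. exact: measurable_rV_Z. Qed.

Lemma leb_scale (c : R) (A : set 'rV[R]_n) : (0 < c)%R -> measurable A ->
  (c ^+ n)%:E * leb ((fun x => c *: x)%R @^-1` A) = leb A.
Proof.
move=> c0 mA; apply/esym.
have cn0 : (0 <= c ^+ n)%R by rewrite exprn_ge0// ltW.
apply: (@leb_unique _ _ (mscale (NngNum cn0) (push_measure leb (measurable_scale c)))) => // -[a b] /= le_ab.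
rewrite /mscale /= /push_measure /= /pushforward.
rewrite (_ : _ @^-1` _ = box (c^-1 *: a, c^-1 *: b)%R); last first.
  by apply/seteqP; split=> x h i; have /= := h i; rewrite !mxE /= !(mulrC c^-1%R) ltr_pdivrMr// ler_pdivlMr// (mulrC c).
rewrite leb_box; last by move=> i /=; rewrite !mxE ler_pM2l// invr_gt0.
rewrite /box_volume -EFinM; congr EFin.
rewrite -[n in (_ ^+ n)%R]card_ord -prodr_const -big_split /=; apply: eq_bigr => i _; rewrite !mxE.
by rewrite -mulrBr normrM gtr0_norm ?invr_gt0// mulrA divff ?mul1r// gt_eqF.
Qed.

Lemma leb_unit_box : leb (box (0, const_mx 1)%R : set 'rV[R]_n) = 1.
Proof.
rewrite leb_box; last by move=> i /=; rewrite !mxE ler01.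
by rewrite /box_volume big1// => i _; rewrite !mxE subr0 normr1.
Qed.

End leb_transformations.

Section with_sigma_finite.
Context d (T : measurableType d) (R : realType) (mu : {measure set T -> \bar R}).
Definition with_sigma_finite (sf : sigma_finite setT mu) : set T -> \bar R := mu.
Variable sf : sigma_finite setT mu.
HB.instance Definition _ := isMeasure.Build _ _ _ (with_sigma_finite sf)
  (measure0 mu) (measure_ge0 mu) (@measure_semi_sigma_additive _ _ _ mu).
HB.instance Definition _ := Measure_isSigmaFinite.Build _ _ _ (with_sigma_finite sf) sf.
End with_sigma_finite.

Section fubini_sets.
Local Open Scope ereal_scope.
Context d1 d2 (T1 : measurableType d1) (T2 : measurableType d2) (R : realType).
Variables (m1 : {sigma_finite_measure set T1 -> \bar R})
          (m2 : {sigma_finite_measure set T2 -> \bar R}).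

Lemma fubini_sets (C : set (T1 * T2)) : measurable C ->
  \int[m1]_x m2 (xsection C x) = \int[m2]_y m1 (ysection C y).
Proof.
move=> mC; have := indic_fubini_tonelli m1 m2 mC.
by rewrite indic_fubini_tonelli_FE// indic_fubini_tonelli_GE.
Qed.

Lemma integral_indicM (A : set T1) (c : \bar R) : 0 <= c -> measurable A ->
  \int[m1]_x (c * (\1_A x)%:E) = c * m1 A.
Proof.
move=> c0 mA; rewrite ge0_integralZl//.
- by rewrite integral_indic// setIT.
- by apply/measurable_EFinP; exact: measurable_indic.
Qed.

End fubini_sets.

(** Apply Fubini to the set of the pairs with x in A and x + y in B, and substitute in two ways.  With B
    fixed, this makes mu proportional to Lebesgue measure. *)
Lemma translation_invariant_leb (R : realType) n
    (mu : {sigma_finite_measure set 'rV[R]_n -> \bar R}) (A B : set 'rV[R]_n) :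
  (forall (v : 'rV[R]_n) (C : set 'rV[R]_n), measurable C ->
     mu ((fun x => x + v)%R @^-1` C) = mu C) ->
  measurable A -> measurable B ->
  (mu A * leb B = leb (-%R @^-1` A) * mu B)%E.
Proof.
move=> muT mA mB.
pose T := ('rV[R]_n * 'rV[R]_n)%type.
have m1 : measurable_fun [set: T] fst by [].
have m2 : measurable_fun [set: T] snd by [].
pose C := [set p : T | A p.1 /\ B (p.1 + p.2)].
have mC : measurable C.
  apply: measurableI.
    by rewrite -[X in measurable X]setTI; exact: m1.
  by rewrite -[X in measurable X]setTI; exact: (measurable_rV_D _ m1 m2).
pose C' := [set p : T | A (p.1 - p.2) /\ B p.1].
have mC' : measurable C'.
  apply: measurableI.
    rewrite -[X in measurable X]setTI.
    by apply: (measurable_rV_D _ m1 (measurable_rV_N _ m2)).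
  by rewrite -[X in measurable X]setTI; exact: m1.
have mNA : measurable (-%R @^-1` A).
  by rewrite -[X in measurable X]setTI; exact: (measurable_rV_N measurableT (@measurable_id _ _ setT)).
have E1 : (\int[mu]_x leb (xsection C x) = mu A * leb B)%E.
  rewrite muleC -integral_indicM//.
  apply: eq_integral => x _; rewrite indicE; case: (boolP (x \in A)) => xA.
    rewrite mule1 -(leb_translate x mB); congr (leb _); apply/seteqP; split=> y /=.
      by rewrite /xsection /= inE => -[_]; rewrite addrC.
    by rewrite /xsection /= inE addrC => By; split=> //; rewrite inE in xA.
  rewrite mule0 (_ : xsection _ _ = set0) ?measure0//.
  apply/seteqP; split=> y //; rewrite /xsection /= inE => -[Ax _].
  by move/negP: xA; rewrite inE.
have E2 : (\int[mu]_x leb (xsection C' x) = leb (-%R @^-1` A) * mu B)%E.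
  rewrite -integral_indicM//.
  apply: eq_integral => x _; rewrite indicE; case: (boolP (x \in B)) => xB.
    rewrite mule1 -(leb_translate (- x) mNA); congr (leb _); apply/seteqP; split=> y /=.
      by rewrite /xsection /= inE opprB => -[].
    by rewrite /xsection /= inE opprB => By; split=> //; rewrite inE in xB.
  rewrite mule0 (_ : xsection _ _ = set0) ?measure0//.
  apply/seteqP; split=> y //; rewrite /xsection /= inE => -[_ Bx].
  by move/negP: xB; rewrite inE.
rewrite -E1 -E2 fubini_sets// fubini_sets//; apply: eq_integral => y _.
rewrite -(muT y (ysection C' y)); last exact: measurable_ysection.
congr (mu _); apply/seteqP; split=> x; rewrite /ysection /= !inE /C /C' /= addrK//.
Qed.

Section balls.
Context {R : realType} {n : nat}.
Local Open Scope ereal_scope.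

Definition cball (r : R) : set 'rV[R]_n := [set x | (enorm x <= r)%R].

Lemma measurable_cball r : measurable (cball r).
Proof.
rewrite -[X in measurable X]setTI.
exact: (measurable_enorm measurableT (@measurable_id _ _ setT) measurableT (measurable_itv `]-oo, r])).
Qed.

Lemma cball_sub_box r : cball r `<=` box (const_mx (- (r + 1)), const_mx r)%R.
Proof.
move=> x xr i /=; rewrite !mxE; have := le_trans (coord_le_enorm x i) xr.
by rewrite ler_norml => /andP[h ->]; rewrite andbT; lra.
Qed.

Lemma leb_cball_lty r : leb (cball r) < +oo.
Proof.
have [r0|r0] := leP 0%R r; last first.
  rewrite (_ : cball r = set0) ?measure0 ?ltry//; apply/seteqP; split => x //= xr.
  by have := le_lt_trans (le_trans (enorm_ge0 x) xr) r0; rewrite ltxx.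
apply: le_lt_trans (le_outer_measure _ _ _ (@cball_sub_box r)) _.
rewrite [X in X < _](@leb_box R n) ?/box_volume ?ltry// => i /=.
by rewrite !mxE; lra.
Qed.

Lemma box_sub_cball1 : box (0, const_mx n.+1%:R^-1)%R `<=` cball 1%R.
Proof.
move=> x bx /=; rewrite /cball /=.
have := @enorm_le_coord _ _ x n.+1%:R^-1%R.
move=> /(_ (ltac:(by rewrite invr_ge0))) /(_ _)/le_trans; apply.
  move=> i; have /= := bx i; rewrite !mxE => /andP[h1 h2].
  by rewrite gtr0_norm.
rewrite mulrC ler_pdivrMr// mul1r.
rewrite -ler_sqr ?nnegrE ?sqrtr_ge0 ?ler0n// sqr_sqrtr//.
by rewrite -natrX ler_nat expnS expn1 (leq_trans (leqnSn n))// leq_pmulr.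
Qed.

Lemma leb_cball1_gt0 : 0 < leb (cball 1%R).
Proof.
apply: lt_le_trans (le_outer_measure _ _ _ box_sub_cball1).
rewrite [X in _ < X](@leb_box R n); last by move=> i /=; rewrite !mxE invr_ge0.
rewrite /box_volume lte_fin; apply: prodr_gt0 => i _.
by rewrite !mxE subr0 normr_gt0 invr_eq0.
Qed.

Lemma leb_cballM (c r : R) : (0 < c)%R -> leb (cball (c * r)%R) = (c ^+ n)%:E * leb (cball r).
Proof.
move=> c0; rewrite -(leb_scale c0); last exact: measurable_cball.
congr (_ * leb _); apply/seteqP; split=> x; rewrite /cball /= enormZ gtr0_norm// ler_pM2l//.
Qed.

End balls.

Lemma emul_cancelr (R : realDomainType) (c x y : \bar R) :
  c \is a fin_num -> (0 < c -> x * c = y * c -> x = y)%E.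
Proof.
move=> cf c0 xy; apply/eqP; rewrite eq_le.
by rewrite -(lee_pmul2r cf c0) -[X in _ && X](lee_pmul2r cf c0) xy lexx.
Qed.

Lemma measurable_preimage d d' (T : measurableType d) (T' : measurableType d')
    (f : T -> T') (A : set T') :
  measurable_fun setT f -> measurable A -> measurable (f @^-1` A).
Proof. by move=> mf mA; rewrite -[X in measurable X]setTI; exact: mf. Qed.

Section isometries.
Context {R : realType} {n : nat}.
Local Open Scope ereal_scope.

Lemma leb_opp (A : set 'rV[R]_n) : measurable A -> leb (-%R @^-1` A) = leb A.
Proof.
move=> mA; have := @translation_invariant_leb _ _ (@leb R n) A (box (0, const_mx 1)%R).
rewrite /= leb_unit_box !mule1 => h; apply/esym/h => //; last exact: measurable_box.
by move=> v C; exact: leb_translate.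
Qed.

(** The image of Lebesgue measure is translation invariant, hence proportional to Lebesgue measure,
    and the unit ball shows that the constant is 1. *)
Lemma leb_isometry (Q Q' : 'rV[R]_n -> 'rV[R]_n) (A : set 'rV[R]_n) :
  measurable_fun setT Q -> {morph Q : x y / (x + y)%R} -> cancel Q' Q ->
  (forall x, enorm (Q x) = enorm x) -> measurable A ->
  leb (Q @^-1` A) = leb A.
Proof.
move=> mQ QD QK nQ mA.
pose mu := push_measure leb mQ.
have muball r : mu (cball r) = leb (@cball R n r).
  have E : Q @^-1` cball r = cball r.
    by apply/seteqP; split => x; rewrite /cball /= nQ.
  by rewrite -[in RHS]E.
have sf : sigma_finite setT mu.
  exists (fun k => cball k%:R).
    apply/seteqP; split => // x _; exists (Num.truncn (enorm x)).+1 => //=.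
    by rewrite /cball /=; apply/ltW; rewrite truncnS_gt.
  move=> k; split; first exact: measurable_cball.
  by rewrite muball leb_cball_lty.
have := @translation_invariant_leb _ _ (with_sigma_finite sf) A (cball 1%R).
rewrite /= /with_sigma_finite muball leb_opp//.
have b0 := @leb_cball1_gt0 R n.
have bfin : leb (@cball R n 1%R) \is a fin_num.
  by rewrite ge0_fin_numE ?leb_cball_lty// ltW.
move=> h; have {}h : mu A * leb (@cball R n 1%R) = leb A * leb (@cball R n 1%R).
  apply: h => //; last exact: measurable_cball.
  move=> v C mC; have mQC : measurable (Q @^-1` C) by rewrite -[X in measurable X]setTI; exact: (mQ measurableT C mC).
  rewrite /pushforward -(leb_translate (Q' v) mQC).
  have -> // : (Q @^-1` ((fun x => x + v)%R @^-1` C)) = ((fun x => x + Q' v)%R @^-1` (Q @^-1` C)).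
  by apply/seteqP; split=> x /=; rewrite QD QK.
have : mu A = leb A; last by [].
by apply: (emul_cancelr bfin b0).
Qed.

Definition householder (v x : 'rV[R]_n) : 'rV[R]_n :=
  (x - (2 * dotp x v / dotp v v) *: v)%R.

Lemma householderD v : {morph householder v : x y / (x + y)%R}.
Proof.
move=> x y; rewrite /householder dotpE; apply/rowP => i; rewrite !mxE; ring.
Qed.

Lemma householderN v x : householder v (- x)%R = (- householder v x)%R.
Proof.
rewrite /householder dotpE; apply/rowP => i; rewrite !mxE; ring.
Qed.

Lemma householderZ v a x : householder v (a *: x)%R = (a *: householder v x)%R.
Proof.
rewrite /householder dotpE; apply/rowP => i; rewrite !mxE; ring.
Qed.

Lemma dotp_householder v x : dotp (householder v x) v = (- dotp x v)%R.
Proof.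
have [->|v0] := eqVneq v 0%R.
  by rewrite -(scale0r 0%R) !dotpE !mul0r oppr0.
by rewrite /householder !dotpE; field; rewrite dotpxx_eq0.
Qed.

Lemma householderK v : involutive (householder v).
Proof.
move=> x; rewrite {1}/householder dotp_householder /householder.
by apply/rowP => i; rewrite !mxE; ring.
Qed.

Lemma enorm_householder v x : enorm (householder v x) = enorm x.
Proof.
rewrite !enormE; congr Num.sqrt.
have [->|v0] := eqVneq v 0%R; first by rewrite /householder scaler0 subr0.
by rewrite /householder !dotpE (dotpC v x); field; rewrite dotpxx_eq0.
Qed.

Lemma measurable_householder v : measurable_fun setT (householder v).
Proof.
apply: measurable_rV_D => //; apply: measurable_rV_N => //.
apply: measurable_rV_Z => //; apply: measurable_funM => //; apply: measurable_funM => //.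
exact: measurable_dotp.
Qed.

Lemma leb_householder v (A : set 'rV[R]_n) : measurable A -> leb (householder v @^-1` A) = leb A.
Proof.
apply: leb_isometry.
- exact: measurable_householder.
- exact: householderD.
- exact: householderK.
- exact: enorm_householder.
Qed.

Lemma householder_swap (x y : 'rV[R]_n) : enorm x = enorm y ->
  householder (x - y)%R x = y.
Proof.
move=> /(congr1 (fun t => t ^+ 2)%R); rewrite !enorm_sqr => xy.
have [/eqP|v0] := eqVneq (x - y)%R 0%R.
  by rewrite subr_eq0 => /eqP ->; rewrite /householder subrr scaler0 subr0.
rewrite /householder (_ : (_ / _)%R = 1%R) ?scale1r ?subKr//.
have d0 : dotp (x - y) (x - y) != 0%R by rewrite dotpxx_eq0.
apply: (mulIf d0); rewrite divfK// mul1r !dotpE (dotpC y x) -xy; ring.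
Qed.

End isometries.

(** * The isodiametric inequality *)

Lemma rV_open_measurable (R : realType) n (A : set 'rV[R]_n) :
  (forall x : 'rV[R]_n, A x -> exists2 e : R, 0 < e & forall y : 'rV[R]_n, (forall i, `|y 0 i - x 0 i| < e) -> A y) ->
  measurable A.
Proof.
move=> opA.
have [dl [dl0 hdl]] : exists dl : nat -> R, (forall k, 0 < dl k) /\
    (forall e, 0 < e -> exists k, dl k < e).
  exists (fun k => k.+1%:R^-1); split => [k|e e0]; first by rewrite invr_gt0.
  exists (Num.truncn e^-1); rewrite invf_plt ?posrE//.
  by rewrite truncnS_gt.
pose B (p : 'rV[rat]_n * nat) : set 'rV[R]_n :=
  box (\row_i (ratr (p.1 0 i) - dl p.2), \row_i (ratr (p.1 0 i) + dl p.2)).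
have -> : A = \bigcup_k (if unpickle k is Some p then
     (if `[< B p `<=` A >] then B p else set0) else set0).
  apply/seteqP; split=> x; last first.
    by move=> [k _]; case: (unpickle k) => // p; case: asboolP => // h; exact: h.
  move=> /opA[e e0 h].
  have [k ke] := hdl (e / 2) (ltac:(by rewrite divr_gt0)).
  have k0 := dl0 k.
  have [q hq] : exists q : 'I_n -> rat, forall i, `|ratr (q i) - x 0 i| < dl k.
    suff : forall i, exists q : rat, `|ratr q - x 0 i| < dl k.
      by move=> /choice[q hq]; exists q.
    move=> i; have [|q] := @rat_in_itvoo R (x 0 i - dl k) (x 0 i + dl k).
      by lra.
    rewrite in_itv /= => /andP[q1 q2]; exists q; rewrite ltr_norml; apply/andP; split; lra.
  exists (pickle (\row_i q i, k)) => //; rewrite pickleK.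
  have Bx : B (\row_i q i, k) x.
    move=> i; rewrite !mxE /=; have := hq i; rewrite ltr_norml => /andP[? ?].
    by apply/andP; split; lra.
  case: asboolP => // -[] y By; apply: h => i.
  have := By i; have := Bx i; rewrite !mxE /= => /andP[? ?] /andP[? ?].
  by rewrite ltr_norml; apply/andP; split; lra.
apply: bigcupT_measurable => k; case: (unpickle k) => // p; case: ifP => // _.
exact: measurable_box.
Qed.

Lemma open_measurable_rV (R : realType) n (A : set 'rV[R]_n) : open A -> measurable A.
Proof.
rewrite openE => oA; apply: rV_open_measurable => x /oA.
rewrite /interior /= -nbhs_ballE => -[e /= e0 h]; exists e => // y hy; apply: h.
by split => // i j; rewrite /ball /= ord1 distrC.
Qed.

Section slices.
Local Open Scope ereal_scope.
Context {R : realType} {n : nat} (i : 'I_n.+1) (A : set 'rV[R]_n.+1).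
Hypothesis mA : measurable A.

Definition slice (x : 'rV[R]_n) : set R := [set t | A (ins i t x)].
Definition slice_length (x : 'rV[R]_n) : \bar R := lebesgue_measure (slice x).

Let C := [set tx : R * 'rV[R]_n | A (ins i tx.1 tx.2)].
Let mC : measurable (C : set (measurableTypeR R * 'rV[R]_n)%type).
Proof.
rewrite (_ : C = (fun tx : R * 'rV[R]_n => ins i tx.1 tx.2) @^-1` A)//.
apply: measurable_preimage => //; exact: measurable_ins.
Qed.

Let ysectionC x : ysection C x = slice x.
Proof. by apply/seteqP; split=> t /=; rewrite /ysection /= inE. Qed.

Lemma measurable_slice x : measurable (slice x : set (measurableTypeR R)).
Proof. by rewrite -ysectionC; exact: measurable_ysection. Qed.

Lemma measurable_slice_length : measurable_fun setT slice_length.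
Proof.
rewrite (_ : slice_length = lebesgue_measure \o ysection C); last first.
  by apply/funext => x /=; rewrite ysectionC.
exact: measurable_fun_ysection.
Qed.

Lemma leb_slices : leb A = \int[leb]_x slice_length x.
Proof.
rewrite (leb_ins i)// /pushforward /product_measure1 /= fubini_sets//.
by apply: eq_integral => x _; rewrite ysectionC.
Qed.

End slices.

Lemma lebesgue_measure_sym_itv (R : realType) (l : \bar R) : (0 <= l)%E ->
  lebesgue_measure [set t : R | ((2 * `|t|)%:E < l)%E] = l.
Proof.
case: l => [l| |] //; rewrite ?lee_fin => l0; last first.
  rewrite (_ : [set _ | _] = `]-oo, +oo[%classic) ?lebesgue_measure_itv//.
  by rewrite set_itvNyy; apply/seteqP; split => // t _ /=; rewrite ltry.
rewrite (_ : [set _ | _] = `]- (l / 2), l / 2[%classic).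
  rewrite lebesgue_measure_itv /= lte_fin; case: ltP => h.
    by rewrite -EFinD; congr EFin; lra.
  by congr EFin; lra.
apply/seteqP; split => t /=; rewrite lte_fin in_itv /= -ltr_norml; lra.
Qed.

Lemma lebesgue_measure_sub_itv (R : realType) (B : set R) (a b : R) :
  B `<=` `[a, b]%classic -> measurable (B : set (measurableTypeR R)) -> a <= b ->
  (lebesgue_measure B <= (b - a)%:E)%E.
Proof.
move=> Bab mB ab; apply: (@le_trans _ _ (lebesgue_measure `[a, b]%classic)).
  by apply: le_measure => //; rewrite inE //; exact: measurable_itv.
rewrite lebesgue_measure_itv /= lte_fin; case: ltP => //= h.
by rewrite lee_fin subr_ge0.
Qed.

Definition diam_le (R : realType) n (d : R) (A : set 'rV[R]_n) :=
  forall x y, A x -> A y -> enorm (x - y) <= d.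

Definition flip (R : realType) n (j : 'I_n) (x : 'rV[R]_n) : 'rV[R]_n :=
  upd x j (- x 0 j).

(** Each line in direction i meets the symmetrized set in an interval centred at 0, of the same
    length as the slice of A. *)
Section steiner.
Local Open Scope ereal_scope.
Context {R : realType} {n : nat} (i : 'I_n.+1) (A : set 'rV[R]_n.+1).
Hypothesis mA : measurable A.

Definition steiner : set 'rV[R]_n.+1 :=
  [set x : 'rV[R]_n.+1 | (2 * `|x 0%R i|)%:E < slice_length i A (del i x)].

Lemma measurable_del : measurable_fun setT (@del R n i).
Proof.
apply/measurable_fun_rVP => // j; under eq_fun do rewrite mxE.
exact: measurable_coord.
Qed.

Lemma measurable_steiner : measurable steiner.
Proof.
have m1 : measurable_fun [set: 'rV[R]_n.+1] (fun x : 'rV[R]_n.+1 => (2 * `|x 0%R i|)%:E).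
  apply/measurable_EFinP; apply: measurable_funM => //.
  apply: measurableT_comp; first exact: normr_measurable.
  exact: measurable_coord.
have m2 : measurable_fun [set: 'rV[R]_n.+1] (fun x : 'rV[R]_n.+1 => slice_length i A (del i x)).
  by apply: measurableT_comp; [exact: measurable_slice_length|exact: measurable_del].
rewrite -[X in measurable X]setTI; exact: emeasurable_fun_lt.
Qed.

Lemma slice_length_ge0 x : 0 <= slice_length i A x.
Proof. exact: measure_ge0. Qed.

Lemma leb_steiner : leb steiner = leb A.
Proof.
rewrite (leb_slices i)//; last exact: measurable_steiner.
rewrite (leb_slices i)//; apply: eq_integral => x _.
rewrite {1}/slice_length -[RHS]lebesgue_measure_sym_itv ?slice_length_ge0//.
congr (lebesgue_measure _); apply/seteqP; split => t;
  by rewrite /slice /steiner /= ins_same del_ins.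
Qed.

(** Otherwise all distances between the two slices are at most |s - t|.  The hulls of the slices then
    have total length at most 2 |s - t| <= 2 |s| + 2 |t|, which is below the sum of the lengths. *)
Lemma steiner_slices (x y : 'rV[R]_n) (s t : R) :
  (2 * `|s|)%:E < slice_length i A x -> (2 * `|t|)%:E < slice_length i A y ->
  exists s1 t1, [/\ A (ins i s1 x), A (ins i t1 y) & `|s - t| <= `|s1 - t1|]%R.
Proof.
move=> xs yt; apply: contrapT => /forallNP h.
have {}h s1 t1 : A (ins i s1 x) -> A (ins i t1 y) -> (`|s1 - t1| <= `|s - t|)%R.
  move=> As At; rewrite leNgt; apply/negP => st.
  by apply: (h s1); exists t1; split => //; exact: ltW.
have ne z (r : R) : (2 * `|r|)%:E < slice_length i A z -> exists w, slice i A z w.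
  move=> zr; apply: contrapT => /forallNP z0.
  have : slice_length i A z = 0.
    by rewrite /slice_length (_ : slice i A z = set0) ?measure0//; apply/seteqP; split.
  move=> E; move: zr; rewrite E lte_fin ltNge.
  by rewrite mulr_ge0.
have [s0 Ss0] := ne _ _ xs; have [t0 St0] := ne _ _ yt.
pose D : R := (`|s - t|)%R.
pose Y := slice i A y.
have Ylo w : Y w -> (s0 - D <= w <= s0 + D)%R.
  move=> /(h _ _ Ss0); rewrite ler_norml -/D => /andP[? ?]; apply/andP; split; lra.
have hsY : has_sup Y.
  by split; [exists t0|exists (s0 + D)%R => w /Ylo /andP[]].
have hiY : has_inf Y.
  by split; [exists t0|exists (s0 - D)%R => w /Ylo /andP[]].
have Yab : Y `<=` `[inf Y, sup Y]%classic.
  move=> w Yw /=; rewrite in_itv /=; apply/andP; split.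
    exact: (ge_inf hiY.2).
  exact: (ub_le_sup hsY.2).
(* the hull of the first slice is bounded in terms of the hull of the second one *)
have Xab : slice i A x `<=` `[(sup Y - D)%R, (inf Y + D)%R]%classic.
  move=> w Xw /=; rewrite in_itv /=; apply/andP; split.
    rewrite lerBlDr; apply: ge_sup hsY.1 _ => v /(h _ _ Xw).
    by rewrite ler_norml -/D => /andP[? ?]; lra.
  rewrite -lerBlDr; apply: lb_le_inf hiY.1 _ => v /(h _ _ Xw).
  by rewrite ler_norml -/D => /andP[? ?]; lra.
have aY := Yab _ St0; have aX := Xab _ Ss0.
rewrite /= !in_itv /= in aY aX.
have lx := lebesgue_measure_sub_itv Xab (measurable_slice i mA x) _.
have ly := lebesgue_measure_sub_itv Yab (measurable_slice i mA y) _.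
have := lt_le_trans xs (lx _); have := lt_le_trans yt (ly _).
rewrite !lte_fin; have := ler_normB s t; rewrite -/D.
case/andP: aX => ? ?; case/andP: aY => ? ?.
move=> ? h1 h2; have /h1 {}h1 : (inf Y <= sup Y)%R by lra.
have /h2 : (sup Y - D <= inf Y + D)%R by lra.
lra.
Qed.

Lemma enorm_ins_sqr (x : 'rV[R]_n) (t : R) : (enorm (ins i t x) ^+ 2 = t ^+ 2 + enorm x ^+ 2)%R.
Proof.
rewrite !enorm_sqr /dotp (bigD1_ord i)//= ins_same -expr2; congr (_ + _)%R.
by apply: eq_bigr => j _; rewrite !ins_lift.
Qed.

Lemma insB (x y : 'rV[R]_n) (s t : R) : (ins i s x - ins i t y = ins i (s - t) (x - y))%R.
Proof.
apply/rowP => j; have [k ->|->] := unliftP i j; rewrite !mxE.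
  by rewrite liftK /= !mxE.
by rewrite unlift_none.
Qed.

Lemma steiner_diam d : diam_le d A -> diam_le d steiner.
Proof.
move=> hA x y; rewrite /steiner /= => Sx Sy.
have [s1 [t1 [As At st]]] := steiner_slices Sx Sy.
apply: le_trans (hA _ _ As At).
rewrite -ler_sqr ?nnegrE ?enorm_ge0//.
rewrite -(ins_del i x) -(ins_del i y) !insB !enorm_ins_sqr !del_ins lerD2r.
by rewrite -real_normK ?num_real// -[leRHS]real_normK ?num_real// ler_sqr ?nnegrE.
Qed.

Lemma del_flip_same (x : 'rV[R]_n.+1) : del i (flip i x) = del i x.
Proof.
by apply/rowP => j; rewrite !mxE eq_sym (negPf (neq_lift _ _)).
Qed.

Lemma steiner_flip x : steiner x -> steiner (flip i x).
Proof. by rewrite /steiner /= del_flip_same mxE eqxx normrN. Qed.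

(** Symmetrization in direction i keeps the symmetries already obtained in the other directions. *)
Lemma steiner_flip_lift (k : 'I_n) : (forall x, A x -> A (flip (lift i k) x)) ->
  forall x, steiner x -> steiner (flip (lift i k) x).
Proof.
move=> hA x; rewrite /steiner /=.
have -> : flip (lift i k) x 0%R i = x 0%R i.
  by rewrite mxE (negPf (neq_lift _ _)).
have dk : del i (flip (lift i k) x) = flip k (del i x).
  by apply/rowP => j; rewrite !mxE (inj_eq lift_inj); case: eqP => // ->.
rewrite dk; suff -> : slice_length i A (flip k (del i x)) = slice_length i A (del i x) by [].
have ik (t : R) (z : 'rV[R]_n) : ins i t (flip k z) = flip (lift i k) (ins i t z).
  apply/rowP => j; have [l ->|->] := unliftP i j.
    by rewrite ins_lift [RHS]mxE (inj_eq lift_inj) !ins_lift mxE.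
  by rewrite ins_same [RHS]mxE (negPf (neq_lift _ _)) ins_same.
have fK (z : 'rV[R]_n) : flip k (flip k z) = z.
  by apply/rowP => j; rewrite !mxE eqxx opprK; case: eqP => // ->.
congr (lebesgue_measure _); apply/seteqP; split => t; rewrite /slice /=.
  by rewrite ik => /hA; rewrite -!ik fK.
by move=> /hA; rewrite -ik.
Qed.

End steiner.

Lemma flips_opp (R : realType) n (A : set 'rV[R]_n) :
  (forall j x, A x -> A (flip j x)) -> forall x, A x -> A (- x).
Proof.
move=> h x Ax.
suff : forall k, A (\row_j if (j < k)%N then - x 0 j else x 0 j).
  move=> /(_ n); congr A; apply/rowP => j; by rewrite !mxE ltn_ord.
elim=> [|k IHk]; first by rewrite (_ : \row__ _ = x)//; apply/rowP => j; rewrite mxE.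
have [kn|kn] := ltnP k n; last first.
  rewrite (_ : \row__ _ = \row_j if (j < k)%N then - x 0 j else x 0 j)//.
  apply/rowP => j; rewrite !mxE (leq_trans (ltn_ord j) kn).
  by rewrite (leq_trans (ltn_ord j) (leqW kn)).
rewrite (_ : \row__ _ = flip (Ordinal kn) (\row_j if (j < k)%N then - x 0 j else x 0 j)).
  exact: h.
apply/rowP => j; rewrite !mxE /= ltnn ltnS -val_eqE /= leq_eqVlt.
by case: eqP => //= jk; rewrite (_ : j = Ordinal kn)//; apply/val_inj.
Qed.

(** Symmetrizing successively in all coordinate directions keeps the measure and does not increase the
    diameter.  The result is symmetric about 0, so a point x is at distance 2 |x| <= d from -x. *)
Lemma isodiametric_borel (R : realType) n (A : set 'rV[R]_n) d : measurable A ->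
  diam_le d A -> (leb A <= leb (@cball R n (d / 2)))%E.
Proof.
move=> mA dA.
suff [B [mB -> dB fB]] : exists B : set 'rV[R]_n, [/\ measurable B, leb A = leb B, diam_le d B &
    forall j x, B x -> B (flip j x)].
  apply: le_measure; rewrite ?inE//; first exact: measurable_cball.
  move=> x Bx; rewrite /cball /=.
  have := dB _ _ Bx (flips_opp fB Bx).
  rewrite opprK -mulr2n -scaler_nat enormZ ger0_norm//; lra.
case: n A mA dA => [|n] A mA dA.
  by exists A; split => // -[].
suff : forall k, exists B : set 'rV[R]_n.+1, [/\ measurable B, leb A = leb B, diam_le d B &
    forall (j : 'I_n.+1) x, (j < k)%N -> B x -> B (flip j x)].
  by move=> /(_ n.+1)[B [? ? ? h]]; exists B; split => // j x; exact: h.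
elim=> [|k [B [mB AB dB fB]]]; first by exists A; split.
have [kn|kn] := ltnP k n.+1; last first.
  by exists B; split => // j x _; apply: fB; exact: leq_trans (ltn_ord j) kn.
pose i := Ordinal kn; exists (steiner i B); split.
- exact: measurable_steiner.
- by rewrite leb_steiner.
- exact: steiner_diam.
- move=> j x; rewrite ltnS leq_eqVlt => /orP[/eqP jk|jk].
    by rewrite (_ : j = i); [exact: steiner_flip|exact: val_inj].
  have [l jl|ji] := unliftP i j; last by rewrite ji /= ltnn in jk.
  by rewrite jl; apply: steiner_flip_lift => // z; apply: fB; rewrite -jl.
Qed.

(** Let G be the set of the points at distance at most d from every point of F, and B that of the points
    at distance at most d from every point of G.  As F lies in G, so does B, whence B has diameter at
    most d. *)
Lemma diam_le_hull (R : realType) n (F : set 'rV[R]_n) d : diam_le d F ->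
  exists B, [/\ measurable B, F `<=` B & diam_le d B].
Proof.
move=> dF.
pose P (G : set 'rV[R]_n) := [set x | forall y, G y -> enorm (x - y) <= d].
have mP G : measurable (P G).
  rewrite -(setCK (P G)); apply: measurableC; apply: rV_open_measurable => x.
  move=> /= /existsNP[y /not_implyP[Gy]] /negP; rewrite -ltNge => dxy.
  exists ((enorm (x - y) - d) / (Num.sqrt n%:R + 1)).
    by rewrite divr_gt0 ?subr_gt0// addr_gt0 ?ltr_wpDl ?sqrtr_ge0.
  move=> z xz; apply/existsNP; exists y; apply/not_implyP; split => //.
  apply/negP; rewrite -ltNge.
  have s0 := sqrtr_ge0 (n%:R : R).
  have := @enorm_le_coord _ _ (z - x) ((enorm (x - y) - d) / (Num.sqrt n%:R + 1)).
  have e0 : 0 <= (enorm (x - y) - d) / (Num.sqrt n%:R + 1).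
    by rewrite divr_ge0 ?subr_ge0 ?ltW// ltr_wpDl.
  move=> /(_ e0) h.
  have {}h : enorm (z - x) <= (enorm (x - y) - d) / (Num.sqrt n%:R + 1) * Num.sqrt n%:R.
    by apply: h => i; rewrite !mxE ltW.
  have {}h : enorm (z - x) < enorm (x - y) - d.
    apply: le_lt_trans h _; rewrite -mulrA gtr_pMr ?subr_gt0//.
    by rewrite mulrC ltr_pdivrMr ?mul1r ?ltrDl// ltr_wpDl.
  have := ler_enormD (x - z) (z - y); rewrite addrA subrK (enormC x z); lra.
exists (P (P F)); split => //; first by move=> x Fx y; rewrite enormC; exact.
move=> x y PPx PPy; apply: PPx => z Fz; apply: PPy => w Fw; exact: dF.
Qed.

Lemma isodiametric (R : realType) n (F : set 'rV[R]_n) d : diam_le d F ->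
  (lebesgue_outer F <= leb (@cball R n (d / 2)))%E.
Proof.
move=> /diam_le_hull[B [mB FB dB]]; apply: le_trans (isodiametric_borel mB dB).
exact: le_outer_measure.
Qed.

(** * Hausdorff measure of Borel sets *)

Section hausdorff_basic.
Local Open Scope ereal_scope.
Context {R : realType} {n : nat}.
Implicit Types (E A : set 'rV[R]_n).

Lemma diameter_leP E (d : R) : diameter E <= d%:E <-> diam_le d E.
Proof.
split=> [h x y Ex Ey|h].
  rewrite -lee_fin; apply: le_trans h; apply: ereal_sup_ubound.
  by exists (x, y).
by apply: ge_ereal_sup => _ [[x y] [/= Ex Ey] <-]; rewrite lee_fin; exact: h.
Qed.

Lemma fine_diameter_ge0 E : (0 <= fine (diameter E))%R.
Proof.
have [->|/set0P[x Ex]] := eqVneq E set0.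
  by rewrite /diameter setX0 image_set0 ereal_sup0.
apply/fine_ge0/le_ereal_sup_tmp; exists (enorm (x - x))%:E.
  by exists (x, x).
by rewrite lee_fin enorm_ge0.
Qed.

Lemma diam_le_fine E (d : R) : diameter E <= d%:E -> diam_le (fine (diameter E)) E.
Proof.
move=> h x y Ex Ey.
have xy : (enorm (x - y))%:E <= diameter E by apply: ereal_sup_ubound; exists (x, y).
have Ef : diameter E \is a fin_num.
  by rewrite fin_numE -ltNye -ltey (lt_le_trans _ xy) ?ltNyr//= (le_lt_trans h) ?ltry.
by rewrite -lee_fin fineK.
Qed.

Lemma fine_diameter_le E (d : R) : (0 <= d)%R -> diam_le d E -> (fine (diameter E) <= d)%R.
Proof.
move=> d0 /diameter_leP; case: (diameter E) => [r| |] //=; by rewrite lee_fin.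
Qed.

Lemma unit_ball_volume_ge0 k : 0 <= unit_ball_volume k :> \bar R.
Proof. exact: outer_measure_ge0. Qed.

Lemma hausdorff_cost_ge0 k E : 0 <= hausdorff_cost k E.
Proof.
by rewrite mule_ge0 ?unit_ball_volume_ge0// lee_fin exprn_ge0// divr_ge0// fine_diameter_ge0.
Qed.

Lemma hausdorff_cost_le k E (d : R) : (0 <= d)%R -> diam_le d E ->
  hausdorff_cost k E <= unit_ball_volume k * ((d / 2) ^+ k)%:E.
Proof.
move=> d0 hE; apply: lee_pmul; rewrite ?unit_ball_volume_ge0 ?lee_fin//.
  by rewrite exprn_ge0// divr_ge0// fine_diameter_ge0.
apply: lerXn2r; rewrite ?nnegrE ?divr_ge0 ?fine_diameter_ge0//.
by rewrite ler_pM2r// fine_diameter_le.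
Qed.

Variable k : nat.

HB.instance Definition _ (d : R) := isOuterMeasure.Build R 'rV[R]_n (hausdorff_delta k d)
  (cover_measure0 _ _ (hausdorff_cost_ge0 k)) (cover_measure_ge0 _ _ (hausdorff_cost_ge0 k))
  (@le_cover_measure _ _ _ _ _ _)
  (cover_measure_sigma_subadditive _ _ (hausdorff_cost_ge0 k)).

Lemma hausdorff_delta_le (d : R) A : (0 < d)%R -> hausdorff_delta k d A <= hausdorff_outer k A.
Proof. by move=> d0; apply: ereal_sup_ubound; exists d. Qed.

Lemma hausdorff_outer_leP A (c : \bar R) :
  (forall d, (0 < d)%R -> hausdorff_delta k d A <= c) -> hausdorff_outer k A <= c.
Proof. by move=> h; apply: ge_ereal_sup => _ [d d0 <-]; exact: h. Qed.

Lemma hausdorff_delta_anti (d d' : R) A : (d <= d')%R ->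
  hausdorff_delta k d' A <= hausdorff_delta k d A.
Proof.
move=> dd'; apply: le_cover_measureP => F [DF AF].
apply: ereal_inf_lbound; exists F => //; split => // j E /DF /= h.
by apply: le_trans h _; rewrite lee_fin.
Qed.

Definition separated (A B : set 'rV[R]_n) := exists2 e : R, (0 < e)%R &
  forall x y, A x -> B y -> (e <= enorm (x - y))%R.

(** A covering set of diameter below e cannot meet both sets, so each cover splits. *)
Lemma hausdorff_delta_separated (e d : R) A B : (0 <= d)%R -> (d < e)%R ->
  (forall x y, A x -> B y -> (e <= enorm (x - y))%R) ->
  hausdorff_delta k d A + hausdorff_delta k d B <= hausdorff_delta k d (A `|` B).
Proof.
move=> d0 de sAB; apply: le_cover_measureP => F [DF ABF].
pose G (X : set 'rV[R]_n) j :=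
  if F j is Some E then if `[< E `&` X !=set0 >] then Some E else None else None.
have GX X : X `<=` A `|` B -> hausdorff_delta k d X <= \sum_(j <oo) oapp (hausdorff_cost k) 0 (G X j).
  move=> XAB; apply: ereal_inf_lbound; exists (G X) => //; split.
    move=> j E; rewrite /G; case FE : (F j) => [E'|]//; case: ifP => // _ [<-].
    exact: DF FE.
  move=> x Xx; have [j _] := ABF _ (XAB _ Xx); case FE : (F j) => [E|] //= Ex.
  exists j => //; rewrite /G FE; case: asboolP => //= h; apply: h; by exists x.
apply: le_trans (leeD (GX A _) (GX B _)) _; [by left|by right|].
have G0 X j : 0 <= oapp (hausdorff_cost k) 0 (G X j).
  by case: (G X j) => //= E; exact: hausdorff_cost_ge0.
rewrite -nneseriesD//.
apply: lee_nneseries => j _; first by move=> _; rewrite adde_ge0.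
rewrite /G; case FE : (F j) => [E|] //=; last by rewrite adde0.
case: asboolP => [[x [Ex Ax]]|_]; case: asboolP => [[y [Ey By]]|_] /=;
  rewrite ?adde0 ?add0e ?hausdorff_cost_ge0//.
have /diameter_leP hE := DF _ _ FE.
by have := lt_le_trans de (sAB _ _ Ax By); rewrite ltNge hE.
Qed.

Lemma hausdorff_separated A B : separated A B ->
  hausdorff_outer k A + hausdorff_outer k B <= hausdorff_outer k (A `|` B).
Proof.
move=> [e e0 sAB].
have h d1 d2 : (0 < d1)%R -> (0 < d2)%R ->
    hausdorff_delta k d1 A + hausdorff_delta k d2 B <= hausdorff_outer k (A `|` B).
  move=> d10 d20.
  pose d := Num.min (e / 2)%R (Num.min d1 d2).
  have d0 : (0 < d)%R by rewrite !lt_min d10 d20 divr_gt0.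
  apply: (@le_trans _ _ (hausdorff_delta k d (A `|` B))); last exact: hausdorff_delta_le.
  apply: le_trans (@hausdorff_delta_separated e d A B (ltW d0) _ sAB).
    by apply: leeD; apply: hausdorff_delta_anti; rewrite !ge_min lexx ?orbT.
  by rewrite gt_min; apply/orP; left; lra.
have [M|Mfin] := eqVneq (hausdorff_outer k (A `|` B)) +oo; first by rewrite M leey.
have AM : hausdorff_outer k A <= hausdorff_outer k (A `|` B) by apply: le_outer_measure; left.
have BM : hausdorff_outer k B <= hausdorff_outer k (A `|` B) by apply: le_outer_measure; right.
have ABf : hausdorff_outer k (A `|` B) \is a fin_num.
  by rewrite ge0_fin_numE ?outer_measure_ge0// lt_neqAle Mfin leey.
have Af : hausdorff_outer k A \is a fin_num.
  by rewrite ge0_fin_numE ?outer_measure_ge0// (le_lt_trans AM)// -ge0_fin_numE ?outer_measure_ge0.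
have Bf d : (0 < d)%R -> hausdorff_delta k d B \is a fin_num.
  move=> d0; rewrite ge0_fin_numE ?outer_measure_ge0//.
  rewrite (le_lt_trans (hausdorff_delta_le _ d0))// (le_lt_trans BM)//.
  by rewrite -ge0_fin_numE ?outer_measure_ge0.
rewrite addeC -leeBrDr//; apply: hausdorff_outer_leP => d2 d20.
rewrite leeBrDr// addeC -leeBrDr ?Bf//; apply: hausdorff_outer_leP => d1 d10.
by rewrite leeBrDr ?Bf//; exact: h.
Qed.

Lemma hausdorff_separated_seq (E : nat -> set 'rV[R]_n) A :
  (forall m, separated (\big[setU/set0]_(l < m) E l) (E m)) ->
  (forall m, E m `<=` A) ->
  forall m, \sum_(l < m) hausdorff_outer k (E l) <= hausdorff_outer k A.
Proof.
move=> sE EA m.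
apply: (@le_trans _ _ (hausdorff_outer k (\big[setU/set0]_(l < m) E l))); last first.
  apply: le_outer_measure; elim/big_rec: _ => // i B _ BA x []; [exact: EA|exact: BA].
elim: m => [|m IHm]; first by rewrite !big_ord0 outer_measure0.
rewrite !big_ord_recr /=; apply: le_trans (hausdorff_separated (sE m)).
exact: leeD.
Qed.

(** The criterion of Caratheodory for metric outer measures.  The part of A outside the half-space is
    exhausted by the parts Q j at distance at least t j from it.  The layers L j in between have
    summable measures, because layers whose indices differ by at least 2 are separated. *)
Lemma hausdorff_halfspace (i : 'I_n) (c : R) :
  (@hausdorff_outer R n k).-caratheodory [set x : 'rV[R]_n | (x 0%R i <= c)%R].
Proof.
apply: (@le_caratheodory_measurable R _ (@hausdorff_outer R n k)) => A /=.
have [->|Afin] := eqVneq (hausdorff_outer k A) +oo; first by rewrite leey.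
have Af : hausdorff_outer k A < +oo by rewrite lt_neqAle Afin leey.
set P := A `&` _.
pose f (x : 'rV[R]_n) := (x 0 i - c)%R.
have lipf x y : (f x - f y <= enorm (x - y))%R.
  by apply: le_trans (coord_le_enorm (x - y) i); rewrite !mxE /f; apply: le_trans (ler_norm _); lra.
pose t (l : nat) : R := l.+1%:R^-1%R.
have tS l : (t l.+1 < t l)%R by rewrite /t ltf_pV2 ?posrE// ltr_nat.
have t0 l : (0 < t l)%R by rewrite /t invr_gt0.
have tle l m : (l <= m)%N -> (t m <= t l)%R.
  by move=> lm; rewrite /t lef_pV2 ?posrE// ler_nat.
pose Q j := A `&` [set x | t j < f x]%R.
pose L j := A `&` [set x | (t j.+1 < f x) && (f x <= t j)]%R.
have PQ j : hausdorff_outer k P + hausdorff_outer k (Q j) <= hausdorff_outer k A.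
  apply: le_trans (hausdorff_separated _) _; last first.
    by apply: le_outer_measure => x [[]|[]].
  exists (t j) => // x y [_ /= xc] [_ /= yj]; rewrite enormC; apply: le_trans (lipf _ _).
  have : (f x <= 0)%R by rewrite /f subr_le0.
  by move: yj; lra.
(* b selects the layers of even or of odd index *)
have sL b m : \sum_(l < m) hausdorff_outer k (L (2 * l + b)%N) <= hausdorff_outer k A.
  apply: (hausdorff_separated_seq (E := fun l => L (2 * l + b)%N)); last by move=> ? x [].
  case=> [|{}m]; first by exists 1%R => // x y; rewrite big_ord0.
  exists (t (2 * m.+1 + b).-1%N - t (2 * m.+1 + b)%N)%R.
    rewrite subr_gt0; have -> : (2 * m.+1 + b = (2 * m + b).+2)%N by lia.
    exact: tS.
  move=> x y; rewrite -(bigcup_mkord _ (fun l => L (2 * l + b)%N)) => -[l /= lm [_ /= /andP[xl _]]] [_ /= /andP[_ ym]].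
  apply: le_trans (lipf _ _).
  have : (t (2 * m.+1 + b).-1%N <= t (2 * l + b).+1%N)%R by apply: tle; lia.
  by move: xl ym; lra.
have sumL : \sum_(l <oo) hausdorff_outer k (L l) < +oo.
  apply: (@le_lt_trans _ _ (hausdorff_outer k A + hausdorff_outer k A)); last first.
    by rewrite lte_add_pinfty.
  apply: lime_le; first by apply: is_cvg_nneseries => *; exact: outer_measure_ge0.
  near=> m.
  apply: (@le_trans _ _ (\sum_(0 <= l < 2 * m) hausdorff_outer k (L l))).
    apply: lee_sum_nneg_natr => //; last by rewrite leq_pmull.
    by move=> *; exact: outer_measure_ge0.
  apply: le_trans (leeD (sL 0%N m) (sL 1%N m)).
  rewrite -big_split /=; move: (m); elim=> [|j IHj].
    by rewrite muln0 big_geq// big_ord0.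
  rewrite (_ : (2 * j.+1 = (2 * j).+2)%N); last by lia.
  rewrite !big_nat_recr//= big_ord_recr/=.
  by rewrite addn0 addn1 -addeA leeD.
have tailL := nneseries_tail_cvg sumL (fun l _ => outer_measure_ge0 (@hausdorff_outer R n k) (L l)).
have Qj j : hausdorff_outer k (A `&` ~` [set x | (x 0%R i <= c)%R]) <=
    hausdorff_outer k (Q j) + \sum_(j <= l <oo) hausdorff_outer k (L l).
  have sub : A `&` ~` [set x | (x 0%R i <= c)%R] `<=` Q j `|` \bigcup_(l in [set l | (j <= l)%N]) L l.
    move=> x [Ax /= /negP]; rewrite -ltNge => cx.
    have fx : (0 < f x)%R by rewrite /f subr_gt0.
    have [xj|xj] := ltP (t j) (f x); first by left.
    right.
    have [m hm] : exists m, (t m < f x)%R.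
      exists (Num.truncn (f x)^-1); rewrite /t invf_plt ?posrE//.
      by rewrite truncnS_gt.
    have := @ex_minnP _ (ex_intro (fun m => t m < f x)%R m hm).
    case=> -[|l] tl lmin; first by have := tle 0%N j (leq0n _); lra.
    have lj : (j <= l)%N.
      rewrite leqNgt; apply/negP => lj; have := tle l.+1 j lj.
      by move: tl; lra.
    exists l => //; split => //=; rewrite tl /=.
    by rewrite leNgt; apply/negP => /lmin; rewrite ltnn.
  apply: le_trans (le_outer_measure _ _ _ sub) _.
  apply: le_trans (outer_measureU2 _ _ _) _; rewrite leeD2l//.
  rewrite (_ : \bigcup_(_ in _) _ = \bigcup_l (if (j <= l)%N then L l else set0)); last first.
    apply/seteqP; split=> x.
      by move=> [l /= jl Ll]; exists l => //; rewrite jl.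
    by move=> [l _]; case: ifPn => // jl Ll; exists l.
  apply: le_trans (outer_measure_sigma_subadditive _ _) _.
  rewrite [leRHS]eseries_cond [leRHS]eseries_mkcond; apply: lee_nneseries => l _.
    by move=> _; exact: outer_measure_ge0.
  by rewrite /=; case: ifPn => // _; rewrite outer_measure0.
apply/lee_addgt0Pr => e e0.
have /fine_cvgP[hfin /cvgrPdist_lt /(_ _ e0) hc] := tailL.
have [j [jfin jl]] : exists j, \sum_(j <= l <oo) hausdorff_outer k (L l) \is a fin_num /\
    (`|0 - fine (\sum_(j <= l <oo) hausdorff_outer k (L l))| < e)%R.
  by near \oo => j; exists j; split; near: j.
apply: le_trans (leeD (lexx _) (Qj j)) _; rewrite addeA; apply: leeD; first exact: PQ.
rewrite -(fineK jfin) lee_fin; move: jl; rewrite sub0r normrN.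
by move=> jl; apply: le_trans (ler_norm _) (ltW jl).
Unshelve. all: by end_near. Qed.

End hausdorff_basic.

Section hausdorff_borel.
Local Open Scope ereal_scope.
Context {R : realType} {n k : nat}.

Lemma hausdorff_outer_borel : measurable `<=` (@hausdorff_outer R n k).-caratheodory.
Proof.
apply: rV_measurable_halfspaces; last exact: hausdorff_halfspace.
exact: (@sigma_algebra_measurable _ (hausdorff_type R n k)).
Qed.

Definition haus : set 'rV[R]_n -> \bar R := hausdorff_outer k.

Let haus0 : haus set0 = 0. Proof. exact: outer_measure0. Qed.
Let haus_ge0 A : 0 <= haus A. Proof. exact: outer_measure_ge0. Qed.
Let haus_sigma_additive : semi_sigma_additive haus.
Proof.
move=> F mF tF mUF.
by apply: caratheodory_measure_sigma_additive => //;
  [move=> j|]; exact: hausdorff_outer_borel.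
Qed.

HB.instance Definition _ := isMeasure.Build _ _ _ haus haus0 haus_ge0 haus_sigma_additive.

End hausdorff_borel.
Arguments haus {R n} k.

Lemma hausdorff_lipschitz (R : realType) n n' k (A : set 'rV[R]_n)
    (f : 'rV[R]_n -> 'rV[R]_n') (L : R) : 0 < L ->
  (forall x y, A x -> A y -> enorm (f x - f y) <= L * enorm (x - y)) ->
  (hausdorff_outer k (f @` A) <= (L ^+ k)%:E * hausdorff_outer k A)%E.
Proof.
move=> L0 hf; apply: hausdorff_outer_leP => d d0.
have Lk0 : (0 < L ^+ k)%R by rewrite exprn_gt0.
have dL0 : 0 < d / L by rewrite divr_gt0.
apply: (@le_trans _ _ ((L ^+ k)%:E * hausdorff_delta k (d / L) A)%E); last first.
  by rewrite lee_pmul2l//; exact: hausdorff_delta_le.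
rewrite -lee_pdivrMl//; apply: le_cover_measureP => F [DF AF].
rewrite lee_pdivrMl// -nneseriesZl; last first.
  by move=> j _; case: (F j) => //= E; exact: hausdorff_cost_ge0.
pose G j := omap (fun E => f @` (E `&` A)) (F j).
have dE E : (diameter E <= (d / L)%:E)%E -> diam_le (L * fine (diameter E)) (f @` (E `&` A)).
  move=> /diam_le_fine hE _ _ [x [Ex Ax] <-] [y [Ey Ay] <-].
  apply: le_trans (hf _ _ Ax Ay) _; rewrite ler_pM2l//; exact: hE.
apply: (@le_trans _ _ (\sum_(j <oo) oapp (hausdorff_cost k) 0 (G j))%E).
  apply: ereal_inf_lbound; exists G => //; split.
    move=> j E; rewrite /G; case FE : (F j) => [E'|]//= [<-].
    apply/diameter_leP => x y fx fy; apply: le_trans (dE _ (DF _ _ FE) _ _ fx fy) _.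
    rewrite mulrC -ler_pdivlMr//; apply: fine_diameter_le; first exact: ltW.
    by apply/diameter_leP; exact: DF FE.
  move=> _ [x Ax <-]; have [j _] := AF _ Ax; case FE : (F j) => [E|] //= Ex.
  by exists j => //; rewrite /G FE /=; exists x.
apply: lee_nneseries => j _.
  by move=> _; case: (G j) => //= E; exact: hausdorff_cost_ge0.
rewrite /G; case FE : (F j) => [E|] //=; last by rewrite mule0.
have := @hausdorff_cost_le _ _ k (f @` (E `&` A)) (L * fine (diameter E)).
move=> /(_ (mulr_ge0 (ltW L0) (fine_diameter_ge0 E)) (dE _ (DF _ _ FE)))/le_trans; apply.
rewrite /hausdorff_cost muleCA -EFinM; apply: lee_pmul => //.
- exact: unit_ball_volume_ge0.
- by rewrite lee_fin exprn_ge0// divr_ge0// mulr_ge0 ?fine_diameter_ge0// ltW.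
- by rewrite -exprMn mulrA.
Qed.

Lemma leb_cball (R : realType) n (r : R) : 0 <= r ->
  leb (@cball R n r) = ((r ^+ n)%:E * leb (@cball R n 1))%E.
Proof.
rewrite le_eqVlt => /predU1P[<-|r0]; last by rewrite -leb_cballM// mulr1.
case: n => [|n].
  rewrite expr0 mul1e; congr leb; apply/seteqP; split=> x _; rewrite /cball /=;
  by rewrite (_ : x = 0) ?enorm0//; apply/rowP => -[].
rewrite expr0n /= mul0e.
have := @leb_cballM R n.+1 2 0 (ltac:(by [])); rewrite mulr0.
have : leb (@cball R n.+1 0) \is a fin_num.
  by rewrite ge0_fin_numE ?measure_ge0 ?leb_cball_lty.
case: (leb (cball 0)) => [v| |]// _; rewrite -EFinM => -[] vv.
have : (2 ^+ n.+1 - 1) * v = 0 by lra.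
move/eqP; rewrite mulf_eq0 => /orP[|/eqP ->//].
by rewrite subr_eq0 gt_eqF// exprn_egt1// ltr1n.
Qed.

(** * Hausdorff and Lebesgue measure in full dimension *)

Section hausdorff_flat.
Local Open Scope ereal_scope.
Context {R : realType} {n : nat}.
Implicit Types A : set 'rV[R]_n.

(** The isodiametric inequality says that the cost of a set bounds its Lebesgue measure; then use the
    extremal property of cover measures. *)
Lemma lebesgue_le_hausdorff A : lebesgue_outer A <= hausdorff_outer n A.
Proof.
apply: le_trans (@hausdorff_delta_le _ _ n 1%R A ltr01).
apply: le_outer_cover_measure => E /= dE.
apply: le_trans (isodiametric (diam_le_fine dE)) _.
by rewrite leb_cball ?divr_ge0 ?fine_diameter_ge0// muleC.
Qed.

Lemma haus_translate (v : 'rV[R]_n) A : haus n ((fun x => x + v)%R @^-1` A) = haus n A.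
Proof.
have le (w : 'rV[R]_n) (B : set 'rV[R]_n) : haus n ((fun x => x + w)%R @^-1` B) <= haus n B.
  have := @hausdorff_lipschitz R n n n B (fun x => x - w)%R 1 ltr01.
  rewrite expr1n mul1e => h; apply: le_trans (h _).
    by apply: le_outer_measure => x /= Bx; exists (x + w)%R => //; rewrite addrK.
  by move=> x y _ _; rewrite mul1r opprD addrACA subrr addr0.
apply/eqP; rewrite eq_le le /=.
apply: le_trans (le (- v)%R _); rewrite le_eqVlt; apply/orP; left; apply/eqP.
by congr (haus n _); apply/seteqP; split=> x /=; rewrite addrNK.
Qed.

Definition ucube : set 'rV[R]_n := box (0, const_mx 1)%R.

Definition grid_pt (p : nat) (c : R) (g : {ffun 'I_n -> 'I_p}) : 'rV[R]_n :=
  (\row_i (((g i)%:R + c) / p%:R))%R.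

Lemma sume_const (J : finType) (c : \bar R) : \sum_(j : J) c = #|J|%:R%:E * c.
Proof.
rewrite big_const; elim: #|J| => [|m IHm]; first by rewrite mul0e.
by rewrite iterS IHm -natr1 EFinD ge0_muleDl ?lee_fin// mul1e addeC.
Qed.

Lemma le_outer_bigsetU (mu : {outer_measure set 'rV[R]_n -> \bar R}) (J : finType)
    (F : J -> set 'rV[R]_n) (c : \bar R) : (forall j, mu (F j) <= c) ->
  mu (\big[setU/set0]_j F j) <= #|J|%:R%:E * c.
Proof.
move=> h; apply: (@le_trans _ _ (\sum_j mu (F j))).
  apply: (big_ind2 (fun A s => mu A <= s)) => [|A a B b Aa Bb|j _] //.
    by rewrite outer_measure0.
  by apply: le_trans (outer_measureU2 _ _ _) _; exact: leeD.
rewrite -sume_const; exact: lee_sum.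
Qed.

Definition grid_cell (p : nat) (g : {ffun 'I_n -> 'I_p}) : set 'rV[R]_n :=
  [set x | forall i, (`|x 0%R i - grid_pt 2^-1 g 0%R i| <= (2 * p%:R)^-1)%R].

Lemma ucube_grid p : (0 < p)%N ->
  ucube `<=` \big[setU/set0]_(g : {ffun 'I_n -> 'I_p}) grid_cell g.
Proof.
move=> p0 x Qx.
have p0R : (0 < p%:R :> R)%R by rewrite ltr0n.
have [g hg] : exists g : 'I_n -> 'I_p, forall i, ((g i)%:R / p%:R <= x 0 i <= (g i).+1%:R / p%:R)%R.
  suff : forall i, exists j : 'I_p, (j%:R / p%:R <= x 0 i <= j.+1%:R / p%:R)%R.
    by move=> /choice[g hg]; exists g.
  move=> i; have /= := Qx i; rewrite !mxE => /andP[x0 x1].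
  have xp0 : (0 <= x 0 i * p%:R)%R by rewrite mulr_ge0 ?ltW.
  have [xp|xp] := ltnP (Num.truncn (x 0%R i * p%:R)%R) p.
    exists (Ordinal xp) => /=; have := truncn_itv xp0 => /andP[h1 h2].
    by rewrite ler_pdivrMr// ler_pdivlMr// h1 ltW.
  have lp : (p.-1 < p)%N by rewrite prednK.
  exists (Ordinal lp) => /=; rewrite prednK// divff ?gt_eqF// x1 andbT.
  rewrite ler_pdivrMr//; apply: le_trans (_ : p%:R <= _)%R.
    by rewrite ler_nat leq_pred.
  by have /andP[h1 _] := truncn_itv xp0; apply: le_trans h1; rewrite ler_nat.
rewrite (bigD1 (finfun g))//=; left => i /=.
rewrite !mxE ffunE; have /andP[] := hg i.
rewrite invfM -[(g i).+1%:R]natr1 !mulrDl mul1r.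
move: (p%:R^-1)%R => w; move: ((g i)%:R * w)%R => z h1 h2.
by rewrite ler_norml; apply/andP; split; lra.
Qed.

Lemma grid_gap (w a b t : R) : (0 < w)%R -> (1 <= a - b)%R \/ (1 <= b - a)%R ->
  (`|t - (a + 2^-1) * w| <= 4^-1 * w)%R -> (`|t - (b + 2^-1) * w| <= 4^-1 * w)%R -> False.
Proof.
move=> w0 ab; rewrite !ler_norml => /andP[h1 h2] /andP[h3 h4].
by case: ab => ab; have := ler_wpM2r (ltW w0) ab; nra.
Qed.

Lemma ffun_card p : #|{: {ffun 'I_n -> 'I_p}}| = (p ^ n)%N.
Proof. by rewrite card_ffun !card_ord. Qed.

Lemma arch_inv (d : R) : (0 < d)%R -> exists2 p, (0 < p)%N & (p%:R^-1 <= d)%R.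
Proof.
move=> d0; exists (Num.truncn d^-1).+1 => //.
by rewrite invf_ple ?posrE// ltW// truncnS_gt.
Qed.

(** The p^n cubes of the regular grid have a total cost that does not depend on p. *)
Lemma haus_ucube_lty : haus n ucube < +oo.
Proof.
pose K : \bar R := unit_ball_volume n * ((Num.sqrt n%:R / 2) ^+ n)%:E.
apply: (@le_lt_trans _ _ K); last first.
  by rewrite lte_mul_pinfty ?unit_ball_volume_ge0 ?ltry// ge0_fin_numE ?unit_ball_volume_ge0 ?leb_cball_lty.
apply: hausdorff_outer_leP => d d0.
have [p p0 pd] : exists2 p, (0 < p)%N & (Num.sqrt n%:R / p%:R <= d :> R)%R.
  have [p p0 h] := @arch_inv (d / (Num.sqrt n%:R + 1))%R (ltac:(by rewrite divr_gt0// ltr_wpDl ?sqrtr_ge0)).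
  exists p => //; apply: (@le_trans _ _ (Num.sqrt n%:R * (d / (Num.sqrt n%:R + 1)))%R).
    by rewrite ler_wpM2l ?sqrtr_ge0.
  by rewrite mulrCA ger_pMr// ler_pdivrMr ?mul1r ?lerDl// ltr_wpDl ?sqrtr_ge0.
have p0R : (0 < p%:R :> R)%R by rewrite ltr0n.
apply: le_trans (le_outer_measure _ _ _ (ucube_grid p0)) _.
pose c : \bar R := unit_ball_volume n * (((Num.sqrt n%:R / p%:R) / 2) ^+ n)%:E.
apply: (@le_trans _ _ (#|{: {ffun 'I_n -> 'I_p}}|%:R%:E * c)).
  apply: le_outer_bigsetU => g.
  have dE : diam_le (Num.sqrt n%:R / p%:R)%R (grid_cell g).
    move=> x y Ex Ey; rewrite mulrC; apply: enorm_le_coord; first by rewrite invr_ge0.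
    move=> i; have := Ex i; have := Ey i; rewrite !mxE invfM.
    move: (p%:R^-1)%R => w; rewrite !ler_norml => /andP[? ?] /andP[? ?].
    by apply/andP; split; lra.
  apply: (@le_trans _ _ (hausdorff_cost n (grid_cell g))).
    apply: cover_measure_le1 => //; first exact: hausdorff_cost_ge0.
    by apply/diameter_leP => x y Ex Ey; apply: le_trans pd; exact: dE.
  by apply: hausdorff_cost_le => //; rewrite divr_ge0 ?sqrtr_ge0.
rewrite ffun_card /c /K muleCA; apply: lee_pmul => //.
- exact: unit_ball_volume_ge0.
- rewrite -EFinM lee_fin natrX -exprMn; apply: lerXn2r.
  + by rewrite nnegrE mulr_ge0// !divr_ge0 ?sqrtr_ge0.
  + by rewrite nnegrE divr_ge0 ?sqrtr_ge0.
  + by rewrite -mulrA [(_^-1 / 2)%R]mulrC !mulrA mulrAC [(_ * Num.sqrt _)%R]mulrC mulfK// gt_eqF.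
Qed.

Lemma haus_sigma_finite : sigma_finite setT (@haus R n n).
Proof.
exists (fun j => box (bigbox R n j)); first by rewrite bigcup_bigbox.
move=> j; split; first exact: measurable_box.
pose L : R := (2 * j.+1%:R)%R.
have L0 : (0 < L)%R by rewrite /L mulr_gt0.
pose f (x : 'rV[R]_n) := (L *: x - const_mx j.+1%:R)%R.
apply: (@le_lt_trans _ _ (haus n (f @` ucube))).
  apply: le_outer_measure => x bx.
  exists (L^-1 *: (x + const_mx j.+1%:R))%R; last first.
    by rewrite /f scalerA divff ?gt_eqF// scale1r addrK.
  move=> i; have /= := bx i; rewrite !mxE => /andP[h1 h2].
  rewrite mulrC divr_gt0 ?ler_pdivrMr ?mul1r// /L -?natr1; lra.
apply: le_lt_trans (hausdorff_lipschitz n L0 _) _.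
  by move=> x y _ _; rewrite /f opprB addrA addrNK -scalerBr enormZ gtr0_norm.
by rewrite lte_mul_pinfty ?lee_fin ?exprn_ge0 ?ltW// haus_ucube_lty.
Qed.

Lemma measure_bigsetU_disjoint d (T : measurableType d) (mu : {measure set T -> \bar R})
    (J : finType) (F : J -> set T) (c : \bar R) :
  (forall j, measurable (F j)) -> (forall i j, i != j -> F i `&` F j = set0) ->
  (forall j, mu (F j) = c) -> mu (\big[setU/set0]_j F j) = #|J|%:R%:E * c.
Proof.
move=> mF dF cF; rewrite -sume_const.
suff : forall s : seq J, uniq s -> mu (\big[setU/set0]_(j <- s) F j) = \sum_(j <- s) c.
  by move=> h; rewrite h ?index_enum_uniq.
elim=> [|j s IHs] /=; first by rewrite !big_nil measure0.
move=> /andP[js us]; rewrite !big_cons.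
transitivity (mu (F j) + mu (\big[setU/set0]_(j0 <- s) F j0)); last by rewrite cF IHs.
apply: measureU => //; first by apply: bigsetU_measurable.
apply/seteqP; split=> x //= -[Fj]; rewrite -bigcup_seq => -[i /= si Fi].
have : (F j `&` F i) x by [].
by rewrite dF//; apply: contraNneq js => ->.
Qed.

(** The cost of a ball is its volume, whereas a cube costs more in dimension at least 2, so that covers
    by cubes only show finiteness.  Let h be the measure of the unit cube.  At any scale, disjoint
    small balls fill a fixed fraction theta of the cube, at cost theta.  As Hausdorff measure is
    proportional to Lebesgue measure, the rest of the cube has measure (1 - theta) h.  Hence
    h <= theta + (1 - theta) h. *)
Lemma haus_ucube_le1 : haus n ucube <= 1.
Proof.
have hfin : haus n ucube \is a fin_num by rewrite ge0_fin_numE ?measure_ge0 ?haus_ucube_lty.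
have mQ : measurable ucube by exact: measurable_box.
have bfin : leb (@cball R n 1%R) \is a fin_num.
  by rewrite ge0_fin_numE ?measure_ge0 ?leb_cball_lty.
have b0 := @leb_cball1_gt0 R n.
pose h := fine (haus n ucube).
pose th := ((4^-1) ^+ n * fine (leb (@cball R n 1%R)))%R.
have th0 : (0 < th)%R by rewrite mulr_gt0 ?exprn_gt0 ?invr_gt0// fine_gt0// b0 leb_cball_lty.
suff : (h <= th + (h - h * th))%R.
  rewrite addrA lerBrDr addrC -subr_ge0 -(fineK hfin) lee_fin -/h => hh.
  have : (0 <= th * (1 - h))%R by lra.
  by rewrite pmulr_rge0// subr_ge0.
rewrite -lee_fin {1}/h fineK//; apply: hausdorff_outer_leP => d d0.
have [p p0 pd] := @arch_inv d d0.
have p0R : (0 < p%:R :> R)%R by rewrite ltr0n.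
(* a quarter of the mesh, so that the balls centred in the grid cells are disjoint *)
pose rho : R := (4 * p%:R)^-1%R.
have rho0 : (0 <= rho)%R by rewrite invr_ge0 mulr_ge0.
pose B (g : {ffun 'I_n -> 'I_p}) := (fun x => x - grid_pt 2^-1 g)%R @^-1` cball rho.
have mB g : measurable (B g).
  apply: measurable_preimage; last exact: measurable_cball.
  by apply: measurable_rV_D.
have lebB g : leb (B g) = (rho ^+ n)%:E * leb (@cball R n 1%R).
  by rewrite /B (leb_translate (- grid_pt 2^-1 g)%R (measurable_cball rho)) leb_cball.
have Bcoord g x i : B g x -> (`|x 0 i - grid_pt 2^-1 g 0 i| <= rho)%R.
  by rewrite /B /cball /= => h1; apply: le_trans h1; have := coord_le_enorm (x - grid_pt 2^-1 g) i; rewrite !mxE.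
pose U := \big[setU/set0]_g B g.
have mU : measurable U by apply: bigsetU_measurable.
have BQ g : B g `<=` ucube.
  move=> x Bx i; have := Bcoord _ _ i Bx; rewrite !mxE /rho invfM ler_norml => /andP[].
  have gp : ((g i).+1%:R <= p%:R :> R)%R by rewrite ler_nat.
  have : (((g i).+1%:R) * p%:R^-1 <= 1 :> R)%R by rewrite ler_pdivrMr ?mul1r.
  have : (0 <= (g i)%:R * p%:R^-1 :> R)%R by rewrite divr_ge0.
  rewrite -natr1 !mulrDl mul1r; have : (0 < p%:R^-1 :> R)%R by rewrite invr_gt0.
  move: (p%:R^-1)%R => w; move: (_ * w)%R => z w0 h1 h2 h3 h4.
  by apply/andP; split; lra.
have UQ : U `<=` ucube.
  by move=> x; rewrite /U -bigcup_seq => -[g _]; exact: BQ.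
have thE : #|{: {ffun 'I_n -> 'I_p}}|%:R%:E * ((rho ^+ n)%:E * leb (@cball R n 1%R)) = th%:E.
  rewrite ffun_card muleA -(fineK bfin) -!EFinM /th; congr ((_ * _)%:E).
  by rewrite natrX -exprMn /rho invfM mulrCA divff ?mulr1// gt_eqF.
have lebU : leb U = th%:E.
  rewrite (@measure_bigsetU_disjoint _ _ _ _ _ ((rho ^+ n)%:E * leb (@cball R n 1%R)))//.
  move=> g g' gg'; apply/seteqP; split=> x // -[Bx B'x].
  have [i gi] : exists i, g i != g' i.
    apply/existsP; rewrite -negb_forall; apply: contra gg' => /forallP gg'.
    by apply/eqP/ffunP => i; apply/eqP.
  have := Bcoord _ _ i Bx; have := Bcoord _ _ i B'x; rewrite !mxE /rho invfM.
  have w0 : (0 < p%:R^-1 :> R)%R by rewrite invr_gt0.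
  have : (1 <= (g i)%:R - (g' i)%:R :> R)%R \/ (1 <= (g' i)%:R - (g i)%:R :> R)%R.
    rewrite -val_eqE neq_ltn in gi; case/orP: gi => lt; [right|left].
      by rewrite lerBrDr addrC natr1 ler_nat.
    by rewrite lerBrDr addrC natr1 ler_nat.
  move=> gd h1 h2.
  exact: (grid_gap w0 gd h2 h1).
have hausU : haus n U = haus n ucube * th%:E.
  have := @translation_invariant_leb _ _ (with_sigma_finite haus_sigma_finite) U ucube.
  rewrite /= /with_sigma_finite leb_opp// lebU leb_unit_box mule1 muleC => -> //.
  by move=> v C _; exact: haus_translate.
apply: (@le_trans _ _ (hausdorff_delta n d U + hausdorff_delta n d (ucube `\` U))).
  apply: le_trans (outer_measureU2 (@hausdorff_delta R n n d) U (ucube `\` U)).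
  by apply: le_outer_measure; rewrite setDUK.
rewrite EFinD; apply: leeD.
  rewrite -thE; apply: le_outer_bigsetU => g.
  have dB : diam_le (2 * rho)%R (B g).
    move=> x y Bx By.
    have := ler_enormD (x - grid_pt 2^-1 g)%R (grid_pt 2^-1 g - y)%R.
    rewrite addrA subrK => /le_trans; apply.
    by rewrite (enormC _ y) mulr2n mulrDl !mul1r; exact: lerD.
  apply: (@le_trans _ _ (hausdorff_cost n (B g))).
    apply: cover_measure_le1 => //; first exact: hausdorff_cost_ge0.
    apply/diameter_leP => x y Bx By; apply: le_trans (dB _ _ Bx By) _.
    apply: le_trans pd; rewrite /rho invfM.
    have : (0 < p%:R^-1 :> R)%R by rewrite invr_gt0.
    by move: (p%:R^-1)%R => w; lra.
  apply: le_trans (hausdorff_cost_le _ _ dB) _; first by rewrite mulr_ge0.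
  by rewrite muleC mulrAC divff ?mul1r.
apply: (@le_trans _ _ (haus n (ucube `\` U))); first exact: hausdorff_delta_le.
rewrite measureD//; last by rewrite ltey_eq hfin.
by rewrite /= setIidr// hausU -(fineK hfin) -EFinM -EFinB.
Qed.

Lemma haus_leb A : measurable A -> haus n A = leb A.
Proof.
move=> mA; apply/eqP; rewrite eq_le lebesgue_le_hausdorff andbT.
have := @translation_invariant_leb _ _ (with_sigma_finite haus_sigma_finite) A ucube.
rewrite /= /with_sigma_finite leb_opp// leb_unit_box mule1 => -> //; last exact: measurable_box.
  by rewrite -[leRHS]mule1; apply: lee_pmul; rewrite ?measure_ge0 ?haus_ucube_le1.
by move=> v C _; exact: haus_translate.
Qed.

End hausdorff_flat.

(** * The cone measure and central projection *)

Lemma measurable_inv (R : realType) : measurable_fun [set: R] (fun x : R => x^-1).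
Proof.
rewrite (_ : (fun x => _) = fun x : R => x * (x ^+ 2) `^ (-1)).
  apply: measurable_funM => //.
  by apply: (measurableT_comp (@measurable_powR R (-1))); exact: exprn_measurable.
apply/funext => x; rewrite powR_inv1 ?sqr_ge0//.
have [->|x0] := eqVneq x 0; first by rewrite invr0 mul0r.
by rewrite expr2 invfM mulrA divff ?mul1r.
Qed.

Section normalization.
Context {R : realType} {n : nat}.
Implicit Types z : 'rV[R]_n.

Definition nrm z : 'rV[R]_n := (enorm z)^-1 *: z.

Lemma nrmE z : z = enorm z *: nrm z.
Proof.
have [->|z0] := eqVneq z 0; first by rewrite enorm0 scale0r.
by rewrite /nrm scalerA divff ?scale1r// enorm_eq0.
Qed.

Lemma enorm_nrm z : z != 0 -> enorm (nrm z) = 1.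
Proof.
move=> z0; rewrite /nrm enormZ ger0_norm ?invr_ge0 ?enorm_ge0//.
by rewrite mulVf// enorm_eq0.
Qed.

Lemma nrmZ c z : 0 < c -> nrm (c *: z) = nrm z.
Proof.
move=> c0; rewrite /nrm enormZ gtr0_norm// invfM scalerA mulrAC.
by rewrite mulVf ?mul1r// gt_eqF.
Qed.

Lemma nrm_sphere z : enorm z = 1 -> nrm z = z.
Proof. by move=> z1; rewrite /nrm z1 invr1 scale1r. Qed.

Lemma measurable_nrm : measurable_fun setT nrm.
Proof.
apply: measurable_rV_Z => //.
by apply: (measurableT_comp (@measurable_inv R)); exact: measurable_enorm.
Qed.

(** The origin, which has no direction, is left out. *)
Definition pball : set 'rV[R]_n := [set z | 0 < enorm z <= 1].

Lemma measurable_pball : measurable pball.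
Proof.
rewrite (_ : pball = enorm @^-1` `]0, 1]%classic); last first.
  by apply/seteqP; split => z; rewrite /pball /= in_itv.
apply: measurable_preimage => //; exact: measurable_enorm.
Qed.

(** The volume of the cone over A with apex 0, which is 1/n times the surface measure of A. *)
Definition cone_measure : {measure set 'rV[R]_n -> \bar R} :=
  push_measure (mrestr leb measurable_pball) measurable_nrm.

Lemma cone_measureE A : cone_measure A = leb (nrm @^-1` A `&` pball).
Proof. by []. Qed.

End normalization.

Section gnomonic.
Context {R : realType} {k : nat}.
Implicit Types (y : 'rV[R]_k) (z : 'rV[R]_k.+1) (E : set 'rV[R]_k.+1) (rho : R).

(** Central (gnomonic) projection of the hyperplane of first coordinate 1 to the sphere.  Its inverse is
    slope. *)
Definition gno y : 'rV[R]_k.+1 := nrm (ins ord0 1 y).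
Definition slope z : 'rV[R]_k := (z 0 ord0)^-1 *: del ord0 z.

Let a y := enorm (ins ord0 1 y).

Let a_sqr y : a y ^+ 2 = 1 + enorm y ^+ 2.
Proof. by rewrite /a enorm_ins_sqr expr1n. Qed.

Let a_ge1 y : 1 <= a y.
Proof.
by rewrite -ler_sqr ?nnegrE ?enorm_ge0// a_sqr expr1n lerDl sqr_ge0.
Qed.

Lemma measurable_gno : measurable_fun setT gno.
Proof.
apply: (measurableT_comp measurable_nrm).
apply/measurable_fun_rVP => // j; have [i ->|->] := unliftP ord0 j.
  by under eq_fun do rewrite ins_lift; exact: measurable_coord.
under eq_fun do rewrite ins_same.
exact: measurable_cst.
Qed.

(** The law of cosines for vectors of lengths a y and a y' with directions gno y and gno y'. *)
Lemma gno_dist y y' : enorm (y - y') ^+ 2 =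
  (a y - a y') ^+ 2 + a y * a y' * enorm (gno y - gno y') ^+ 2.
Proof.
have u w : enorm (gno w) = 1.
  by rewrite enorm_nrm// -enorm_gt0; exact: lt_le_trans ltr01 (a_ge1 w).
have -> : enorm (y - y') ^+ 2 = enorm (a y *: gno y - a y' *: gno y') ^+ 2.
  by rewrite -!nrmE insB enorm_ins_sqr subrr expr0n add0r.
have h w : dotp (gno w) (gno w) = 1 by rewrite -enorm_sqr u expr1n.
rewrite !enorm_sqr; move: (gno y) (gno y') (h y) (h y') => p p' pp pp'.
by rewrite !dotpE pp pp' (dotpC p'); ring.
Qed.

Lemma gno_lip y y' : enorm (gno y - gno y') <= enorm (y - y').
Proof.
rewrite -ler_sqr ?nnegrE ?enorm_ge0// (gno_dist y y').
have a1 : 1 <= a y * a y' by rewrite -[leLHS]mulr1 ler_pM.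
have := ler_wpM2r (sqr_ge0 (enorm (gno y - gno y'))) a1.
have := sqr_ge0 (a y - a y'); lra.
Qed.

(** Near the point of contact y = 0 the lengths a y vary slowly, so that the radial part of the law of
    cosines is absorbed in the left-hand side. *)
Lemma gno_lip_inv rho y y' : 0 <= rho -> enorm y <= rho -> enorm y' <= rho ->
  (1 - rho ^+ 2) * enorm (y - y') ^+ 2 <= (1 + rho ^+ 2) * enorm (gno y - gno y') ^+ 2.
Proof.
move=> rho0 yr y'r.
have h1 : (a y - a y') ^+ 2 <= rho ^+ 2 * enorm (y - y') ^+ 2.
  rewrite -exprMn -[leLHS]real_normK ?num_real// lerXn2r ?nnegrE ?mulr_ge0 ?enorm_ge0//.
  have e : `|a y - a y'| * (a y + a y') = `|enorm y - enorm y'| * (enorm y + enorm y').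
    have e2 : (a y - a y') * (a y + a y') = (enorm y - enorm y') * (enorm y + enorm y').
      have := a_sqr y; have := a_sqr y'; lra.
    have := congr1 (fun x : R => `|x|) e2; rewrite !normrM.
    by rewrite (@ger0_norm _ (a y + a y')) ?(@ger0_norm _ (enorm y + enorm y')) ?addr_ge0 ?enorm_ge0.
  have := ler_enorm_dist y y'; have := enorm_ge0 y; have := enorm_ge0 y'.
  move: e (a_ge1 y) (a_ge1 y') (normr_ge0 (a y - a y')) (normr_ge0 (enorm y - enorm y')) yr y'r.
  move: (a y) (a y') (enorm y) (enorm y') (enorm (y - y')) => b b' c c' d.
  move: (`|_|) (`|_|) => m' m e b1 b1' m0 m0' cr cr' c0' c0 md.
  have : m * 2 <= m * (b + b') by rewrite ler_wpM2l//; lra.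
  have : m' * (c + c') <= d * (rho + rho) by rewrite ler_pM ?addr_ge0//; lra.
  lra.
have h2 : a y * a y' <= 1 + rho ^+ 2.
  have : enorm y ^+ 2 <= rho ^+ 2 by rewrite lerXn2r ?nnegrE ?enorm_ge0.
  have : enorm y' ^+ 2 <= rho ^+ 2 by rewrite lerXn2r ?nnegrE ?enorm_ge0.
  have := a_sqr y; have := a_sqr y'; have := sqr_ge0 (a y - a y'); rewrite sqrrB.
  lra.
have h3 := gno_dist y y'.
have := ler_wpM2r (sqr_ge0 (enorm (gno y - gno y'))) h2.
by rewrite mulrBl mul1r; lra.
Qed.

Lemma ins_slope z : z 0 ord0 != 0 -> ins ord0 1 (slope z) = (z 0 ord0)^-1 *: z.
Proof.
move=> z0; apply/rowP => j; have [i ->|->] := unliftP ord0 j.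
  by rewrite ins_lift !mxE.
by rewrite ins_same mxE mulVf.
Qed.

Lemma gno_slope z : 0 < z 0 ord0 -> gno (slope z) = nrm z.
Proof. by move=> z0; rewrite /gno ins_slope ?gt_eqF// nrmZ ?invr_gt0. Qed.

Lemma slope_gno y : slope (gno y) = y.
Proof.
rewrite /slope /gno /nrm mxE ins_same mulr1 invrK -/(a y).
apply/rowP => j; rewrite !mxE liftK /= mulrA divff ?mul1r// gt_eqF//.
exact: lt_le_trans (a_ge1 y).
Qed.

Lemma enorm_slope z : 0 < z 0 ord0 -> enorm z ^+ 2 = z 0 ord0 ^+ 2 * (1 + enorm (slope z) ^+ 2).
Proof.
move=> z0; have := enorm_ins_sqr ord0 (slope z) 1; rewrite ins_slope ?gt_eqF//.
rewrite enormZ exprMn expr1n => <-.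
by rewrite gtr0_norm ?invr_gt0// mulrA -exprMn divff ?gt_eqF// expr1n mul1r.
Qed.

(** The cone with apex 0 over the points of height h whose slope is in Y. *)
Definition wedge (Y : set 'rV[R]_k) (h : R) : set 'rV[R]_k.+1 :=
  [set z : 'rV[R]_k.+1 | 0 < z 0 ord0 <= h /\ Y (slope z)].

Lemma measurable_slope : measurable_fun setT (slope : 'rV[R]_k.+1 -> _).
Proof.
apply/measurable_fun_rVP => // j; under eq_fun do rewrite !mxE.
apply: measurable_funM; last exact: measurable_coord.
by apply: (measurableT_comp (@measurable_inv R)); exact: measurable_coord.
Qed.

Lemma measurable_wedge Y h : measurable Y -> measurable (wedge Y h).
Proof.
move=> mY.
have -> : wedge Y h = (fun z : 'rV[R]_k.+1 => z 0 ord0) @^-1` `]0, h]%classic `&` slope @^-1` Y.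
  by apply/seteqP; split => z /=; rewrite in_itv.
apply: measurableI.
  by apply: measurable_preimage => //; exact: measurable_coord.
exact: (measurable_preimage measurable_slope).
Qed.

Lemma integral_exprn01 : (\int[lebesgue_measure]_(t in `]0%R, 1%R]) (t ^+ k)%:E = (k.+1%:R^-1 : R)%:E)%E.
Proof.
rewrite integral_itv_obnd_cbnd; last first.
  by apply/measurable_EFinP; exact: exprn_measurable.
rewrite -(beta_fun1Sn k) -beta_fun_sym EFin_beta_fun /= [LHS]integral_mkcond.
apply: eq_integral => x _; rewrite !patchE; case: ifP => //.
by rewrite XMonemXn0.
Qed.

(** The slice at height t is t Y, and the integral of t^k over ]0, 1] is 1/(k+1). *)
Lemma leb_wedge1 Y : measurable Y -> leb (wedge Y 1) = ((k.+1%:R^-1)%:E * leb Y)%E.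
Proof.
move=> mY; have mW := measurable_wedge 1 mY.
rewrite (leb_ins ord0)// /pushforward /product_measure1 /=.
rewrite -integral_exprn01 muleC -ge0_integralZl//; last 2 first.
- by apply/measurable_EFinP; exact: exprn_measurable.
- by move=> t /=; rewrite in_itv /= => /andP[t0 _]; rewrite lee_fin exprn_ge0// ltW.
rewrite [RHS]integral_mkcond; apply: eq_integral => t _ /=.
rewrite patchE; case: ifPn => t01.
  rewrite inE /= in_itv /= in t01; case/andP: (t01) => t0 t1.
  rewrite muleC -(leb_scale (c := t^-1) _ mY) ?invr_gt0// muleA -EFinM.
  rewrite -exprMn divff ?gt_eqF// expr1n mul1e; congr leb.
  apply/seteqP; split => y; rewrite /xsection /= inE /= /wedge /= /slope ins_same del_ins.
    by case.
  by rewrite t01.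
rewrite (_ : xsection _ _ = set0) ?measure0//; apply/seteqP; split => y //.
rewrite /xsection /= inE /= /wedge /= ins_same => -[t01' _].
by move: t01; rewrite notin_setE /= in_itv /= t01'.
Qed.

Lemma leb_wedge Y h : 0 < h -> measurable Y ->
  leb (wedge Y h) = ((h ^+ k.+1 * k.+1%:R^-1)%:E * leb Y)%E.
Proof.
move=> h0 mY; rewrite EFinM -muleA -leb_wedge1//.
rewrite -(leb_scale h0); last exact: measurable_wedge.
congr (_ * leb _)%E; apply/seteqP; split => z; rewrite /wedge /slope /= mxE;
  rewrite pmulr_rgt0// ger_pMr// (_ : (_ *: _) = (z 0 ord0)^-1 *: del ord0 z)//;
  by apply/rowP => j; rewrite !mxE invfM mulrACA mulVf ?mul1r// gt_eqF.
Qed.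

End gnomonic.

Lemma haus_le_lipschitz (R : realType) n n' k (A : set 'rV[R]_n) (B : set 'rV[R]_n')
    (f : 'rV[R]_n -> 'rV[R]_n') (L : R) : 0 < L ->
  (forall x y, A x -> A y -> enorm (f x - f y) <= L * enorm (x - y)) ->
  B `<=` f @` A -> (haus k B <= (L ^+ k)%:E * haus k A)%E.
Proof.
move=> L0 hf BA; apply: le_trans (hausdorff_lipschitz k L0 hf).
exact: le_outer_measure.
Qed.

(** A piece E of the sphere near the first basis vector is compared with its projection Y to the tangent
    hyperplane: the cone over E lies between two wedges over Y, and the projection is almost
    isometric.  Both the Hausdorff measure of E and k+1 times its cone measure are thus close to
    the k-dimensional Lebesgue measure of Y. *)
Section sphere_patch.
Local Open Scope ereal_scope.
Context {R : realType} {k : nat}.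
Variables (E : set 'rV[R]_k.+1) (rho t : R).
Hypothesis mE : measurable E.
Hypothesis Es : E `<=` unit_sphere.
Hypothesis rho0 : (0 <= rho)%R.
Hypothesis Erho : forall z : 'rV[R]_k.+1, E z -> (0 < z 0 ord0)%R /\ (enorm (slope z) <= rho)%R.
Hypothesis t0 : (0 < t)%R.
Hypothesis rhot : (1 + rho ^+ 2 <= (1 + t) * (1 - rho ^+ 2))%R.

Let Y := gno @^-1` E.
Let mY : measurable Y. Proof. exact: measurable_preimage measurable_gno mE. Qed.

Let Y_rho y : Y y -> (enorm y <= rho)%R.
Proof. by move=> /Erho[_]; rewrite slope_gno. Qed.

Let E_Y z : E z -> Y (slope z) /\ gno (slope z) = z.
Proof.
move=> Ez; have [z0 _] := Erho Ez; have gz := gno_slope z0.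
by rewrite /Y /= gz nrm_sphere//; exact: (Es Ez).
Qed.

Lemma cone_measure_patch_le : k.+1%:R%:E * cone_measure E <= leb Y.
Proof.
have -> : leb Y = k.+1%:R%:E * leb (wedge Y 1).
  by rewrite leb_wedge1// muleA -EFinM divff ?mul1e// pnatr_eq0.
rewrite lee_pmul2l// cone_measureE; apply: le_outer_measure => z [/= Ez zb].
have [z0 _] := Erho Ez.
have {}z0 : (0 < z 0%R ord0)%R.
  by move: z0; rewrite mxE pmulr_rgt0// invr_gt0; case/andP: zb.
split; last by rewrite /Y /= gno_slope.
rewrite z0 /=; case/andP: zb => _; apply: le_trans.
by apply: le_trans (coord_le_enorm z ord0); exact: ler_norm.
Qed.

(** A wedge of height (1 + rho^2)^-1 over Y stays in the unit ball. *)
Lemma cone_measure_patch_ge :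
  leb Y <= ((1 + rho ^+ 2) ^+ k.+1)%:E * (k.+1%:R%:E * cone_measure E).
Proof.
have r1 : (0 < 1 + rho ^+ 2)%R by rewrite ltr_pwDl// sqr_ge0.
pose h := ((1 + rho ^+ 2)^-1)%R.
have h0 : (0 < h)%R by rewrite invr_gt0.
have -> : leb Y = ((1 + rho ^+ 2) ^+ k.+1)%:E * (k.+1%:R%:E * leb (wedge Y h)).
  rewrite leb_wedge// !muleA -!EFinM (_ : (_ * _)%R = 1%R) ?mul1e//.
  rewrite mulrACA divff ?pnatr_eq0// mulr1 -exprMn /h divff ?expr1n//.
  by rewrite gt_eqF.
rewrite !lee_pmul2l ?lte_fin ?exprn_gt0//.
rewrite cone_measureE; apply: le_outer_measure => z [/= /andP[z0 zh] Yz].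
have Ez : E (nrm z) by rewrite -gno_slope.
split => //; rewrite /pball /= enorm_gt0; apply/andP; split.
  by apply: contraTneq z0 => ->; rewrite mxE ltxx.
rewrite -ler_sqr ?nnegrE ?enorm_ge0// expr1n (enorm_slope z0).
apply: (@le_trans _ _ (h ^+ 2 * (1 + rho ^+ 2))%R).
  rewrite ler_pM ?sqr_ge0 ?addr_ge0 ?sqr_ge0//.
    by apply: lerXn2r; rewrite ?nnegrE ?(ltW z0) ?(ltW h0).
  by rewrite lerD2l lerXn2r ?nnegrE ?enorm_ge0// Y_rho.
rewrite /h expr2 -mulrA mulVf ?gt_eqF// mulr1 invf_le1//.
by rewrite lerDl sqr_ge0.
Qed.

(** Projection to the sphere does not increase distances, and Hausdorff and Lebesgue measure agree on
    the hyperplane. *)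
Lemma haus_patch_le : haus k E <= leb Y.
Proof.
rewrite -haus_leb//; have := @haus_le_lipschitz _ _ _ k Y E gno 1 ltr01.
rewrite expr1n mul1e; apply => [x y _ _|z Ez]; first by rewrite mul1r gno_lip.
by have [Yz gz] := E_Y Ez; exists (slope z).
Qed.

Let t1 : (0 < 1 + t)%R. Proof. by rewrite addr_gt0. Qed.

Lemma haus_patch_ge : leb Y <= ((1 + t) ^+ k)%:E * haus k E.
Proof.
rewrite -haus_leb//; apply: (@haus_le_lipschitz _ _ _ k E Y slope) => //.
  move=> x y /E_Y[Yx gx] /E_Y[Yy gy].
  have := gno_lip_inv rho0 (Y_rho Yx) (Y_rho Yy); rewrite gx gy => h.
  rewrite -ler_sqr ?nnegrE ?mulr_ge0 ?enorm_ge0 ?(ltW t1)// exprMn.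
  have r2 : (0 < 1 - rho ^+ 2)%R.
    rewrite -(pmulr_rgt0 _ t1); apply: lt_le_trans rhot.
    by rewrite ltr_pwDl// sqr_ge0.
  rewrite -(ler_pM2l r2); apply: le_trans h _.
  rewrite [leRHS]mulrA ler_wpM2r ?sqr_ge0//; apply: le_trans rhot _.
  rewrite mulrC; apply: ler_wpM2l; first exact: ltW.
  by rewrite expr2 ler_peMr ?(ltW t1)// lerDl ltW.
by move=> y Yy; exists (gno y); rewrite ?slope_gno.
Qed.

Lemma haus_cone_patch :
  haus k E <= ((1 + t) ^+ k.+1)%:E * (k.+1%:R%:E * cone_measure E) /\
  k.+1%:R%:E * cone_measure E <= ((1 + t) ^+ k.+1)%:E * haus k E.
Proof.
split.
  apply: le_trans haus_patch_le (le_trans cone_measure_patch_ge _).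
  apply: lee_pmul; rewrite ?lee_fin ?exprn_ge0 ?mule_ge0 ?addr_ge0 ?sqr_ge0 ?measure_ge0//.
  rewrite lerXn2r ?nnegrE ?addr_ge0 ?sqr_ge0 ?(ltW t0)//.
  apply: le_trans rhot _; rewrite ger_pMr//.
  by rewrite gerBl sqr_ge0.
apply: le_trans cone_measure_patch_le (le_trans haus_patch_ge _).
apply: lee_pmul; rewrite ?lee_fin ?exprn_ge0 ?measure_ge0 ?(ltW t1)//.
by apply: ler_weXn2l => //; rewrite lerDl ltW.
Qed.

End sphere_patch.

Lemma sqrtr_lt1 (R : realType) (x : R) : 0 <= x -> x < 1 -> Num.sqrt x < 1.
Proof.
move=> x0 x1; rewrite -ltr_sqr ?nnegrE ?sqrtr_ge0// sqr_sqrtr// expr1n//.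
Qed.

(** * Surface measure of the sphere and polar coordinates *)

Section rotation.
Context {R : realType} {n : nat}.
Implicit Types (E : set 'rV[R]_n) (v : 'rV[R]_n).

Lemma haus_householder k v E : haus k (householder v @^-1` E) = haus k E.
Proof.
have le F : (haus k (householder v @^-1` F) <= haus k F)%E.
  have := @haus_le_lipschitz R n n k F (householder v @^-1` F) (householder v) 1 ltr01.
  rewrite expr1n mul1e; apply=> [x y _ _|x Fx].
    by rewrite mul1r -householderN -householderD enorm_householder.
  by exists (householder v x) => //; rewrite householderK.
apply/eqP; rewrite eq_le le /=; apply: le_trans (le _).
by apply: le_outer_measure => x /=; rewrite householderK.
Qed.

Lemma nrm_householder v z : nrm (householder v z) = householder v (nrm z).
Proof. by rewrite /nrm enorm_householder householderZ. Qed.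

Lemma cone_measure_householder v E : measurable E ->
  cone_measure (householder v @^-1` E) = cone_measure E.
Proof.
move=> mE; rewrite !cone_measureE -[RHS](leb_householder v).
  congr leb; apply/seteqP; split => z; rewrite /pball /= enorm_householder nrm_householder//.
by apply: measurableI; [exact: measurable_preimage measurable_nrm mE|exact: measurable_pball].
Qed.

Lemma measurable_sphere : measurable (@unit_sphere R n).
Proof.
rewrite (_ : unit_sphere = enorm @^-1` [set 1])//.
by apply: measurable_preimage => //; exact: measurable_enorm.
Qed.

Lemma cone_measure_sphere E : cone_measure (E `&` unit_sphere) = cone_measure E.
Proof.
rewrite !cone_measureE; congr leb; apply/seteqP; split => z; rewrite /pball /=.
  by move=> [[]].
move=> [Ez /[dup] zb /andP[z0 _]]; do 2 split => //.
by rewrite /unit_sphere /= enorm_nrm// -enorm_gt0.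
Qed.

End rotation.

(** The constant rho is chosen such that 1 + rho^2 = (1 + t)(1 - rho^2).  A reflection moves a point of the
    piece to the first basis vector. *)
Lemma haus_cone_small (R : realType) k (t : R) : 0 < t ->
  exists2 eta : R, 0 < eta & forall E : set 'rV[R]_k.+1, measurable E -> E `<=` unit_sphere ->
    diam_le eta E ->
  (haus k E <= ((1 + t) ^+ k.+1)%:E * (k.+1%:R%:E * cone_measure E) /\
   k.+1%:R%:E * cone_measure E <= ((1 + t) ^+ k.+1)%:E * haus k E)%E.
Proof.
move=> t0; pose rho := Num.sqrt (t / (t + 2)).
have t2 : 0 < t + 2 by lra.
have r2 : rho ^+ 2 = t / (t + 2) by rewrite sqr_sqrtr// divr_ge0 ?ltW.
have rho1 : rho < 1 by apply: sqrtr_lt1; rewrite ?divr_ge0 ?ltW// ltr_pdivrMr// mul1r; lra.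
have rho0 : 0 < rho by rewrite sqrtr_gt0 divr_gt0.
exists (rho / 2); first by rewrite divr_gt0.
move=> E mE ES dE.
have [->|/set0P[p Ep]] := eqVneq E set0; first by rewrite !measure0 !mule0.
pose e : 'rV[R]_k.+1 := ins ord0 1 0.
have e1 : enorm e = 1.
  apply/eqP; rewrite -(@pexpr_eq1 _ _ 2) ?enorm_ge0//.
  by rewrite enorm_ins_sqr enorm0 expr1n expr0n addr0.
have p1 : enorm p = 1 by exact: ES.
pose Q := householder (p - e).
have Qp : Q p = e by apply: householder_swap; rewrite e1.
have Qe : Q e = p by rewrite -Qp /Q householderK.
have -> : haus k E = haus k (Q @^-1` E) by rewrite haus_householder.
have -> : cone_measure E = cone_measure (Q @^-1` E) by rewrite cone_measure_householder.
have del_le (z : 'rV[R]_k.+1) : enorm (del ord0 z) <= enorm z.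
  rewrite -ler_sqr ?nnegrE ?enorm_ge0// -[in leRHS](ins_del ord0 z) enorm_ins_sqr.
  by rewrite lerDr sqr_ge0.
apply: (haus_cone_patch (rho := rho)) => //.
- by apply: measurable_preimage => //; exact: measurable_householder.
- by move=> z /= /ES; rewrite /unit_sphere /= /Q enorm_householder.
- exact: ltW.
- move=> z Ez.
  have ze : enorm (z - e) <= rho / 2.
    rewrite -(enorm_householder (p - e)) householderD householderN -/(Q _) -/(Q _) Qe.
    exact: dE.
  have z0 : 1 - rho / 2 <= z 0 ord0.
    have := le_trans (coord_le_enorm (z - e) ord0) ze.
    by rewrite !mxE unlift_none /= ler_norml => /andP[? _]; lra.
  have z0' : 0 < z 0 ord0 by lra.
  split => //; rewrite /slope enormZ gtr0_norm ?invr_gt0//.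
  rewrite mulrC ler_pdivrMr//.
  have : enorm (del ord0 z) <= rho / 2.
    apply: le_trans ze; have := del_le (z - e); congr (enorm _ <= _).
    by apply/rowP => j; rewrite !mxE liftK /= mxE subr0.
  move/le_trans; apply; apply: (@le_trans _ _ (rho * (1 - rho / 2))); last by rewrite ler_pM2l.
  nra.
- by rewrite r2; apply/eqP/eqP; rewrite le_eqVlt; apply/orP; left; apply/eqP; field; lra.
Qed.

Section small_pieces.
Context {R : realType} {n : nat}.

Definition cell (h : R) (g : 'rV[int]_n) : set 'rV[R]_n :=
  box (\row_i (h * (g 0 i)%:~R), \row_i (h * ((g 0 i)%:~R + 1))).

Lemma cell_diam h g : 0 < h -> diam_le (h * Num.sqrt n%:R) (cell h g).
Proof.
move=> h0 x y xg yg; apply: enorm_le_coord; first exact: ltW.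
move=> i; have := xg i; have := yg i; rewrite !mxE !mulrDr mulr1 => /andP[? ?] /andP[? ?].
by rewrite ler_norml; apply/andP; split; lra.
Qed.

Lemma cell_cover h (x : 'rV[R]_n) : 0 < h -> exists g, cell h g x.
Proof.
move=> h0; exists (\row_i (Num.ceil (x 0 i / h) - 1)) => i; rewrite !mxE.
have := @ceil_itv R (x 0 i / h).
rewrite intrD /= => /andP[h1 h2].
by rewrite !(mulrC h) -ltr_pdivlMr// -ler_pdivrMr// subrK h1 h2.
Qed.

Lemma cell_inj h g g' x : 0 < h -> cell h g x -> cell h g' x -> g = g'.
Proof.
move=> h0 xg xg'; apply/rowP => i.
have := xg i; have := xg' i; rewrite !mxE => /andP[a1 a2] /andP[b1 b2].
have := lt_le_trans a1 b2; have := lt_le_trans b1 a2.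
have e (z : int) : z%:~R + 1 = (z + 1)%:~R :> R by rewrite intrD.
rewrite !ltr_pM2l// !e !ltr_int !ltzD1 => c1 c2.
by apply/eqP; rewrite eq_le c1 c2.
Qed.

(** Both measures are additive over the cells of a fine grid. *)
Lemma le_measure_small_pieces (mu nu : {measure set 'rV[R]_n -> \bar R}) (c eta : R) :
  0 <= c -> 0 < eta ->
  (forall E : set 'rV[R]_n, measurable E -> diam_le eta E -> (mu E <= c%:E * nu E)%E) ->
  forall A, measurable A -> (mu A <= c%:E * nu A)%E.
Proof.
move=> c0 eta0 hE A mA.
pose h := eta / (Num.sqrt n%:R + 1).
have s1 : 0 < Num.sqrt (n%:R : R) + 1 by rewrite ltr_wpDl ?sqrtr_ge0.
have h0 : 0 < h by rewrite divr_gt0.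
pose F j := A `&` oapp (cell h) set0 (pickle_inv j).
have mF j : measurable (F j).
  apply: measurableI => //; case: (pickle_inv j) => [g|] //=; exact: measurable_box.
have tF : trivIset setT F.
  apply/trivIsetP => i j _ _ ij; apply/seteqP; split => x //= -[[_ +] [_]].
  have := pickle_invK (T := 'rV[int]_n) i; have := pickle_invK (T := 'rV[int]_n) j.
  case: (pickle_inv i) => [g|] //=; case: (pickle_inv j) => [g'|] //= gj gi gx g'x.
  by move/eqP: ij; apply; rewrite -gi -gj (cell_inj h0 gx g'x).
have AF : A = \bigcup_j F j.
  apply/seteqP; split => [x Ax|x [j _ []//]].
  have [g gx] := cell_cover x h0; exists (pickle g) => //; split => //.
  by rewrite pickleK_inv.
have E (m : {measure set 'rV[R]_n -> \bar R}) : m A = (\sum_(j <oo) m (F j))%E.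
  rewrite {1}AF measure_bigcup//=; apply: eq_eseriesl => j.
  by rewrite mem_set.
rewrite (E mu) (E nu) -nneseriesZl//; apply: lee_nneseries => j _.
  by move=> _; exact: measure_ge0.
apply: hE => //.
move=> x y [_ xF] [_ yF].
case Ej : (pickle_inv j) xF yF => [g|] //= xg yg.
apply: le_trans (cell_diam h0 xg yg) _.
by rewrite /h mulrAC ler_pdivrMr// ler_wpM2l ?(ltW eta0)// lerDl.
Qed.

End small_pieces.

Lemma le_of_le_powM (R : realType) (n : nat) (x y : \bar R) : (0 <= y)%E ->
  (forall t : R, 0 < t -> (x <= ((1 + t) ^+ n)%:E * y)%E) -> (x <= y)%E.
Proof.
have pow t : 0 <= t <= 1 -> (1 + t) ^+ n <= 1 + (2 ^+ n - 1) * t :> R.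
  move=> /andP[t0 t1]; elim: n => [|m IHm]; first by rewrite !expr0; lra.
  have b1 : 1 <= 2 ^+ m :> R by rewrite exprn_ege1// ler1n.
  rewrite !exprS; move: IHm b1; move: ((1 + t) ^+ m) (2 ^+ m) => a b h b1.
  have := ler_wpM2l (ltac:(by rewrite addr_ge0) : 0 <= 1 + t) h.
  have : (b - 1) * (t * t) <= (b - 1) * t by rewrite ler_wpM2l ?subr_ge0// ler_piMl.
  nra.
case: y => [y| |]//; last by move=> _ _; rewrite leey.
rewrite lee_fin => y0 h; apply/lee_addgt0Pr => e e0.
have c0 : 0 < y * 2 ^+ n + 1 by rewrite ltr_wpDl// mulr_ge0// exprn_ge0.
pose t := Num.min 1 (e / (y * 2 ^+ n + 1)).
have t0 : 0 < t by rewrite lt_min ltr01 divr_gt0.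
apply: le_trans (h t t0) _; rewrite -EFinM -EFinD lee_fin.
apply: (@le_trans _ _ ((1 + (2 ^+ n - 1) * t) * y)).
  by rewrite ler_wpM2r// pow// (ltW t0) ge_min lexx.
have te : t * (y * 2 ^+ n + 1) <= e by rewrite -ler_pdivlMr// ge_min lexx orbT.
have : 0 <= t * y by rewrite mulr_ge0// ltW.
by move: te t0; move: (2 ^+ n) => b; nra.
Qed.

Section sphere_measure.
Local Open Scope ereal_scope.
Context {R : realType} {k : nat}.

(** Both inequalities hold up to a factor (1 + t)^(k+1) on small pieces, for every t > 0. *)
Lemma haus_sphere (A : set 'rV[R]_k.+1) : measurable A ->
  haus k (A `&` unit_sphere) = k.+1%:R%:E * cone_measure A.
Proof.
move=> mA; have mS := @measurable_sphere R k.+1.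
pose mu := mrestr (@haus R k.+1 k) mS.
have k0 : (0 <= k.+1%:R :> R)%R by [].
pose nu := mscale (NngNum k0) (@cone_measure R k.+1).
have p t : (0 < t)%R -> (0 <= (1 + t) ^+ k.+1 :> R)%R.
  by move=> t0; rewrite exprn_ge0// addr_ge0// ltW.
have pieces t (E : set 'rV[R]_k.+1) : (0 < t)%R -> measurable E ->
    mu E <= ((1 + t) ^+ k.+1)%:E * nu E /\ nu E <= ((1 + t) ^+ k.+1)%:E * mu E.
  move=> t0 mE; have [eta eta0 h] := @haus_cone_small R k t t0.
  have {}h F : measurable F -> diam_le eta F ->
      mu F <= ((1 + t) ^+ k.+1)%:E * nu F /\ nu F <= ((1 + t) ^+ k.+1)%:E * mu F.
    move=> mF dF; rewrite /mu /nu /mrestr /mscale /= -cone_measure_sphere.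
    apply: h; [exact: measurableI|by move=> x []|].
    by move=> x y [Fx _] [Fy _]; exact: dF.
  split; apply: (@le_measure_small_pieces R k.+1 _ _ _ eta) => //; try exact: p.
    by move=> F mF dF; have [] := h F mF dF.
  by move=> F mF dF; have [] := h F mF dF.
apply/eqP; rewrite eq_le; apply/andP; split.
  apply: (@le_of_le_powM R k.+1); first by rewrite mule_ge0.
  by move=> t t0; have [] := pieces t A t0 mA.
apply: (@le_of_le_powM R k.+1); first exact: measure_ge0.
by move=> t t0; have [] := pieces t A t0 mA.
Qed.

End sphere_measure.

Section restriction.
Local Open Scope ereal_scope.
Context d (T : measurableType d) (R : realType) (mu : {measure set T -> \bar R}) (D : set T)
  (mD : measurable D).

Lemma ge0_integral_mrestr (f : T -> \bar R) : (forall x, 0 <= f x) -> measurable_fun setT f ->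
  \int[mrestr mu mD]_x f x = \int[mu]_(x in D) f x.
Proof.
move=> f0 mf; have mDC := measurableC mD.
have mfD B : measurable_fun B f by exact: (measurable_funS measurableT).
transitivity (\int[mrestr mu mD]_(x in D) f x).
  rewrite [LHS](@ge0_negligible_integral _ _ _ _ setT (~` D))//.
    by rewrite setTD setCK.
  by rewrite /= /mrestr setICl measure0.
have -> : \int[mu]_(x in D) f x = \int[measure_add (mrestr mu mD) (mrestr mu mDC)]_(x in D) f x.
  apply: eq_measure_integral => A mA AD.
  transitivity (mrestr mu mD A + mrestr mu mDC A); last exact: esym (measure_addE _ _ _).
  rewrite /mrestr /= -measureU.
  - by rewrite -setIUr setUCr setIT.
  - exact: measurableI.
  - exact: measurableI.
  - by rewrite setIACA setICr setI0.
rewrite ge0_integral_measure_add// [X in _ = _ + X]null_set_integral ?adde0//.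
by rewrite /= /mrestr setICr measure0.
Qed.

End restriction.

Lemma sigma_finite_mrestr d (T : measurableType d) (R : realType)
    (mu : {measure set T -> \bar R}) (D : set T) (mD : measurable D) :
  sigma_finite setT mu -> sigma_finite setT (mrestr mu mD).
Proof.
move=> [F FT Foo]; exists F => // i; have [mF Fi] := Foo i; split => //.
rewrite /mrestr; apply: le_lt_trans Fi; apply: le_measure; rewrite ?inE//.
exact: measurableI.
Qed.

Lemma measurable_itvNyc (R : realType) :
  @measurable _ (measurableTypeR R) = <<s [set `]-oo, b]%classic | b in [set: R]] >>.
Proof.
apply/seteqP; split.
  rewrite [X in X `<=` _](RGenOInfty.measurableE R); apply: smallest_sub.
    exact: smallest_sigma_algebra.
  move=> _ [x ->]; rewrite -setCitvl -setTD; apply: sigma_algebraCD.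
  by apply: sub_sigma_algebra; exists x.
apply: smallest_sub; first exact: sigma_algebra_measurable.
by move=> _ [b _ <-]; exact: measurable_itv.
Qed.

Lemma outer_measureD_null (R : realType) (T : Type) (mu : {outer_measure set T -> \bar R})
    (A N : set T) : (mu N = 0 -> mu (A `\` N) = mu A)%E.
Proof.
move=> N0; apply/eqP; rewrite eq_le; apply/andP; split; first by apply: le_outer_measure => x [].
apply: (@le_trans _ _ (mu (A `\` N) + mu N)%E); last by rewrite N0 adde0.
apply: le_trans (outer_measureU2 mu _ _); apply: le_outer_measure => x Ax.
by have [Nx|Nx] := pselect (N x); [right|left].
Qed.

Section polar.
Local Open Scope ereal_scope.
Context {R : realType} {k : nat}.
Let N := k.+1.
Implicit Types (z : 'rV[R]_N).

Lemma cball0 : cball 0%R = [set 0%R : 'rV[R]_N].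
Proof.
apply/seteqP; split=> z; rewrite /cball /=; last by move=> ->; rewrite enorm0.
by rewrite le_eqVlt ltNge enorm_ge0 orbF enorm_eq0 => /eqP.
Qed.

Lemma leb_set1_0 : leb [set 0%R : 'rV[R]_N] = 0.
Proof. by rewrite -cball0 leb_cball// expr0n /= mul0e. Qed.

Definition root_radius (v : R) : R := v `^ N%:R^-1.

Lemma root_radius_gt0 v : (0 < v)%R -> (0 < root_radius v)%R.
Proof. by move=> v0; rewrite powR_gt0. Qed.

Lemma root_radiusK v : (0 < v)%R -> (root_radius v ^+ N)%R = v.
Proof.
move=> v0; rewrite -powR_mulrn ?powR_ge0// -powRrM mulVf ?pnatr_eq0//.
by rewrite powRr1// ltW.
Qed.

Lemma root_radiusX r : (0 <= r)%R -> root_radius (r ^+ N) = r.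
Proof.
move=> r0; rewrite /root_radius -powR_mulrn// -powRrM mulfV ?pnatr_eq0//.
by rewrite powRr1.
Qed.

(** The radial coordinate is |z|^N, so that the radial measure is Lebesgue measure on the half-line. *)
Definition polar_map z : measurableTypeR R * 'rV[R]_N := (enorm z ^+ N, nrm z)%R.

Lemma measurable_polar_map : measurable_fun setT polar_map.
Proof.
apply: measurable_fun_pair; last exact: measurable_nrm.
by apply: measurable_funX; exact: measurable_enorm.
Qed.

Lemma measurable_ray : measurable (`]0%R, +oo[%classic : set (measurableTypeR R)).
Proof. exact: measurable_itv. Qed.

Definition ray_measure := with_sigma_finite
  (sigma_finite_mrestr measurable_ray (@sigma_finiteT _ _ _ (@lebesgue_measure R))).

Lemma cone_measure_lty : cone_measure [set: 'rV[R]_N] < +oo.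
Proof.
rewrite cone_measureE; apply: le_lt_trans (@leb_cball_lty R N 1%R).
by apply: le_outer_measure => z [_ /andP[]].
Qed.

Lemma cone_measure_sigma_finite : sigma_finite setT (@cone_measure R N).
Proof.
exists (fun=> setT); first by rewrite bigcup_const.
by move=> _; split => //; exact: cone_measure_lty.
Qed.

Definition cone_measure_sf := with_sigma_finite cone_measure_sigma_finite.

(** Scaling by b^(1/N) maps the truncated unit cone over B to the one of radius b^(1/N). *)
Lemma leb_cone_radius (b : R) (B : set 'rV[R]_N) : (0 < b)%R -> measurable B ->
  leb [set z | (enorm z ^+ N <= b)%R /\ B (nrm z)] = b%:E * cone_measure B.
Proof.
move=> b0 mB; pose c := root_radius b; have c0 := root_radius_gt0 b0.
have cb := root_radiusK b0.
pose S := [set z | (enorm z ^+ N <= b)%R /\ B (nrm z)].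
have m0 : measurable [set 0%R : 'rV[R]_N] by rewrite -cball0; exact: measurable_cball.
have mS : measurable S.
  apply: measurableI; last exact: measurable_preimage measurable_nrm mB.
  rewrite -[X in measurable X]setTI.
  have mN : measurable_fun setT (fun z : 'rV[R]_N => (enorm z ^+ N)%R).
    by apply: measurable_funX; exact: measurable_enorm.
  exact: (mN measurableT _ (measurable_itv `]-oo, b])).
transitivity (leb (S `\` [set 0%R])).
  exact: esym (outer_measureD_null (mu := @lebesgue_outer R N) S leb_set1_0).
rewrite -(leb_scale c0); last exact: measurableD.
rewrite cb cone_measureE; congr (_ * leb _); apply/seteqP; split => z; rewrite /S /pball /=.
  rewrite nrmZ// enormZ (gtr0_norm c0) exprMn cb => -[[zb Bz] z0].
  split => //; rewrite enorm_gt0; apply/andP; split.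
    by apply/eqP => z0'; apply: z0; rewrite z0' scaler0.
  by move: zb; rewrite ger_pMr// -[leRHS](expr1n _ N) ler_pXn2r// nnegrE ?enorm_ge0.
move=> [Bz /andP[z0 z1]]; rewrite nrmZ// enormZ (gtr0_norm c0) exprMn cb; split.
  by split => //; rewrite ger_pMr// exprn_ile1 ?enorm_ge0.
move=> /eqP; rewrite scaler_eq0 gt_eqF//= => /eqP zE.
by rewrite zE enorm0 ltxx in z0.
Qed.

Lemma ray_measure_le (b : R) : ray_measure `]-oo, b]%classic = (Num.max b 0)%:E.
Proof.
rewrite /ray_measure /with_sigma_finite /= /mrestr.
have [b0|b0] := leP b 0%R.
  rewrite (_ : _ `&` _ = set0) ?measure0//; apply/seteqP; split => x //=.
  by rewrite !in_itv /= andbT => -[xb x0]; have := lt_le_trans x0 (le_trans xb b0); rewrite ltxx.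
rewrite (_ : _ `&` _ = `]0%R, b]%classic); last first.
  by apply/seteqP; split => x; rewrite /= !in_itv /= andbT; [case=> -> ->|case/andP=> -> ->].
by rewrite lebesgue_measure_itv /= lte_fin b0 -EFinB subr0.
Qed.

(** For fixed B both sides are measures in A; they agree on the half-lines bounded above. *)
Lemma leb_polar_rect (A : set (measurableTypeR R)) (B : set 'rV[R]_N) :
  measurable A -> measurable B ->
  leb (polar_map @^-1` (A `*` B)) = ray_measure A * cone_measure B.
Proof.
move=> mA mB.
have mD : measurable (nrm @^-1` B) := measurable_preimage measurable_nrm mB.
have mN : measurable_fun setT (fun z : 'rV[R]_N => (enorm z ^+ N)%R : measurableTypeR R).
  by apply: measurable_funX; exact: measurable_enorm.
pose m1 := push_measure (mrestr leb mD) mN.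
have Bfin : cone_measure B \is a fin_num.
  rewrite ge0_fin_numE ?measure_ge0//; apply: le_lt_trans cone_measure_lty.
  by apply: le_measure; rewrite ?inE.
have B0 : (0 <= fine (cone_measure B))%R by rewrite fine_ge0 ?measure_ge0.
pose m2 : {measure set (measurableTypeR R) -> \bar R} := mscale (NngNum B0) ray_measure.
have m1E b : m1 `]-oo, b]%classic = (Num.max b 0)%:E * cone_measure B.
  rewrite /m1 push_measureE /= /mrestr.
  rewrite (_ : _ `&` _ = [set z | (enorm z ^+ N <= b)%R /\ B (nrm z)]); last first.
    by apply/seteqP; split => z; rewrite /= in_itv.
  have [b0|b0] := leP b 0%R; last by rewrite leb_cone_radius.
  rewrite mul0e; apply/eqP; rewrite eq_le measure_ge0 andbT -leb_set1_0.
  apply: le_outer_measure => z [/= zb _].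
  have : (enorm z ^+ N == 0)%R by rewrite eq_le (le_trans zb b0)/= exprn_ge0 ?enorm_ge0.
  by rewrite expf_eq0 enorm_eq0 => /eqP.
have m2E X : m2 X = cone_measure B * ray_measure X.
  by rewrite -[LHS]/((fine _)%:E * ray_measure X) fineK.
suff : m1 A = m2 A by rewrite m2E muleC.
apply: (@measure_unique _ R (measurableTypeR R) [set `]-oo, b]%classic | b in [set: R]]
  (fun j => `]-oo, j%:R]%classic) _ _ _ _ m1 m2) => //.
- exact: measurable_itvNyc.
- move=> _ _ [a _ <-] [b _ <-]; exists (Num.min a b) => //.
  by apply/seteqP; split => x; rewrite /= !in_itv /= le_min; [case/andP=> -> ->|case=> -> ->].
- apply/seteqP; split => // x _; exists (Num.truncn x).+1 => //=.
  by rewrite in_itv /= ltW// truncnS_gt.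
- by move=> _ [b _ <-]; rewrite m1E m2E ray_measure_le muleC.
- by move=> j; rewrite m1E -(fineK Bfin) -EFinM ltry.
Qed.

Lemma leb_polar (X : set (measurableTypeR R * 'rV[R]_N)) : measurable X ->
  leb (polar_map @^-1` X) = (ray_measure \x cone_measure_sf) X.
Proof.
move=> mX.
have := @product_measure_unique _ _ _ _ _ ray_measure cone_measure_sf (push_measure leb measurable_polar_map).
by move=> -> // A B mA mB; exact: leb_polar_rect.
Qed.

Lemma integral_polar (g : 'rV[R]_N -> \bar R) : (forall z, 0 <= g z) ->
  measurable_fun setT g ->
  \int[leb]_z g z =
  \int[lebesgue_measure]_(v in `]0%R, +oo[) \int[cone_measure]_w g (root_radius v *: w)%R.
Proof.
move=> g0 mg.
pose G (p : measurableTypeR R * 'rV[R]_N) := g (root_radius p.1 *: p.2)%R.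
have mG : measurable_fun setT G.
  apply: (measurableT_comp mg); apply: measurable_rV_Z => //.
  by apply: (measurableT_comp (@measurable_powR R _)).
transitivity (\int[leb]_z (G \o polar_map) z).
  apply: eq_integral => z _; rewrite /G /polar_map /= root_radiusX ?enorm_ge0//.
  by rewrite -nrmE.
have := @ge0_integral_pushforward _ _ _ _ R _ measurable_polar_map (@leb R N) setT G measurableT mG.
rewrite preimage_setT => <-//.
rewrite (eq_measure_integral (ray_measure \x cone_measure_sf)); last first.
  by move=> mp X mX _; exact: leb_polar.
  exact: measurable_polar_map.
rewrite fubini_tonelli1//.
have mF : measurable_fun setT (fubini_F cone_measure_sf G).
  by apply: measurable_fun_fubini_tonelli_F => // p; exact: g0.
transitivity (\int[mrestr lebesgue_measure measurable_ray]_v fubini_F cone_measure_sf G v) => //.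
  rewrite ge0_integral_mrestr// => v; apply: integral_ge0 => w _; exact: g0.
- by move=> p; exact: g0.
- by move=> p _; exact: g0.
Qed.

Lemma integral_sphere (f : 'rV[R]_N -> \bar R) : (forall z, 0 <= f z) -> measurable_fun setT f ->
  \int[hausdorff R N k]_(w in unit_sphere) f w = N%:R%:E * \int[cone_measure]_w f w.
Proof.
move=> f0 mf.
have mid : measurable_fun setT (id : hausdorff_type R N k -> 'rV[R]_N).
  by move=> _ A mA; rewrite setTI; exact: hausdorff_outer_borel.
have mS := @measurable_sphere R N.
have := @ge0_integral_pushforward _ _ _ _ R _ mid (hausdorff R N k) unit_sphere f mS (measurable_funS measurableT (@subsetT _ _) mf).
rewrite preimage_id /= => <-; last by move=> y _; exact: f0.
transitivity (\int[mrestr (@haus R N k) mS]_w f w); first by rewrite ge0_integral_mrestr.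
have k0 : (0 <= N%:R :> R)%R by [].
rewrite (eq_measure_integral (mscale (NngNum k0) (@cone_measure R N))); last first.
  by move=> A mA _; rewrite -[LHS]/(haus k (A `&` unit_sphere)) haus_sphere.
by rewrite ge0_integral_mscale.
Qed.

End polar.

(** * Truncation and logarithmic integrals *)

Section calculus.
Context {R : realType}.

(** The length of the part of ]s0, s1] below w, see lebesgue_clip. *)
Definition clip (s0 s1 w : R) : R := Num.max 0 (Num.min w s1 - s0).

Lemma clip_ge0 s0 s1 w : 0 <= clip s0 s1 w.
Proof. by rewrite le_max lexx. Qed.

Lemma clip_le s0 s1 w : 0 <= s0 -> 0 <= w -> clip s0 s1 w <= w.
Proof.
move=> h0 w0; rewrite ge_max w0/= lerBlDr; apply: (@le_trans _ _ w); last by rewrite lerDl.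
by rewrite ge_min lexx.
Qed.

Lemma clip_le_top s0 s1 w : 0 <= s0 -> 0 <= s1 -> clip s0 s1 w <= s1.
Proof.
move=> h0 w0; rewrite ge_max w0/= lerBlDr; apply: (@le_trans _ _ s1); last by rewrite lerDl.
by rewrite ge_min lexx orbT.
Qed.

Lemma clip_eq0 s0 s1 w : w <= s0 -> clip s0 s1 w = 0.
Proof. by move=> h; apply/max_idPl; rewrite subr_le0 ge_min h. Qed.

Lemma le_clip s0 s1 w : w <= s1 -> w <= clip s0 s1 w + s0.
Proof. by move=> /min_idPl h; rewrite /clip h -lerBlDr le_max lexx orbT. Qed.

Lemma measurable_clip s0 s1 : measurable_fun setT (clip s0 s1).
Proof.
apply: measurable_maxr => //; apply: measurable_funB => //; exact: measurable_minr.
Qed.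

Lemma lebesgue_clip s0 s1 w :
  lebesgue_measure (`]s0, s1] `&` [set s | s < w] : set (measurableTypeR R)) =
  (clip s0 s1 w)%:E.
Proof.
have [ws|ws] := leP w s1; rewrite /clip.
  rewrite (_ : _ `&` _ = `]s0, w[%classic); last first.
    apply/seteqP; split => x; rewrite /= !in_itv /=; first by case=> /andP[-> _] ->.
    by move=> /andP[-> xw]; rewrite (le_trans (ltW xw) ws).
  rewrite lebesgue_measure_itv /= lte_fin (min_idPl ws); case: ltP => h.
    by rewrite -EFinB (max_idPr _)// subr_ge0 ltW.
  by rewrite (max_idPl _)// subr_le0.
rewrite (_ : _ `&` _ = `]s0, s1]%classic); last first.
  apply/seteqP; split => x; rewrite /= !in_itv /=; first by case=> /andP[-> ->].
  by move=> /andP[-> xs]; rewrite xs (le_lt_trans xs ws).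
rewrite lebesgue_measure_itv /= lte_fin (min_idPr (ltW ws)); case: ltP => h.
  by rewrite -EFinB (max_idPr _)// subr_ge0 ltW.
by rewrite (max_idPl _)// subr_le0.
Qed.

Lemma integral_itv_cst (c a b : R) : a < b ->
  (\int[lebesgue_measure]_(v in `]a, b]) cst c%:E v = (c * (b - a))%:E)%E.
Proof. by move=> ab; rewrite integral_cst//= lebesgue_measure_itv /= lte_fin ab -EFinB -EFinM. Qed.

Lemma integral_reciprocal (c a b : R) : 0 < a -> a < b ->
  (\int[lebesgue_measure]_(v in `]a, b]) (c / v)%:E = (c * (ln b - ln a))%:E)%E.
Proof.
move=> a0 ab.
have mf : measurable_fun [set: R] (fun v : R => c / v).
  by apply: measurable_funM => //; exact: measurable_inv.
rewrite integral_itv_obnd_cbnd; last first.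
  by apply/measurable_EFinP; exact: measurable_funS mf.
have dl (x : R) : 0 < x -> is_derive x 1 (fun v : R => c * ln v : R) (c / x).
  move=> x0; have := is_derive1_ln x0 => h.
  by apply: is_derive_eq.
rewrite (@continuous_FTC2 _ _ (fun v : R => c * ln v : R))//.
- by rewrite -EFinB mulrBr.
- apply: continuous_in_subspaceT => x; rewrite inE /= in_itv /= => /andP[ax _].
  apply: continuousM; first exact: cst_continuous.
  apply: inv_continuous; rewrite gt_eqF//; exact: lt_le_trans ax.
- split.
  + move=> x; rewrite in_itv /= => /andP[ax _].
    by have [] := dl x (lt_trans a0 ax).
  + apply: cvg_at_right_filter; apply: cvgM; first exact: cvg_cst.
    exact: continuous_ln.
  + apply: cvg_at_left_filter; apply: cvgM; first exact: cvg_cst.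
    by apply: continuous_ln; exact: lt_trans ab.
- move=> x; rewrite in_itv /= => /andP[ax _].
  by rewrite derive1E; have [] := dl x (lt_trans a0 ax).
Qed.

Lemma le_of_asymptotic (al be c d x0 : R) :
  (forall x, x0 <= x -> al * x + c <= be * x + d) -> al <= be.
Proof.
move=> h; rewrite leNgt; apply/negP => ba.
have ab0 : 0 < al - be by rewrite subr_gt0.
pose x := Num.max x0 ((d - c + 1) / (al - be)).
have := h x (ltac:(by rewrite le_max lexx)).
have : (d - c + 1) <= x * (al - be) by rewrite -ler_pdivrMr// le_max lexx orbT.
nra.
Qed.

End calculus.

(** * Spherical means against measures of superlevel sets *)

Lemma sigma_finite_product d1 d2 (T1 : measurableType d1) (T2 : measurableType d2) (R : realType)
    (m1 : {sigma_finite_measure set T1 -> \bar R})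
    (m2 : {sigma_finite_measure set T2 -> \bar R}) :
  sigma_finite setT (m1 \x m2)%E.
Proof.
have [F1 F1T F1oo] := @sigma_finiteT _ _ _ m1.
have [F2 F2T F2oo] := @sigma_finiteT _ _ _ m2.
pose G j := let p := odflt (0, 0)%N (unpickle j) in F1 p.1 `*` F2 p.2.
exists G.
  apply/seteqP; split => // -[x y] _.
  have : setT x by []. have : setT y by [].
  rewrite F1T F2T => -[j _ Fy] [i _ Fx]; exists (pickle (i, j)) => //.
  by rewrite /G pickleK.
move=> j; rewrite /G; move: (odflt _ _) => [a b] /=.
have [ma fa] := F1oo a; have [mb fb] := F2oo b; split; first exact: measurableX.
have -> : (m1 \x m2)%E (F1 a `*` F2 b) = (m1 (F1 a) * m2 (F2 b))%E := product_measure1E m1 m2 ma mb.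
by rewrite lte_mul_pinfty// ge0_fin_numE.
Qed.

(** In this part F(x, y) stands for |u(x) - u(y)|^q restricted to pairs of points of E.  Functions of a pair
    of points become functions of the pair (x, z) with z = y - x. *)
Section slicing.
Local Open Scope ereal_scope.
Context {R : realType} {k : nat}.
Let N := k.+1.
Variables (F : 'rV[R]_N * 'rV[R]_N -> R) (E : set 'rV[R]_N) (M r : R).
Hypotheses (mF : measurable_fun setT F) (F0 : forall p, (0 <= F p)%R)
  (FM : forall p, (F p <= M)%R) (FE : forall p, ~ E p.1 -> F p = 0%R)
  (mE : measurable E) (Eoo : leb E < +oo) (r0 : (0 <= r)%R).

Let N0 : (0 < N%:R :> R)%R. Proof. by []. Qed.
Let rN0 : (0 < r + N%:R)%R. Proof. by rewrite ltr_wpDl. Qed.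

Definition radial_weight (z : 'rV[R]_N) : R := ((enorm z `^ (r + N%:R))^-1)%R.
Definition quotient (p : 'rV[R]_N * 'rV[R]_N) : R := (F (p.1, p.1 + p.2) * radial_weight p.2)%R.
Definition shift_mean (z : 'rV[R]_N) : \bar R := \int[leb]_x (F (x, x + z)%R)%:E.
Definition sphere_mean (t : R) : \bar R :=
  N%:R%:E * \int[cone_measure]_w (((t `^ r)^-1)%:E * shift_mean (t *: w)%R).
Definition level (s : R) : \bar R := (@leb R N \x @leb R N) [set p | (s < quotient p)%R].
Definition clipped (s0 s1 : R) (z : 'rV[R]_N) : \bar R :=
  \int[leb]_x (clip s0 s1 (quotient (x, z)))%:E.

Lemma radial_weight_ge0 z : (0 <= radial_weight z)%R.
Proof. by rewrite invr_ge0 powR_ge0. Qed.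

Lemma measurable_radial_weight : measurable_fun setT radial_weight.
Proof.
apply: (measurableT_comp (@measurable_inv R)).
apply: (measurableT_comp (@measurable_powR R _)); exact: measurable_enorm.
Qed.

Lemma quotient_ge0 p : (0 <= quotient p)%R.
Proof. by rewrite mulr_ge0// radial_weight_ge0. Qed.

Let shear (p : 'rV[R]_N * 'rV[R]_N) := (p.1, p.1 + p.2)%R.

Let measurable_shear : measurable_fun setT shear.
Proof. by apply: measurable_fun_pair => //; exact: measurable_rV_D. Qed.

Let measurable_F_shear : measurable_fun setT (fun p => F (shear p)).
Proof. exact: measurableT_comp mF measurable_shear. Qed.

Lemma measurable_quotient : measurable_fun setT quotient.
Proof.
apply: measurable_funM; first exact: measurable_F_shear.
exact: (measurableT_comp measurable_radial_weight).
Qed.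

Lemma measurable_shift_mean : measurable_fun setT shift_mean.
Proof.
apply: (@measurable_fun_fubini_tonelli_G _ _ _ _ R (@leb R N) (fun p => (F (shear p))%:E)).
  exact/measurable_EFinP.
by move=> p; rewrite lee_fin.
Qed.

Lemma shift_mean_ge0 z : 0 <= shift_mean z.
Proof. by apply: integral_ge0 => x _; rewrite lee_fin. Qed.

Let measurable_clip_quotient s0 s1 :
  measurable_fun setT (fun p : 'rV[R]_N * 'rV[R]_N => (clip s0 s1 (quotient p))%:E).
Proof.
apply/measurable_EFinP; apply: measurableT_comp measurable_quotient; exact: measurable_clip.
Qed.

Lemma measurable_clipped s0 s1 : measurable_fun setT (clipped s0 s1).
Proof.
apply: (@measurable_fun_fubini_tonelli_G _ _ _ _ R (@leb R N)
  (fun p => (clip s0 s1 (quotient p))%:E)) => // p.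
by rewrite lee_fin clip_ge0.
Qed.

Lemma clipped_ge0 s0 s1 z : 0 <= clipped s0 s1 z.
Proof. by apply: integral_ge0 => x _; rewrite lee_fin clip_ge0. Qed.

(** Fubini on the set of the (s, (x, z)) with s < quotient (x, z). *)
Lemma layer_cake s0 s1 :
  \int[lebesgue_measure]_(s in `]s0, s1]) level s = \int[leb]_z clipped s0 s1 z.
Proof.
have mI : measurable (`]s0, s1]%classic : set (measurableTypeR R)) by exact: measurable_itv.
pose m1 := with_sigma_finite
  (sigma_finite_mrestr mI (@sigma_finiteT _ _ _ (@lebesgue_measure R))).
pose C := [set sp : measurableTypeR R * ('rV[R]_N * 'rV[R]_N) | (sp.1 < quotient sp.2)%R].
have mC : measurable C.
  have m2 : measurable_fun setT (fun sp : measurableTypeR R * ('rV[R]_N * 'rV[R]_N) =>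
      quotient sp.2) by exact: (measurableT_comp measurable_quotient).
  rewrite -[X in measurable X]setTI; apply: measurable_fun_ltr => //.
have CE s : xsection C s = [set p | (s < quotient p)%R].
  by apply/seteqP; split => p; rewrite /xsection /= inE.
pose m2 := with_sigma_finite (sigma_finite_product (@leb R N) (@leb R N)).
transitivity (\int[m1]_s m2 (xsection C s)).
  under [RHS]eq_integral do rewrite CE.
  rewrite /m1 /with_sigma_finite ge0_integral_mrestr//.
  under eq_fun do rewrite -CE.
  exact: (measurable_fun_xsection m2 mC).
rewrite fubini_sets//.
transitivity (\int[@leb R N \x @leb R N]_p (clip s0 s1 (quotient p))%:E).
  apply: eq_integral => p _; rewrite /m1 /with_sigma_finite /mrestr -lebesgue_clip setIC.
  by congr (lebesgue_measure (_ `&` _)); apply/seteqP; split => s; rewrite /ysection /= inE.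
by rewrite fubini_tonelli2// => p; rewrite lee_fin clip_ge0.
Qed.

Let mx (f : 'rV[R]_N * 'rV[R]_N -> R) z : measurable_fun setT f ->
  measurable_fun setT (fun x => (f (x, z))%:E).
Proof.
by move=> mf; apply/measurable_EFinP; apply: (measurableT_comp mf); exact: measurable_fun_pair.
Qed.

Lemma integral_quotient z : \int[leb]_x (quotient (x, z))%:E = (radial_weight z)%:E * shift_mean z.
Proof.
rewrite -ge0_integralZl//.
- by apply: eq_integral => x _; rewrite /quotient /= EFinM muleC.
- exact: (mx _ measurable_F_shear).
- by move=> x _; rewrite lee_fin.
- by rewrite lee_fin radial_weight_ge0.
Qed.

Lemma clipped_le s0 s1 z : (0 <= s0)%R -> clipped s0 s1 z <= (radial_weight z)%:E * shift_mean z.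
Proof.
move=> h0; rewrite -integral_quotient; apply: ge0_le_integral => //.
- by move=> x _; rewrite lee_fin clip_ge0.
- exact: (mx _ (measurableT_comp (measurable_clip s0 s1) measurable_quotient)).
- exact: mx measurable_quotient.
- by move=> x _; rewrite lee_fin clip_le// quotient_ge0.
Qed.

Lemma clipped_le_top s0 s1 z : (0 <= s0)%R -> (0 <= s1)%R -> clipped s0 s1 z <= s1%:E * leb E.
Proof.
move=> h0 h1; rewrite -integral_indicM//; apply: ge0_le_integral => //.
- by move=> x _; rewrite lee_fin clip_ge0.
- exact: (mx _ (measurableT_comp (measurable_clip s0 s1) measurable_quotient)).
- by apply/measurable_EFinP; apply: measurable_funM => //; exact: measurable_indic.
- move=> x _; rewrite -EFinM lee_fin indicE; case: (boolP (x \in E)) => xE.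
    by rewrite mulr1 clip_le_top.
  rewrite mulr0 clip_eq0// /quotient FE ?mul0r//=.
  by move=> Ex; rewrite mem_set in xE.
Qed.

(** Truncation at s0 removes the increments z for which even the bound M gives a quotient below s0. *)
Lemma clipped_eq0 s0 s1 z : (M * radial_weight z <= s0)%R -> clipped s0 s1 z = 0.
Proof.
move=> h; rewrite /clipped integral0_eq// => x _; rewrite clip_eq0//.
by apply: le_trans h; rewrite ler_wpM2r// radial_weight_ge0.
Qed.

(** Where the quotient cannot exceed s1, truncation loses at most s0, and this only for x in E. *)
Lemma le_clipped s0 s1 z : (0 <= s0)%R -> (M * radial_weight z <= s1)%R ->
  (radial_weight z)%:E * shift_mean z <= clipped s0 s1 z + s0%:E * leb E.
Proof.
move=> h0 h; rewrite -integral_quotient -integral_indicM//.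
have mi : measurable_fun setT (fun x => s0%:E * (\1_E x : R)%:E).
  by apply/measurable_EFinP; apply: measurable_funM => //; exact: measurable_indic.
have mc := mx z (measurableT_comp (measurable_clip s0 s1) measurable_quotient).
have c0 (x : 'rV[R]_N) : 0 <= s0%:E * (\1_E x : R)%:E by rewrite mule_ge0// lee_fin.
rewrite /clipped -ge0_integralD//; last by move=> x _; rewrite lee_fin clip_ge0.
apply: ge0_le_integral => //.
- by move=> x _; rewrite lee_fin quotient_ge0.
- exact: mx measurable_quotient.
- exact: emeasurable_funD.
- move=> x _; rewrite -EFinM -EFinD lee_fin indicE; case: (boolP (x \in E)) => xE.
    by rewrite mulr1 le_clip//; apply: le_trans h; rewrite ler_wpM2r// radial_weight_ge0.
  rewrite mulr0 addr0 {1}/quotient FE ?mul0r ?clip_ge0//=.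
  by move=> Ex; rewrite mem_set in xE.
Qed.

Lemma integral_cone_sphere (f : 'rV[R]_N -> \bar R) : (forall w, 0 <= f w) ->
  measurable_fun setT f ->
  \int[cone_measure]_w f w = \int[cone_measure]_(w in unit_sphere) f w.
Proof.
move=> f0 mf; have mS := @measurable_sphere R N.
rewrite (@ge0_negligible_integral _ _ _ _ _ (~` unit_sphere))//.
- by rewrite setTD setCK.
- exact: measurableC.
- by rewrite -cone_measure_sphere setICl measure0.
Qed.

Lemma measurable_ray_map (f : 'rV[R]_N -> \bar R) (t : R) : measurable_fun setT f ->
  measurable_fun setT (fun w : 'rV[R]_N => f (t *: w)%R).
Proof. by move=> mf; apply: (measurableT_comp mf); exact: measurable_scale. Qed.

(** On the sphere of radius t the weight is the constant t^-(r+N), of which the spherical mean takes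
    t^-r. *)
Lemma cone_radial_weight (t : R) : (0 < t)%R ->
  \int[cone_measure]_w ((radial_weight (t *: w)%R)%:E * shift_mean (t *: w)%R) =
  ((N%:R * t ^+ N)^-1)%:E * sphere_mean t.
Proof.
move=> t0; have mS := @measurable_sphere R N.
have c0 : (0 <= (t `^ r)^-1)%R by rewrite invr_ge0 powR_ge0.
have ms := measurable_ray_map t measurable_shift_mean.
rewrite /sphere_mean muleA -EFinM invfM mulrAC mulVf ?mul1r ?gt_eqF//.
rewrite integral_cone_sphere; last 2 first.
- by move=> w; rewrite mule_ge0 ?shift_mean_ge0// lee_fin radial_weight_ge0.
- apply: emeasurable_funM => //; apply/measurable_EFinP.
  by apply: (measurableT_comp measurable_radial_weight); exact: measurable_scale.
rewrite [in RHS]integral_cone_sphere; last 2 first.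
- by move=> w; rewrite mule_ge0 ?shift_mean_ge0.
- exact: emeasurable_funM.
rewrite -ge0_integralZl//; last 3 first.
- by apply: emeasurable_funM => //; exact: measurable_funS ms.
- by move=> w _; rewrite mule_ge0 ?shift_mean_ge0.
- by rewrite lee_fin invr_ge0 exprn_ge0// ltW.
apply: eq_integral => w; rewrite inE => w1.
rewrite muleA -EFinM; congr (_%:E * _).
rewrite /radial_weight enormZ w1 mulr1 gtr0_norm// -powR_mulrn ?ltW//.
by rewrite -invfM addrC powRD// (gt_eqF t0) implybT.
Qed.

Lemma measurable_level : measurable_fun setT (level : measurableTypeR R -> \bar R).
Proof.
pose C := [set sp : measurableTypeR R * ('rV[R]_N * 'rV[R]_N) | (sp.1 < quotient sp.2)%R].
have mC : measurable C.
  have m2 : measurable_fun setT (fun sp : measurableTypeR R * ('rV[R]_N * 'rV[R]_N) =>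
      quotient sp.2) by exact: (measurableT_comp measurable_quotient).
  by rewrite -[X in measurable X]setTI; apply: measurable_fun_ltr.
have -> : level = fun s => (@leb R N \x @leb R N) (xsection C s).
  by apply/funext => s; congr product_measure1; apply/seteqP; split => p; rewrite /xsection /= inE.
exact: (measurable_fun_xsection (with_sigma_finite (sigma_finite_product (@leb R N) (@leb R N))) mC).
Qed.

(** The integral over the sphere with |z|^N = v, see integral_polar. *)
Definition shell (f : 'rV[R]_N -> \bar R) (v : measurableTypeR R) : \bar R :=
  \int[cone_measure]_w f (@root_radius R k v *: w)%R.

Lemma measurable_shell f : (forall z, 0 <= f z) -> measurable_fun setT f ->
  measurable_fun setT (shell f).
Proof.
move=> f0 mf.
apply: (@measurable_fun_fubini_tonelli_F _ _ _ _ R (@cone_measure_sf R k)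
  (fun p : measurableTypeR R * 'rV[R]_N => f (@root_radius R k p.1 *: p.2)%R)) => [|p]; last exact: f0.
apply: (measurableT_comp mf); apply: measurable_rV_Z => //.
by apply: (measurableT_comp (@measurable_powR R _)).
Qed.

Lemma shell_ge0 f v : (forall z, 0 <= f z) -> 0 <= shell f v.
Proof. by move=> f0; apply: integral_ge0 => w _; exact: f0. Qed.

Lemma le_shell f g v : (forall z, 0 <= f z) -> measurable_fun setT f ->
  (forall z, 0 <= g z) -> measurable_fun setT g -> (0 < v)%R ->
  (forall z, enorm z = @root_radius R k v -> f z <= g z) -> shell f v <= shell g v.
Proof.
move=> f0 mf g0 mg v0 fg; have t0 := @root_radius_gt0 R k v v0.
rewrite /shell !integral_cone_sphere//; try by [exact: measurable_ray_map|move=> w; exact: f0|move=> w; exact: g0].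
apply: ge0_le_integral => //.
- exact: measurable_sphere.
- exact: measurable_funS (measurable_ray_map _ mf).
- exact: measurable_funS (measurable_ray_map _ mg).
- by move=> w w1; apply: fg; rewrite enormZ w1 mulr1 gtr0_norm.
Qed.

Lemma shell_cst c v : shell (cst c) v = c * cone_measure [set: 'rV[R]_N].
Proof. by rewrite /shell integral_cst. Qed.

Lemma shell_addcst f c v : (forall z, 0 <= f z) -> measurable_fun setT f -> 0 <= c ->
  shell (fun z => f z + c) v = shell f v + c * cone_measure [set: 'rV[R]_N].
Proof.
move=> f0 mf c0.
rewrite -(shell_cst c v) -[RHS](@ge0_integralD _ _ _ cone_measure setT _
  (fun w => f (root_radius v *: w)%R) (cst c))//.
exact: measurable_ray_map.
Qed.

Let weighted z := (radial_weight z)%:E * shift_mean z.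

Let weighted_ge0 z : 0 <= weighted z.
Proof. by rewrite mule_ge0 ?shift_mean_ge0// lee_fin radial_weight_ge0. Qed.

Let measurable_weighted : measurable_fun setT weighted.
Proof.
apply: emeasurable_funM; last exact: measurable_shift_mean.
by apply/measurable_EFinP; exact: measurable_radial_weight.
Qed.

Lemma shell_weighted v : (0 < v)%R ->
  shell weighted v = ((N%:R * v)^-1)%:E * sphere_mean (@root_radius R k v).
Proof. by move=> v0; rewrite /shell cone_radial_weight ?root_radius_gt0// root_radiusK. Qed.

Let cone_fin : cone_measure [set: 'rV[R]_N] \is a fin_num.
Proof. by rewrite ge0_fin_numE// cone_measure_lty. Qed.

Let leb_fin : leb E \is a fin_num.
Proof. by rewrite ge0_fin_numE. Qed.

Let M_ge0 : (0 <= M)%R. Proof. exact: le_trans (F0 (0, 0)%R) (FM _). Qed.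

Lemma radial_weight_le (t : R) z : (0 < t)%R -> (t <= enorm z)%R ->
  (M * radial_weight z <= M / t `^ (r + N%:R))%R.
Proof.
move=> t0 tz; rewrite ler_wpM2l// lef_pV2 ?posrE ?powR_gt0//; last exact: lt_le_trans tz.
by rewrite ge0_ler_powR ?nnegrE ?enorm_ge0// ltW.
Qed.

Lemma le_root_radius t v : (0 <= t)%R -> (t ^+ N < v)%R -> (t <= @root_radius R k v)%R.
Proof.
move=> t0 tv; rewrite -(@root_radiusX R k _ t0) ge0_ler_powR ?nnegrE ?invr_ge0 ?exprn_ge0//.
  by apply: ltW; apply: le_lt_trans tv; rewrite exprn_ge0.
exact: ltW.
Qed.

Lemma sphere_mean_ge0 t : 0 <= sphere_mean t.
Proof.
rewrite mule_ge0//; apply: integral_ge0 => w _.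
by rewrite mule_ge0 ?shift_mean_ge0// lee_fin invr_ge0 powR_ge0.
Qed.

Lemma level_ge0 s : 0 <= level s.
Proof. exact: measure_ge0. Qed.

Lemma integral_clipped s0 s1 :
  \int[lebesgue_measure]_(s in `]s0, s1]) level s =
  \int[lebesgue_measure]_(v in `]0%R, +oo[) shell (clipped s0 s1) v.
Proof.
rewrite layer_cake integral_polar//; [exact: clipped_ge0|exact: measurable_clipped].
Qed.

(** For a large s2 >= s0, the integral of the level function over ]s2, s1] is at least
    B (ln s1 - ln s2).  In polar coordinates, shells with v <= 1/s1 contribute a bounded amount since the integrand is at most s1; shells up
    to radius delta contribute at most (A / N)(ln b + ln s1); the other shells do not contribute
    since s2 is large.  Let s1 tend to infinity. *)
Lemma level_ge_sphere_mean (A B delta s0 : R) : (0 < delta)%R -> (0 < s0)%R ->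
  (forall t, (0 < t <= delta)%R -> sphere_mean t <= A%:E) ->
  (forall s, (s0 <= s)%R -> B%:E <= s%:E * level s) ->
  (N%:R * B <= A)%R.
Proof.
move=> d0 s00 hA hB.
have A0 : (0 <= A)%R.
  by rewrite -lee_fin; apply: le_trans (sphere_mean_ge0 delta) (hA _ _); rewrite d0 lexx.
have [B0|B0] := ltP B 0%R; first by apply: le_trans A0; rewrite pmulr_rle0// ltW.
pose b := (delta ^+ N)%R; have b0 : (0 < b)%R by rewrite exprn_gt0.
(* beyond radius delta the quotient does not exceed s2 *)
pose s2 := Num.max s0 (M / delta `^ (r + N%:R))%R.
have s20 : (0 < s2)%R by rewrite lt_max s00.
pose L := fine (leb E); pose C := fine (cone_measure [set: 'rV[R]_N]).
suff : (B <= A / N%:R)%R by rewrite ler_pdivlMr// mulrC.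
apply: (@le_of_asymptotic R _ _ (- (B * ln s2))%R (L * C + A / N%:R * ln b)%R
  (* x is ln s1; the bound on x ensures s2 < s1 and 1/s1 < b *)
  (Num.max (ln s2) (- ln b) + 1)%R) => x xx.
have [x1 x2] : (ln s2 < x /\ - ln b < x)%R.
  by move: xx; rewrite -lerBrDr ge_max => /andP[h1 h2]; split; lra.
pose s1 := expR x; have s10 : (0 < s1)%R by exact: expR_gt0.
have s21 : (s2 < s1)%R by rewrite -[ltLHS]lnK ?posrE// ltr_expR.
pose a := (s1^-1)%R; have a0 : (0 < a)%R by rewrite invr_gt0.
have ab : (a < b)%R by rewrite /a /s1 -expRN -[ltRHS]lnK ?posrE// ltr_expR ltrNl.
have lna : ln a = (- x)%R by rewrite lnV ?posrE// expRK.
have K0 := clipped_ge0 s2 s1; have mK := measurable_clipped s2 s1.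
have mh := measurable_shell K0 mK.
have h0 v : 0 <= shell (clipped s2 s1) v by exact: shell_ge0.
have lower : (B * (x - ln s2))%:E <= \int[lebesgue_measure]_(s in `]s2, s1]) level s.
  have := integral_reciprocal B s20 s21; rewrite expRK => <-.
  apply: ge0_le_integral => //.
  - by move=> s; rewrite /= in_itv /= => /andP[s2s _]; rewrite lee_fin divr_ge0// ltW// (lt_trans s20).
  - apply/measurable_EFinP; apply: measurable_funM => //.
    exact: measurable_funS (@measurable_inv R).
  - exact: measurable_funS measurable_level.
  - move=> s; rewrite /= in_itv /= => /andP[s2s _]; have sp := lt_trans s20 s2s.
    rewrite mulrC EFinM lee_pdivrMl//; apply: hB.
    by apply: ltW; apply: le_lt_trans s2s; rewrite le_max lexx.
have upper1 : \int[lebesgue_measure]_(v in `]0%R, a]) shell (clipped s2 s1) v <= (L * C)%:E.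
  apply: (@le_trans _ _ (\int[lebesgue_measure]_(v in `]0%R, a]) cst (s1 * L * C)%:E v)).
    apply: ge0_le_integral => //.
    - exact: measurable_funS mh.
    - move=> v; rewrite /= in_itv /= => /andP[v0 _].
      rewrite !EFinM !fineK// -(shell_cst _ v); apply: le_shell => //.
        by move=> z; rewrite mule_ge0// lee_fin ltW.
      by move=> z _; apply: clipped_le_top; exact: ltW.
  rewrite integral_itv_cst// lee_fin subr0.
  rewrite [leLHS](_ : _ = L * C)%R//; by rewrite /a; field; rewrite gt_eqF.
have upper2 : \int[lebesgue_measure]_(v in `]a, b]) shell (clipped s2 s1) v <=
    (A / N%:R * (ln b + x))%:E.
  have := integral_reciprocal (A / N%:R) a0 ab; rewrite lna opprK => <-.
  apply: ge0_le_integral => //.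
  - exact: measurable_funS mh.
  - apply/measurable_EFinP; apply: measurable_funM => //.
    exact: measurable_funS (@measurable_inv R).
  - move=> v; rewrite /= in_itv /= => /andP[av vb]; have v0 := lt_trans a0 av.
    apply: (@le_trans _ _ (shell weighted v)).
      by apply: le_shell => // z _; apply: clipped_le; exact: ltW.
    rewrite shell_weighted// -mulrA -invfM [(A * _)%R]mulrC EFinM; apply: lee_wpmul2l.
      by rewrite lee_fin invr_ge0 mulr_ge0// ltW.
    apply: hA; rewrite root_radius_gt0//= -(@root_radiusX R k _ (ltW d0)) ge0_ler_powR ?nnegrE ?invr_ge0//.
    + exact: ltW.
    + exact: ltW.
have upper3 : \int[lebesgue_measure]_(v in `]b, +oo[) shell (clipped s2 s1) v = 0.
  apply: integral0_eq => v; rewrite /= in_itv /= andbT => bv; have v0 := lt_trans b0 bv.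
  apply/eqP; rewrite eq_le h0 andbT.
  rewrite -(mul0e (cone_measure [set: 'rV[R]_N])) -(shell_cst 0 v); apply: le_shell => // z zv.
  rewrite clipped_eq0//; apply: (@le_trans _ _ (M / delta `^ (r + N%:R))%R).
    by apply: radial_weight_le => //; rewrite zv; apply: le_root_radius => //; exact: ltW.
  by rewrite le_max lexx orbT.
have := lower; rewrite integral_clipped.
have -> : `]0%R, +oo[%classic = `]0%R, a] `|` (`]a, b] `|` `]b, +oo[) :> set (measurableTypeR R).
  apply/seteqP; split => v; rewrite /= !in_itv /= ?andbT.
    move=> ->; have [va|va] := leP v a; first by left.
    by right; have [vb|vb] := leP v b; [left|right].
  move=> [/andP[//]|[/andP[av _]|bv]]; first exact: lt_trans av.
  exact: lt_trans bv.
rewrite ge0_integral_setU//; last 3 first.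
- by apply: measurableU; exact: measurable_itv.
- exact: measurable_funS mh.
- apply/disj_setPS => y [] /=; rewrite !in_itv /= andbT => /andP[_ ya] [/andP[ay _]|].
    by have := le_lt_trans ya ay; rewrite ltxx.
  by move=> by'; have := le_lt_trans ya (lt_trans ab by'); rewrite ltxx.
rewrite ge0_integral_setU//; last 2 first.
- exact: measurable_funS mh.
- apply/disj_setPS => y [] /=; rewrite !in_itv /= andbT => /andP[_ yb] by'.
  by have := le_lt_trans yb by'; rewrite ltxx.
rewrite upper3 adde0 => /le_trans/(_ (leeD upper1 upper2)).
rewrite -EFinD lee_fin; lra.
Qed.

(** The integral of the level function over ]s0, s1] is at most B (ln s1 - ln s0).  Let ta be the radius
    beyond which the quotient cannot exceed s1.  Shells between the radii ta and delta are truncated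
    by at most s0 and contribute at least (A / N) N (ln delta - ln ta) up to a constant, where
    ln ta is - ln s1 / (r + N) up to a constant.  Let s1 tend to infinity. *)
Lemma level_le_sphere_mean (A B delta s0 : R) : (0 < delta)%R -> (0 < s0)%R ->
  (forall t, (0 < t <= delta)%R -> A%:E <= sphere_mean t) ->
  (forall s, (s0 <= s)%R -> s%:E * level s <= B%:E) ->
  (A <= (N%:R + r) * B)%R.
Proof.
move=> d0 s00 hA hB.
have B0 : (0 <= B)%R.
  rewrite -lee_fin; apply: le_trans (hB s0 (lexx _)).
  by rewrite mule_ge0 ?level_ge0// lee_fin ltW.
have [A0|A0] := ltP A 0%R.
  by apply: (le_trans (ltW A0)); rewrite mulr_ge0// addr_ge0.
pose b := (delta ^+ N)%R; have b0 : (0 < b)%R by rewrite exprn_gt0.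
pose L := fine (leb E); pose C := fine (cone_measure [set: 'rV[R]_N]).
have L0 : (0 <= L)%R by rewrite fine_ge0.
have C0 : (0 <= C)%R by rewrite fine_ge0.
(* M may be 0, and the logarithm of a positive bound is used *)
pose e := (r + N%:R)%R; pose m := ln (M + 1).
have M1 : (0 < M + 1)%R by rewrite ltr_wpDl.
suff : (A / e <= B)%R by rewrite ler_pdivrMr// mulrC addrC.
apply: (@le_of_asymptotic R _ _ (A / N%:R * ln b - A / e * m)%R (s0 * L * C * b - B * ln s0)%R
  (Num.max (ln s0) (m - e / N%:R * ln b) + 1)%R) => x xx.
have [x1 x2] : (ln s0 < x /\ m - e / N%:R * ln b < x)%R.
  by move: xx; rewrite -lerBrDr ge_max => /andP[h1 h2]; split; lra.
pose s1 := expR x; have s10 : (0 < s1)%R by exact: expR_gt0.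
have s01 : (s0 < s1)%R by rewrite -[ltLHS]lnK ?posrE// ltr_expR.
pose ta := expR ((m - x) / e); have ta0 : (0 < ta)%R by exact: expR_gt0.
pose a := (ta ^+ N)%R; have a0 : (0 < a)%R by rewrite exprn_gt0.
have lna : ln a = (N%:R * ((m - x) / e))%R by rewrite /a lnXn// expRK mulr_natl.
have ab : (a < b)%R.
  rewrite -[ltLHS]lnK ?posrE// -[ltRHS]lnK ?posrE// ltr_expR lna.
  rewrite mulrA ltr_pdivrMr// mulrC -ltr_pdivlMr//.
  by move: x2; rewrite -[(ln b * e / _)%R]mulrA [(ln b * _)%R]mulrC; lra.
have K0 := clipped_ge0 s0 s1; have mK := measurable_clipped s0 s1.
have mh := measurable_shell K0 mK.
have h0 v : 0 <= shell (clipped s0 s1) v by exact: shell_ge0.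
have upper : \int[lebesgue_measure]_(s in `]s0, s1]) level s <= (B * (x - ln s0))%:E.
  have := integral_reciprocal B s00 s01; rewrite expRK => <-.
  apply: ge0_le_integral => //.
  - exact: measurable_funS measurable_level.
  - apply/measurable_EFinP; apply: measurable_funM => //.
    exact: measurable_funS (@measurable_inv R).
  - move=> s; rewrite /= in_itv /= => /andP[s0s _]; have sp := lt_trans s00 s0s.
    by rewrite mulrC EFinM lee_pdivlMl//; apply: hB; exact: ltW.
have c0 : 0 <= (s0 * L * C)%:E by rewrite lee_fin !mulr_ge0// ltW.
have lower : (A / N%:R * (ln b - ln a))%:E <=
    \int[lebesgue_measure]_(v in `]a, b]) shell (clipped s0 s1) v + (s0 * L * C * (b - a))%:E.
  rewrite -(integral_reciprocal (A / N%:R) a0 ab).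
  have -> : (s0 * L * C * (b - a))%:E = \int[lebesgue_measure]_(v in `]a, b]) cst (s0 * L * C)%:E v.
    by rewrite integral_itv_cst.
  rewrite -ge0_integralD//; last exact: measurable_funS mh.
  apply: ge0_le_integral => //.
  - move=> v; rewrite /= in_itv /= => /andP[av _].
    by rewrite lee_fin !divr_ge0// ltW// (lt_trans a0).
  - apply/measurable_EFinP; apply: measurable_funM => //.
    exact: measurable_funS (@measurable_inv R).
  - by apply: emeasurable_funD => //; exact: measurable_funS mh.
  - move=> v; rewrite /= in_itv /= => /andP[av vb]; have v0 := lt_trans a0 av.
    apply: (@le_trans _ _ (shell weighted v)).
      rewrite shell_weighted// -mulrA -invfM [(A * _)%R]mulrC EFinM; apply: lee_wpmul2l.
        by rewrite lee_fin invr_ge0 mulr_ge0// ltW.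
      apply: hA; rewrite root_radius_gt0//= -(@root_radiusX R k _ (ltW d0)) ge0_ler_powR ?nnegrE ?invr_ge0//.
      + exact: ltW.
      + exact: ltW.
    have mc : measurable_fun [set: 'rV[R]_N] (fun=> s0%:E * leb E : \bar R) by exact: measurable_cst.
    apply: (@le_trans _ _ (shell (fun z => clipped s0 s1 z + s0%:E * leb E) v)).
      apply: le_shell => //.
      * by move=> z; rewrite adde_ge0 ?K0// mule_ge0// lee_fin ltW.
      * exact: emeasurable_funD.
      * move=> z zv; apply: le_clipped; first exact: ltW.
        apply: (@le_trans _ _ (M / ta `^ e)%R).
          by apply: radial_weight_le => //; rewrite zv; apply: le_root_radius => //; exact: ltW.
        have -> : (ta `^ e = (M + 1) / s1)%R.
          rewrite /powR gt_eqF// expRK mulrC divfK ?gt_eqF// expRB /m lnK//.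
        by rewrite ler_pdivrMr ?divr_gt0// mulrC divfK ?gt_eqF// lerDl.
    by rewrite shell_addcst ?EFinM ?fineK// mule_ge0// lee_fin ltW.
have sub : \int[lebesgue_measure]_(v in `]a, b]) shell (clipped s0 s1) v <=
    \int[lebesgue_measure]_(s in `]s0, s1]) level s.
  rewrite integral_clipped; apply: ge0_subset_integral => //.
    exact: measurable_funS mh.
  move=> v; rewrite /= !in_itv /= andbT => /andP[av _]; exact: lt_trans av.
have := le_trans lower (leeD2r _ (le_trans sub upper)).
rewrite -EFinD lee_fin lna.
have : (0 <= s0 * L * C * a)%R by rewrite !mulr_ge0// ltW.
have -> : (A / N%:R * (ln b - N%:R * ((m - x) / e)) = A / N%:R * ln b - A / e * (m - x))%R.
  by rewrite mulrBr; congr (_ - _)%R; rewrite [LHS]mulrA divfK ?gt_eqF// mulrA mulrAC.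
lra.
Qed.

End slicing.

(** * Borel representatives *)

Section regularity.
Local Open Scope ereal_scope.
Context {R : realType} {n : nat}.
Implicit Types (A D Z : set 'rV[R]_n).

(** Intersect countably many covers by boxes, of total volumes tending to the outer measure. *)
Lemma borel_hull A : exists H, [/\ measurable H, A `<=` H & leb H = lebesgue_outer A].
Proof.
have [Aoo|Afin] := eqVneq (lebesgue_outer A) +oo.
  exists setT; split => //; apply/eqP; rewrite Aoo -leye_eq -Aoo.
  exact: (le_outer_measure (@lebesgue_outer R n)).
have {}Afin : lebesgue_outer A \is a fin_num.
  by rewrite ge0_fin_numE ?ltey// outer_measure_ge0.
have [F FP] : {F : nat -> nat -> option ('rV[R]_n * 'rV[R]_n) & forall j,
    countable_cover [set ab : 'rV[R]_n * 'rV[R]_n | forall i, (ab.1 0 i <= ab.2 0 i)%R] (@box R n) A (F j) /\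
    \sum_(k <oo) oapp (@box_volume R n) 0 (F j k) < lebesgue_outer A + (j.+1%:R^-1)%:E}.
  apply: (@choice _ _ (fun j G => countable_cover _ (@box R n) A G /\
    \sum_(k <oo) oapp (@box_volume R n) 0 (G k) < lebesgue_outer A + (j.+1%:R^-1)%:E)) => j.
  have e0 : (0 < j.+1%:R^-1 :> R)%R by [].
  by have [_ [G cG <-] ltG] := lb_ereal_inf_adherent e0 Afin; exists G.
pose U j := \bigcup_k oapp (@box R n) set0 (F j k).
have mB j k : measurable (oapp (@box R n) set0 (F j k)).
  by case: (F j k) => [ab|] //=; exact: measurable_box.
have mU j : measurable (U j) by apply: bigcup_measurable => k _; exact: mB.
exists (\bigcap_j U j); split; first exact: bigcap_measurable.
  by move=> x Ax j _; have [[_ +] _] := FP j; exact.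
apply/eqP; rewrite eq_le; apply/andP; split; last first.
  by apply: (le_outer_measure (@lebesgue_outer R n)) => x Ax j _; have [[_ +] _] := FP j; exact.
apply/lee_addgt0Pr => e e0.
pose j := Num.truncn e^-1.
have je : (j.+1%:R^-1 <= e)%R.
  by rewrite invf_ple ?posrE//; apply/ltW; rewrite truncnS_gt.
apply: (@le_trans _ _ (lebesgue_outer A + (j.+1%:R^-1)%:E)); last by rewrite leeD2l.
have [[DF _] /ltW] := FP j; apply: le_trans.
apply: (@le_trans _ _ (lebesgue_outer (U j))).
  by apply: (le_outer_measure (@lebesgue_outer R n)); exact: bigcap_inf.
apply: (le_trans (outer_measure_sigma_subadditive (@lebesgue_outer R n) _)).
apply: lee_nneseries => k _; first by move=> _; exact: outer_measure_ge0.
case Ek : (F j k) => [ab|] //=; last by rewrite outer_measure0.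
exact/lebesgue_outer_box_le/(DF k).
Qed.

Lemma null_borel_hull A : lebesgue_outer A = 0 ->
  exists Z, [/\ measurable Z, A `<=` Z & leb Z = 0].
Proof. by move=> A0; have [H [mH AH]] := borel_hull A; rewrite A0 => H0; exists H. Qed.

Lemma null_caratheodory A : lebesgue_outer A = 0 -> lebesgue_outer.-caratheodory A.
Proof.
move=> A0; apply: le_caratheodory_measurable => X.
rewrite [X in X + _](_ : _ = 0) ?add0e; first by apply: le_outer_measure => x [].
apply/eqP; rewrite eq_le outer_measure_ge0 andbT -A0.
by apply: le_outer_measure => x [].
Qed.

(** The hull of A exceeds A by a null set, which has a null Borel hull Z.  Outside Z, the set A and its
    hull coincide. *)
Lemma caratheodory_borel A : lebesgue_outer.-caratheodory A -> lebesgue_outer A < +oo ->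
  exists Z, [/\ measurable Z, leb Z = 0 & measurable (A `\` Z)].
Proof.
move=> cA Aoo; have [H [mH AH HA]] := borel_hull A.
have HA0 : lebesgue_outer (H `\` A) = 0.
  have := cA H; rewrite (setIidr AH) -setDE.
  rewrite -[X in X = _]/(leb H) HA.
  have : lebesgue_outer A \is a fin_num by rewrite ge0_fin_numE ?outer_measure_ge0.
  have := @outer_measure_ge0 _ _ (@lebesgue_outer R n) (H `\` A).
  case: (lebesgue_outer A) => [y| |]//; case: (lebesgue_outer _) => [z| |]//= _ _ [e].
  by congr EFin; lra.
have [Z [mZ HAZ Z0]] := null_borel_hull HA0.
exists Z; split => //; rewrite (_ : A `\` Z = H `\` Z); first exact: measurableD.
apply/seteqP; split => x [Hx Zx]; split => //; first exact: AH.
by apply: contrapT => Ax; apply: Zx; apply: HAZ.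
Qed.

Lemma null_bigcup (Z : nat -> set 'rV[R]_n) : (forall j, leb (Z j) = 0) -> leb (\bigcup_j Z j) = 0.
Proof.
move=> Z0; apply/eqP; rewrite eq_le measure_ge0 andbT.
apply: (le_trans (outer_measure_sigma_subadditive (@lebesgue_outer R n) _)).
by rewrite eseries0// => j _ _; exact: Z0.
Qed.

(** It suffices to modify the superlevel sets at the countably many rational levels. *)
Lemma measurable_fun_borel (f : 'rV[R]_n -> R) D : measurable D -> lebesgue_outer D < +oo ->
  measurable_fun (D : set (lebesgue_type R n)) (f : lebesgue_type R n -> R) ->
  exists Z, [/\ measurable Z, leb Z = 0 & measurable_fun (D `\` Z) f].
Proof.
move=> mD Doo mf.
pose A (c : rat) := D `&` [set x | (ratr c < f x)%R].
have cA c : lebesgue_outer.-caratheodory (A c).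
  have := mf (lebesgue_outer_borel mD) _ (measurable_itv `]ratr c : R, +oo[).
  by congr caratheodory_measurable; apply/seteqP; split => x [Dx]; rewrite /A /= in_itv /= andbT.
have [Z ZP] : {Z : rat -> set 'rV[R]_n & forall c,
    [/\ measurable (Z c), leb (Z c) = 0 & measurable (A c `\` Z c)]}.
  apply: (@choice _ _ (fun c Y => [/\ measurable Y, leb Y = 0 & measurable (A c `\` Y)])) => c.
  apply: caratheodory_borel => //; apply: le_lt_trans Doo.
  by apply: le_outer_measure => x [].
pose Y := \bigcup_j Z (odflt 0%R (unpickle j)).
have ZY c : Z c `<=` Y by move=> x Zx; exists (pickle c) => //; rewrite pickleK.
have mY : measurable Y by apply: bigcup_measurable => j _; have [] := ZP (odflt 0%R (unpickle j)).
exists Y; split => //.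
  by apply: null_bigcup => j; have [] := ZP (odflt 0%R (unpickle j)).
apply: (measurability _ (RGenOInfty.measurableE R)) => // _ [_ [c ->] <-].
rewrite (_ : _ `&` _ = \bigcup_(a in [set a : rat | (c < ratr a)%R]) ((A a `\` Z a) `\` Y)).
  rewrite bigcup_mkcond; apply: bigcupT_measurable_rat => a; case: ifP => // _.
  by apply: measurableD => //; have [] := ZP a.
apply/seteqP; split => x.
  rewrite /= in_itv /= andbT => -[[Dx Yx] cx].
  have [a] := rat_in_itvoo cx; rewrite in_itv /= => /andP[ca ax].
  exists a => //; do 2 split => //; last by move=> /ZY.
by move=> [a /= ca [[[Dx ax] _] Yx]]; rewrite in_itv /= andbT; split => //; exact: lt_trans ax.
Qed.

End regularity.

(** The exceptional null sets of the coordinates and of the essential bound are put together. *)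
Lemma Linfty_borel (R : realType) (N m : nat) (Omega : set 'rV[R]_N) (u : 'rV[R]_N -> 'rV[R]_m) :
  measurable Omega -> (lebesgue_outer Omega < +oo)%E -> Linfty Omega u ->
  exists Z M, [/\ measurable Z, leb Z = 0%E, 0 <= M, measurable_fun (Omega `\` Z) u &
    forall x, (Omega `\` Z) x -> enorm (u x) <= M].
Proof.
move=> mO Ooo [mu supu].
have [Z ZP] : {Z : 'I_m -> set 'rV[R]_N & forall j, [/\ measurable (Z j), leb (Z j) = 0%E &
    measurable_fun (Omega `\` Z j) (fun x => u x 0 j)]}.
  apply: (@choice _ _ (fun j Y => [/\ measurable Y, leb Y = 0%E &
    measurable_fun (Omega `\` Y) (fun x => u x 0 j)])) => j.
  exact: measurable_fun_borel.
pose Z1 := \big[setU/set0]_(j < m) Z j.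
have [mZ1 Z10] : measurable Z1 /\ leb Z1 = 0%E.
  apply: (big_ind (fun A => measurable A /\ leb A = 0%E)); first by rewrite measure0.
    move=> A B [mA A0] [mB B0]; split; first exact: measurableU.
    by rewrite measureU0.
  by move=> j _; have [] := ZP j.
pose M := Num.max 0 (fine (ess_sup (lebesgue R N) (EFin \o ((enorm \o u) \_ Omega)))).
have [B [mB B0 BM]] : exists B, [/\ lebesgue_outer.-caratheodory B, lebesgue_outer B = 0%E &
    forall x, Omega x -> ~ B x -> enorm (u x) <= M].
  have : (ess_sup (lebesgue R N) (EFin \o ((enorm \o u) \_ Omega)) <= M%:E)%E.
    rewrite /M; case: (ess_sup _ _) supu => [y| |]//= _; rewrite ?leNye//.
    by rewrite lee_fin le_max lexx orbT.
  move=> /ess_supP [B [mB B0 sB]]; exists B; split => // x Ox Bx.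
  have := contra_notP (@sB x) Bx.
  by rewrite /= patchE mem_set// lee_fin.
have [Z2 [mZ2 BZ Z20]] := null_borel_hull B0.
exists (Z1 `|` Z2), M; split.
- exact: measurableU.
- by rewrite measureU0.
- by rewrite le_max lexx.
- apply/measurable_fun_rVP; first by apply: measurableD => //; exact: measurableU.
  move=> j; have [_ _ mj] := ZP j; apply: measurable_funS mj.
    by apply: measurableD => //; have [] := ZP j.
  move=> x [Ox Zx]; split => // Zjx; apply: Zx; left.
  by rewrite /Z1 -bigcup_seq; exists j => //=; rewrite mem_index_enum.
- move=> x [Ox Zx]; apply: BM => // Bx; apply: Zx; right; exact: BZ.
Qed.

(** * The two sides for a bounded measurable function *)

Section lebesgue_borel.
Local Open Scope ereal_scope.
Context {R : realType} {n : nat}.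

Lemma measurable_id_lebesgue :
  measurable_fun setT (id : lebesgue_type R n -> 'rV[R]_n).
Proof. by move=> _ A mA; rewrite setTI; exact: lebesgue_outer_borel. Qed.

Lemma integral_lebesgue_leb (g : 'rV[R]_n -> \bar R) (D : set 'rV[R]_n) :
  measurable D -> (forall x, 0 <= g x) -> measurable_fun setT g ->
  \int[lebesgue R n]_(x in D) g x = \int[leb]_(x in D) g x.
Proof.
move=> mD g0 mg.
have := @ge0_integral_pushforward _ _ _ _ R _ measurable_id_lebesgue (lebesgue R n) D g mD
  (measurable_funS measurableT (@subsetT _ _) mg).
rewrite preimage_id /= => <-//.
Qed.

(** Null sets being Caratheodory measurable, f is Caratheodory measurable; it may then be replaced by g. *)
Lemma integral_lebesgue_borel (f g : 'rV[R]_n -> \bar R) (D Z : set 'rV[R]_n) :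
  measurable D -> measurable Z -> leb Z = 0 ->
  (forall x, D x -> 0 <= f x) -> (forall x, 0 <= g x) -> measurable_fun setT g ->
  (forall x, D x -> ~ Z x -> f x = g x) ->
  \int[lebesgue R n]_(x in D) f x = \int[leb]_(x in D) g x.
Proof.
move=> mD mZ Z0 f0 g0 mg fg.
have cD := lebesgue_outer_borel mD; have cZ := lebesgue_outer_borel mZ.
have mg' : measurable_fun setT (g : lebesgue_type R n -> \bar R).
  exact: (measurableT_comp mg measurable_id_lebesgue).
have mf : measurable_fun (D : set (lebesgue_type R n)) (f : lebesgue_type R n -> \bar R).
  move=> _ Y mY.
  rewrite (_ : D `&` f @^-1` Y = ((D `\` Z) `&` g @^-1` Y) `|` ((D `&` f @^-1` Y) `&` Z)).
    apply: measurableU.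
      apply: measurableI; first exact: measurableD.
      by rewrite -[X in measurable X]setTI; exact: mg'.
    apply: null_caratheodory; apply/eqP; rewrite eq_le outer_measure_ge0 andbT -[leRHS]Z0.
    exact: (le_outer_measure (@lebesgue_outer R n)).
  apply/seteqP; split => x /=.
    move=> [Dx Yx]; have [Zx|Zx] := pselect (Z x); first by right.
    by left; split => //; rewrite -fg.
  by move=> [[[Dx Zx] Yx]|[[]]//]; rewrite fg.
have mgD : measurable_fun (D : set (lebesgue_type R n)) (g : lebesgue_type R n -> \bar R).
  exact: measurable_funS mg'.
transitivity (\int[lebesgue R n]_(x in D `\` Z) f x); first exact: ge0_negligible_integral.
transitivity (\int[lebesgue R n]_(x in D `\` Z) g x).
  by apply: eq_integral => x; rewrite inE => -[Dx Zx]; exact: fg.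
transitivity (\int[lebesgue R n]_(x in D) g x); last exact: integral_lebesgue_leb.
by apply/esym; apply: ge0_negligible_integral.
Qed.

End lebesgue_borel.

(** Pairs with a point in the null set Z are discarded, which makes the function Borel. *)
Section oscillation.
Context {R : realType} {k m : nat}.
Let N := k.+1.
Variables (Omega Z : set 'rV[R]_N) (u : 'rV[R]_N -> 'rV[R]_m) (q r M : R).
Let E := Omega `\` Z.
Hypotheses (mO : measurable Omega) (Ooo : (lebesgue_outer Omega < +oo)%E)
  (mZ : measurable Z) (Z0 : leb Z = 0%E) (mu : measurable_fun E u)
  (uM : forall x, E x -> enorm (u x) <= M) (q1 : 1 <= q) (r0 : 0 <= r).

Definition oscillation (p : 'rV[R]_N * 'rV[R]_N) : R :=
  \1_E p.1 * \1_E p.2 * enorm (u p.2 - u p.1) `^ q.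

Let mE : measurable E. Proof. exact: measurableD. Qed.

Let oscE p : E p.1 -> E p.2 -> oscillation p = enorm (u p.2 - u p.1) `^ q.
Proof. by move=> E1 E2; rewrite /oscillation !indicE !mem_set// !mul1r. Qed.

Let indic0 p : ~ (E p.1 /\ E p.2) -> \1_E p.1 * \1_E p.2 = 0 :> R.
Proof.
move=> h; rewrite !indicE; have [E1|E1] := pselect (E p.1); last first.
  by rewrite (memNset E1) mul0r.
by have [E2|E2] := pselect (E p.2); [exfalso; apply: h|rewrite (memNset E2) mulr0].
Qed.

Let osc0 p : ~ (E p.1 /\ E p.2) -> oscillation p = 0.
Proof. by move=> /indic0 h; rewrite /oscillation h mul0r. Qed.

Lemma oscillation_ge0 p : 0 <= oscillation p.
Proof. by rewrite !mulr_ge0 ?powR_ge0. Qed.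

Lemma oscillation_le p : oscillation p <= (M + M) `^ q.
Proof.
have [[E1 E2]|h] := pselect (E p.1 /\ E p.2); last by rewrite osc0// powR_ge0.
rewrite oscE// ge0_ler_powR ?nnegrE ?enorm_ge0//.
- exact: le_trans q1.
- have := le_trans (enorm_ge0 _) (uM E1); by move=> ?; rewrite addr_ge0.
- by rewrite (le_trans (ler_enormD _ _))// enormN lerD ?uM.
Qed.

Lemma oscillation_out p : ~ E p.1 -> oscillation p = 0.
Proof. by move=> h; apply: osc0 => -[]. Qed.

Lemma measurable_oscillation : measurable_fun setT oscillation.
Proof.
pose v x := \1_E x *: u x.
have mv : measurable_fun setT v.
  apply/measurable_fun_rVP => // j.
  rewrite (_ : (fun t => v t 0 j) = (fun t => u t 0 j) \_ E).
    by apply/(measurable_restrictT _ mE); exact: (iffLR (measurable_fun_rVP _ mE) mu).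
  by apply/funext => t; rewrite /v mxE patchE indicE; case: ifP; rewrite ?mul1r ?mul0r.
have -> : oscillation = fun p => \1_E p.1 * \1_E p.2 * enorm (v p.2 - v p.1) `^ q.
  apply/funext => p; have [[E1 E2]|h] := pselect (E p.1 /\ E p.2).
    have vu x : E x -> v x = u x by move=> Ex; rewrite /v indicE mem_set// scale1r.
    by rewrite !vu.
  by rewrite (osc0 h) (indic0 h) mul0r.
apply: measurable_funM.
  by apply: measurable_funM; apply: measurableT_comp => //; exact: measurable_indic.
apply: (measurableT_comp (@measurable_powR R q)); apply: measurable_enorm => //.
apply: measurable_rV_D => //; first exact: (measurableT_comp mv).
by apply: measurable_rV_N => //; exact: (measurableT_comp mv).
Qed.

Lemma leb_domain_lty : (leb E < +oo)%E.
Proof. by apply: le_lt_trans Ooo; apply: (le_outer_measure (@lebesgue_outer R N)) => x []. Qed.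

(** For a fixed direction w, the integrands over Omega and over E differ only for x in Z and for x in Z
    translated by - eps w. *)
Lemma sphere_integralE eps : 0 < eps ->
  sphere_integral Omega u q r eps = sphere_mean oscillation r eps.
Proof.
move=> e0; rewrite /sphere_mean -integral_sphere; last 2 first.
- move=> w; rewrite mule_ge0//; first by rewrite lee_fin invr_ge0 powR_ge0.
  exact: shift_mean_ge0 oscillation_ge0 _.
- apply: emeasurable_funM => //; apply: measurable_ray_map.
  exact: measurable_shift_mean measurable_oscillation oscillation_ge0.
apply: eq_integral => w _; set z := eps *: w.
have mo : measurable_fun setT (fun x : 'rV[R]_N => (oscillation (x, x + z))%:E).
  apply/measurable_EFinP; apply: (measurableT_comp measurable_oscillation).
  by apply: measurable_fun_pair => //; exact: measurable_translate.
have mZz := measurable_preimage (measurable_translate z) mZ.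
rewrite (integral_lebesgue_borel (Z := Z `|` (fun x : 'rV[R]_N => x + z) @^-1` Z)
  (g := fun x : 'rV[R]_N => (((eps `^ r)^-1)%:E * (oscillation (x, x + z))%:E)%E))//.
- rewrite /shift_mean -ge0_integralZl//; last 2 first.
  + by move=> x _; rewrite lee_fin oscillation_ge0.
  + by rewrite lee_fin invr_ge0 powR_ge0.
  rewrite [LHS]integral_mkcond; apply: eq_integral => x _; rewrite patchE; case: ifPn => // xO.
  rewrite oscillation_out ?mule0// => -[Ox _].
  by rewrite mem_set in xO.
- exact: measurableU.
- by rewrite measureU0// [LHS](leb_translate z mZ).
- by move=> x _; rewrite lee_fin !mulr_ge0 ?invr_ge0 ?powR_ge0.
- by move=> x; rewrite -EFinM lee_fin mulr_ge0 ?oscillation_ge0// invr_ge0 powR_ge0.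
- exact: emeasurable_funM.
- move=> x Ox /not_orP[Zx Zxz]; rewrite -EFinM; congr EFin.
  rewrite indicE; have [xzO|xzO] := pselect (Omega (x + z)).
    by rewrite mem_set// mul1r oscE//= mulrC.
  by rewrite memNset// mul0r osc0 ?mulr0// => -[_ []].
Qed.

(** The pairs with a point in Z form a null set, and y = x + z is a translation for fixed x. *)
Lemma scaled_measureE s : 0 <= s ->
  scaled_measure Omega u q r s = (s%:E * level oscillation r s)%E.
Proof.
move=> s0; rewrite /scaled_measure; congr (_ * _)%E.
pose Y := [set z : 'rV[R]_(N + N) | Z (lsubmx z) \/ Z (rsubmx z)].
pose X := [set z : 'rV[R]_(N + N) |
  s < oscillation (lsubmx z, rsubmx z) * radial_weight r (rsubmx z - lsubmx z)].
have ml : measurable_fun setT (fun z : 'rV[R]_(N + N) => lsubmx z).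
  by apply/measurable_fun_rVP => // i; under eq_fun do rewrite mxE; exact: measurable_coord.
have mr : measurable_fun setT (fun z : 'rV[R]_(N + N) => rsubmx z).
  by apply/measurable_fun_rVP => // i; under eq_fun do rewrite mxE; exact: measurable_coord.
have mY : measurable Y.
  by apply: measurableU; [exact: measurable_preimage ml mZ|exact: measurable_preimage mr mZ].
have mX : measurable X.
  rewrite -[X in measurable X]setTI; apply: measurable_fun_ltr => //.
  apply: measurable_funM.
    by apply: (measurableT_comp measurable_oscillation); exact: measurable_fun_pair.
  apply: (measurableT_comp (measurable_radial_weight r)).
  by apply: measurable_rV_D => //; exact: measurable_rV_N.
have Y0 : leb Y = 0%E.
  rewrite leb_row_mx// /pushforward.
  rewrite (_ : _ @^-1` _ = (Z `*` setT) `|` (setT `*` Z)); last first.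
    by apply/seteqP; split => -[x y]; rewrite /Y /= row_mxKl row_mxKr; tauto.
  rewrite measureU0; [|exact: measurableX|exact: measurableX|].
    by rewrite [LHS](product_measure1E _ _ mZ measurableT) [X in (X * _)%E]Z0 mul0e.
  by rewrite [LHS](product_measure1E _ _ measurableT mZ) [X in (_ * X)%E]Z0 mule0.
have XE : X = superlevel Omega u q r s `\` Y.
  apply/seteqP; split => z; rewrite /X /Y /superlevel /=.
    have [[E1 E2]|h] := pselect (E (lsubmx z) /\ E (rsubmx z)); last first.
      by rewrite osc0// mul0r ltNge s0.
    rewrite oscE// => sz; split; last by case: E1 E2 => _ ? [_ ?]; tauto.
    by split => //; [case: E1|case: E2].
  by move=> [[x_in y_in sz] /not_orP[xZ yZ]]; rewrite oscE.
transitivity (leb X).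
  rewrite XE; apply/esym; exact: (outer_measureD_null (mu := @lebesgue_outer R (N + N)) _ Y0).
rewrite [LHS](leb_row_mx mX).
change (\int[leb]_x leb (xsection ((fun p : 'rV[R]_N * 'rV[R]_N => row_mx p.1 p.2) @^-1` X) x) =
  \int[leb]_x leb (xsection [set p : 'rV[R]_N * 'rV[R]_N | (s < quotient oscillation r p)%R] x))%E.
have mX' : measurable ((fun p : 'rV[R]_N * 'rV[R]_N => row_mx p.1 p.2) @^-1` X).
  by apply: measurable_preimage mX; exact: measurable_row_mx.
apply: eq_integral => x _; rewrite -[LHS](leb_translate x); last exact: measurable_xsection.
have key z : X (row_mx x (z + x)) = (s < quotient oscillation r (x, z)).
  by rewrite /X /mkset /quotient row_mxKl row_mxKr (addrK x z) (addrC x z).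
apply: (congr1 (@leb R N)); apply/seteqP; split => z; rewrite /xsection.
  move=> xz; have {}xz : X (row_mx x (z + x)) by move: xz; rewrite /preimage /mkset inE.
  by rewrite /mkset inE /mkset -key.
rewrite /mkset inE /mkset -key => xz.
by rewrite /preimage /mkset inE.
Qed.

End oscillation.

(** * Passage to the limit *)

Section limits.
Context {R : realType}.
Implicit Types (f : R -> \bar R) (F : set (set R)) (V : set R) (x y : \bar R).
Local Open Scope ereal_scope.

Lemma lte_between x y : x < y -> exists2 a : R, x < a%:E & a%:E < y.
Proof.
case: x => [x| |]; case: y => [y| |]//.
- by rewrite lte_fin => xy; exists ((x + y) / 2)%R; rewrite lte_fin; lra.
- by move=> _; exists (x + 1)%R; rewrite ?ltry// lte_fin ltrDl.
- by move=> _; exists (y - 1)%R; rewrite ?ltNyr// lte_fin ltrBlDr ltrDl.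
- by move=> _; exists 0%R; rewrite ?ltry ?ltNyr.
Qed.

Lemma limf_esup_lt f F a : limf_esup f F < a ->
  exists2 V, F V & forall t, V t -> f t < a.
Proof.
move=> /ereal_inf_lt[_ [V FV <-] Va]; exists V => // t Vt.
by apply: le_lt_trans Va; apply: ereal_sup_ubound; exists t.
Qed.

Lemma limf_einf_gt f F a : a < limf_einf f F ->
  exists2 V, F V & forall t, V t -> a < f t.
Proof.
rewrite limf_einfE => /ereal_sup_gt[_ [V FV <-] Va]; exists V => // t Vt.
by apply: (lt_le_trans Va); apply: ereal_inf_lbound; exists t.
Qed.

Lemma at_right0P V : (0 : R)^'+ V ->
  exists2 d : R, (0 < d)%R & forall t, (0 < t <= d)%R -> V t.
Proof.
move=> [e /= e0 eV]; exists (e / 2)%R; first by rewrite divr_gt0.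
move=> t /andP[t0 te]; apply: eV => //=.
by rewrite sub0r normrN gtr0_norm//; lra.
Qed.

Lemma pinfty_nbhsP V : pinfty_nbhs R V ->
  exists2 s0 : R, (0 < s0)%R & forall s, (s0 <= s)%R -> V s.
Proof.
move=> [M [_ MV]]; exists (Num.max M 0 + 1)%R.
  by rewrite ltr_wpDl// le_max lexx orbT.
move=> s sM; apply: MV; apply: lt_le_trans sM.
by rewrite (@le_lt_trans _ _ (Num.max M 0))%R ?le_max ?lexx// ltrDl.
Qed.

End limits.

Lemma coord_le_norm (R : realType) n (x : 'rV[R]_n) i : `|x 0 i| <= `|x|.
Proof.
rewrite [leRHS]/Num.norm /= mx_normrE.
by have := @le_bigmax _ _ _ 0 (fun ij : 'I_1 * 'I_n => `|x ij.1 ij.2|) (0, i).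
Qed.

Lemma bounded_lebesgue_outer (R : realType) n (A : set 'rV[R]_n) :
  bounded_set A -> (lebesgue_outer A < +oo)%E.
Proof.
move=> [M [_ AM]].
pose b := `|M| + 1.
have b0 : 0 <= b by rewrite addr_ge0.
have Mb : M < b by rewrite (le_lt_trans (ler_norm M))// ltrDl.
apply: le_lt_trans (@leb_cball_lty R n (b * Num.sqrt n%:R)).
apply: (le_outer_measure (@lebesgue_outer R n)) => x Ax.
apply: enorm_le_coord => // i; apply: le_trans (coord_le_norm x i) _.
exact: AM.
Qed.

Theorem theorem1p5 (R : realType) (N m : nat) (N_gt0 : (0 < N)%N)
    (m_gt0 : (0 < m)%N) (Omega : set 'rV[R]_N) (domOmega : domain Omega)
    (bndOmega : bounded_set Omega) (q r : R) (q_ge1 : 1 <= q) (r_ge0 : 0 <= r)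
    (u : 'rV[R]_N -> 'rV[R]_m) (u_Linfty : Linfty Omega u) :
  (limf_einf (sphere_integral Omega u q r) (0 : R)^'+ <=
     (N%:R + r)%:E * limf_esup (scaled_measure Omega u q r) (pinfty_nbhs R))%E /\
  (N%:R%:E * limf_einf (scaled_measure Omega u q r) (pinfty_nbhs R) <=
     limf_esup (sphere_integral Omega u q r) (0 : R)^'+)%E.
Proof.
case: N N_gt0 Omega domOmega bndOmega u u_Linfty => [//|k] _ Omega [oO _] bO u Lu.
have mO := open_measurable_rV oO; have Ooo := bounded_lebesgue_outer bO.
have [Z [M [mZ Z0 M0 mu uM]]] := Linfty_borel mO Ooo Lu.
have mE : measurable (Omega `\` Z) by exact: measurableD.
have Eoo := leb_domain_lty Z Ooo.
pose F := oscillation Omega Z u q.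
have mF : measurable_fun setT F := measurable_oscillation q mO mZ mu.
have F0 p : 0 <= F p := oscillation_ge0 _ _ _ _ _.
have FM p : F p <= (M + M) `^ q := oscillation_le uM q_ge1 p.
have FE p : ~ (Omega `\` Z) p.1 -> F p = 0 := @oscillation_out _ _ _ _ _ _ _ _.
have sphereE t : 0 < t -> sphere_integral Omega u q r t = sphere_mean F r t.
  by move=> t0; exact: sphere_integralE.
have levelE s : 0 <= s -> scaled_measure Omega u q r s = (s%:E * level F r s)%E.
  by move=> s0; exact: scaled_measureE.
have N0 : 0 < k.+1%:R :> R by [].
have Nr0 : 0 < k.+1%:R + r by rewrite ltr_pwDl.
split; rewrite leNgt; apply/negP => /lte_between[A].
  rewrite -lte_pdivlMl// -EFinM => /limf_esup_lt[V /pinfty_nbhsP[s0 s00 sV] VB].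
  move=> /lte_between[A' AA' /limf_einf_gt[W /at_right0P[d d0 dW] WA]].
  have := @level_le_sphere_mean R k F (Omega `\` Z) ((M + M) `^ q) r mF F0 FM FE mE Eoo r_ge0
    A' ((k.+1%:R + r)^-1 * A) d s0 d0 s00.
  rewrite mulVKf ?gt_eqF// => h; suff : A' <= A by rewrite leNgt -lte_fin AA'.
  apply: h => [t /andP[t0 td]|s ss].
    by rewrite -sphereE//; apply/ltW/WA/dW; rewrite t0.
  by rewrite -levelE ?(ltW (lt_le_trans s00 ss))//; apply/ltW/VB/sV.
move=> /limf_esup_lt[W /at_right0P[d d0 dW] WA].
rewrite -lte_pdivrMl// -EFinM => /lte_between[B AB /limf_einf_gt[V /pinfty_nbhsP[s0 s00 sV] VB]].
have := @level_ge_sphere_mean R k F (Omega `\` Z) ((M + M) `^ q) r mF F0 FM FE mE Eoo r_ge0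
  A B d s0 d0 s00.
move=> h; suff : k.+1%:R * B <= A.
  by rewrite leNgt -ltr_pdivrMl// -lte_fin AB.
apply: h => [t /andP[t0 td]|s ss].
  by rewrite -sphereE//; apply/ltW/WA/dW; rewrite t0.
by rewrite -levelE ?(ltW (lt_le_trans s00 ss))//; apply/ltW/VB/sV.
Qed.
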